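(* Let $\alpha \in (0,1)$ and $\kappa_+, \kappa_- > 0$, and let $z_c > 0$ and $h_0$ be the associated jump position and limit profile (defined in the context). There exist $\varepsilon_0 > 0$ and two $C^1$ functions $\varepsilon \mapsto z_c(\varepsilon)$, $\varepsilon \mapsto a(\varepsilon)$ on $(0, \varepsilon_0)$ with $$z_c(\varepsilon) \to z_c, \qquad a(\varepsilon) \to \frac{h_0(z_c^-) - h_0(z_c^+)}{2} \qquad \text{as } \varepsilon \to 0,$$ such that for every $\varepsilon \in (0,\varepsilon_0)$ the solution $\mathbb{h}_\varepsilon$ of the ODE problem $$\left\{\begin{array}{l} \frac{\alpha}{1+\alpha} \mathbb{h}_\varepsilon + \left( \frac{z}{1+\alpha} - \mathbb{h}_\varepsilon \right) \partial_z \mathbb{h}_\varepsilon + \varepsilon \partial_z^2 \mathbb{h}_\varepsilon = 0 \\ \mathbb{h}_\varepsilon(z_c(\varepsilon)) = \frac{z_c(\varepsilon)}{1+\alpha}, \quad \mathbb{h}_\varepsilon'(z_c(\varepsilon)) = \frac{-a(\varepsilon)^2}{2\varepsilon} \end{array}\right.$$ satisfies $$\mathbb{h}_\varepsilon(z) = \kappa_{\pm} |z|^{-\alpha} \left(1 + o_{z \to \pm\infty}(1)\right).$$ Furthermore, there exists $w_0 > 0$ depending only on $\alpha, \kappa_+, \kappa_-$ such that, writing $I_\varepsilon = \left[ z_c(\varepsilon) - w_0 \varepsilon \ln \frac1\varepsilon,\ z_c(\varepsilon) + w_0 \varepsilon \ln \frac1\varepsilon \right]$, $$\left\| \mathbb{h}_\varepsilon(z)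 - h_0(z_c^+) - \frac{2 a(\varepsilon) e^{-a(\varepsilon) \left( \frac{z - z_c(\varepsilon)}{\varepsilon} \right)}}{1 + e^{-a(\varepsilon) \left( \frac{z - z_c(\varepsilon)}{\varepsilon} \right)}} \right\|_{L^\infty(I_\varepsilon)} \to 0$$ and $$\left\| (1 + |z|)^\alpha (\mathbb{h}_\varepsilon - h_0)(z) \right\|_{L^\infty(\mathbb{R} \setminus I_\varepsilon)} \to 0$$ as $\varepsilon \to 0$. Finally, there is a constant $K > 0$ independent of $\varepsilon$ with $$|\partial_\varepsilon z_c(\varepsilon)| + |\partial_\varepsilon a(\varepsilon)| \leq K \left( \ln \frac1\varepsilon \right)^2 .$$
   Context: Definition of $z_c$ and $h_0$. Given $\alpha \in (0,1)$ and $\kappa_+,\kappa_->0$, there is a unique pair $(z_c, a)$ with $z_c > 0$, $\frac{\alpha}{1+\alpha} z_c < a < \frac{z_c}{1+\alpha}$, and a unique function $h_0 \in C^\infty(\mathbb{R}\setminus\{z_c\}, (0,+\infty))$ such that $\frac{\alpha}{1+\alpha} h_0 + \left( \frac{z}{1+\alpha} - h_0 \right) \partial_z h_0 = 0$ on $\mathbb{R} \setminus \{z_c\}$, $h_0(z_c^+) = \frac{z_c}{1+\alpha} - a$, $h_0(z_c^-) = \frac{z_c}{1+\alpha} + a$, and $h_0(z) = \kappa_\pm |z|^{-\alpha}(1 + o_{z \to \pm\infty}(1))$. Here $h_0(z_c^{\pm}) = \lim_{\nu \to 0^+} h_0(z_c \pm \nu)$. (In particular $a = \frac{h_0(z_c^-)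 - h_0(z_c^+)}{2}$ and the Rankine–Hugoniot condition $\frac12(h_0(z_c^+) + h_0(z_c^-)) = \frac{z_c}{1+\alpha}$ holds.) Explicitly, $(z_c,a)$ is determined by $\kappa_+ = \left(\frac{z_c}{1+\alpha} - a\right)\left(\frac{\alpha}{1+\alpha}z_c + a\right)^\alpha$ and $\kappa_- = \left(\frac{z_c}{1+\alpha} + a\right)\left(a - \frac{\alpha}{1+\alpha}z_c\right)^\alpha$. *)

(* Defs.v *)
From Stdlib Require Import Reals.
From Coquelicot Require Import Coquelicot.
Open Scope R_scope.

(** [h z = kappa |z|^(-alpha) (1 + o(1))] as [z] tends to [l], where [l] is
    [p_infty] or [m_infty]. [Rpower 0 _] is a junk value, but it is only met at
    [z = 0], which no small enough neighbourhood of [l] contains. *)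
Definition power_tail (alpha kappa : R) (l : Rbar) (h : R -> R) : Prop :=
  exists o : R -> R,
    is_lim o l 0 /\
    Rbar_locally l (fun z => h z = kappa * Rpower (Rabs z) (- alpha) * (1 + o z)).

(** The value of [h0] at [zc] is left unconstrained: [h0] stands for a function
    on the line deprived of [zc]. *)
Definition limit_profile (alpha kp km zc a : R) (h0 : R -> R) : Prop :=
  0 < zc /\
  alpha / (1 + alpha) * zc < a < zc / (1 + alpha) /\
  (forall z, z <> zc -> 0 < h0 z) /\
  (forall (n : nat) z, z <> zc -> ex_derive_n h0 n z) /\
  (forall z, z <> zc ->
     alpha / (1 + alpha) * h0 z + (z / (1 + alpha) - h0 z) * Derive h0 z = 0) /\
  filterlim h0 (at_right zc) (locally (zc / (1 + alpha) - a)) /\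
  filterlim h0 (at_left zc) (locally (zc / (1 + alpha) + a)) /\
  power_tail alpha kp p_infty h0 /\
  power_tail alpha km m_infty h0.

(** Global classical solution of the viscous problem with data at [zc]. *)
Definition viscous_solution (alpha eps zc a : R) (h : R -> R) : Prop :=
  (forall z, ex_derive h z /\ ex_derive_n h 2 z) /\
  (forall z,
     alpha / (1 + alpha) * h z + (z / (1 + alpha) - h z) * Derive h z
       + eps * Derive_n h 2 z = 0) /\
  h zc = zc / (1 + alpha) /\
  Derive h zc = - a ^ 2 / (2 * eps).

Definition C1_on (A : R -> Prop) (f : R -> R) : Prop :=
  forall x, A x -> ex_derive f x /\ continuous (Derive f) x.

(** Lebesgue-null sets: countable covers by open intervals of arbitrarily small
    total length. *)
Definition null_set (N : R -> Prop) : Prop :=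
  forall delta : posreal, exists u v : nat -> R,
    (forall n, u n <= v n) /\
    (forall x, N x -> exists n, u n < x < v n) /\
    (forall m, sum_n (fun n => v n - u n) m <= delta).

(** Essential supremum of [|f|] over [A], with value [p_infty] when [f] is not
    essentially bounded on [A]. The constraint [0 <= M] makes it 0, and not
    [m_infty], when [A] is null. *)
Definition Linf_norm (A : R -> Prop) (f : R -> R) : Rbar :=
  Glb_Rbar (fun M => 0 <= M /\
    exists N, null_set N /\ forall x, A x -> ~ N x -> Rabs (f x) <= M).

(** Convergence to 0 of a nonnegative extended-real quantity as [eps -> 0+]. *)
Definition vanishes_at_0 (F : R -> Rbar) : Prop :=
  forall eta : posreal, at_right 0 (fun eps => Rbar_lt (F eps) eta).

Definition layer (w0 eps c z : R) : Prop :=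
  c - w0 * eps * ln (1 / eps) <= z <= c + w0 * eps * ln (1 / eps).

(* Main.v *)
Require Import Defs.
From Stdlib Require Import Reals Lra Lia Psatz IndefiniteDescription.
From Coquelicot Require Import Coquelicot.
Open Scope R_scope.

(** Write [l = 1/(1+alpha)], [g = (1-alpha)/(1+alpha) = 2l-1]. An antiderivative of
    the viscous equation is the Hamilton-Jacobi equation
    [g P = eps P'' + l z P' - P'^2 / 2] for a suitable potential [P] of [h = P']. As
    [g > 0] it has a maximum principle on the whole line ([max_principle],
    [growth_max_principle]), and most of the proof rests on it.

    _Existence._ The inviscid potential [P0], with [P0' = h0], has a concave corner at
    the jump. Rounding the corner with the stationary layer gives a function [Q] that
    satisfies the viscous equation up to [O(eps)] ([Q_residual]). Hence [Q - C eps] and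
    [Q + C eps] are a subsolution and a supersolution, and a solution lies between
    them: on bounded intervals by shooting for the Hopf-Cole transform
    [exp (- P / (2 eps))] ([potential_on_interval]), then on the line by monotone
    exhaustion ([potential_on_line]). So [|P - P0| <= C eps]. No parameter has to be
    tuned to the constants [kappa]: the tails of [h] follow, because
    [h - h0 = O(1/|z|)], which is smaller than [|z|^(-alpha)] ([power_tail_transfer]).

    _Shape._ The function [f = l z - h] solves the Riccati equation [eps f' = W - f^2 / 2]
    with [W] bounded below by a positive constant. It has exactly one zero, which
    defines [zc eps], and [h'] there defines [a eps]. The function [l z^2 / 2 - P] has
    its minimum at [zc eps] and is [O(eps)]-close to [l z^2 / 2 - P0], which has a corner
    at its minimum [zc0]; so [zc eps - zc0 = O(eps)] ([crossing_near]). Integrating the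
    Riccati equation from its zero gives the hyperbolic tangent in the layer, with error
    [O(y^2 / eps + |y|)] at distance [y] from [zc eps]; beyond it, [h - h0] is damped at a
    rate of order [(1 + |z|) / eps] ([half_line_estimates], [solution_facts_uniform]).
    This suffices for both norms.

    _Dependence on the viscosity._ A difference quotient [D] of [P] in [eps] satisfies
    an exact linear equation with source [P''], to which the maximum principle applies
    again. It shows that the quotients are bounded and converge as both viscosities
    tend to the same one ([quot_cauchy]), so that [zc] and [a] are of class C1. A
    direct bound of [D] would be of the order [1/eps] of the source. But [ln (K - P'')] is
    a supersolution of the linearized equation with a source comparable to [|P''|]
    ([log_super]), hence [D = O(ln (1/eps))]. Then [D' = O(ln (1/eps) / eps)] in the
    layer, where [f'] is of order [1/eps], so that [zc'] and [a'] are
    [O(ln (1/eps))] ([crossing_C1]). *)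

(** * Differential calculus on the line *)

Lemma is_derive_ed (f : R -> R) (x d : R) :
  is_derive f x d <->
  (forall e, 0 < e -> exists r, 0 < r /\ forall y, Rabs (y - x) < r ->
     Rabs (f y - f x - d * (y - x)) <= e * Rabs (y - x)).
Proof.
  rewrite is_derive_Reals. split.
  - intros H e He. destruct (H e He) as [r Hr]. exists r. split; [apply cond_pos|].
    intros y Hy. destruct (Req_dec y x) as [->|Hn].
    + replace (f x - f x - d * (x - x)) with 0 by ring.
      rewrite Rminus_diag, Rabs_R0. lra.
    + assert (Hyx : y - x <> 0) by lra.
      specialize (Hr (y - x) Hyx Hy).
      replace (x + (y - x)) with y in Hr by ring.
      replace (f y - f x - d * (y - x))
        with (((f y - f x) / (y - x) - d) * (y - x)) by (field; lra).
      rewrite Rabs_mult. apply Rmult_le_compat_r; [apply Rabs_pos|lra].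
  - intros H e He. destruct (H (e / 2)) as [r [Hr Hy]]; [lra|].
    exists (mkposreal r Hr). intros h Hh Hhr. simpl in Hhr.
    specialize (Hy (x + h)). replace (x + h - x) with h in Hy by ring.
    specialize (Hy Hhr).
    replace ((f (x + h) - f x) / h - d) with ((f (x + h) - f x - d * h) / h)
      by (field; lra).
    unfold Rdiv. rewrite Rabs_mult, Rabs_inv.
    assert (Hp : 0 < Rabs h) by (apply Rabs_pos_lt; lra).
    apply Rle_lt_trans with (e / 2); [|lra].
    apply Rmult_le_reg_r with (Rabs h); [lra|].
    rewrite Rmult_assoc, Rinv_l by lra. lra.
Qed.

Lemma continuous_ed (f : R -> R) (x : R) :
  continuous f x <->
  (forall e, 0 < e -> exists r, 0 < r /\ forall y, Rabs (y - x) < r ->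
     Rabs (f y - f x) < e).
Proof.
  unfold continuous. rewrite filterlim_locally. split.
  - intros H e He. destruct (H (mkposreal e He)) as [r Hr].
    exists r. split; [apply cond_pos|]. intros y Hy. exact (Hr y Hy).
  - intros H e. destruct (H e (cond_pos e)) as [r [Hr Hy]].
    exists (mkposreal r Hr). intros y Hyr. exact (Hy y Hyr).
Qed.

Lemma continuity_pt_of_continuous (f : R -> R) x :
  continuous f x -> continuity_pt f x.
Proof. intros H. apply continuity_pt_filterlim. exact H. Qed.

Lemma continuous_of_derive (f : R -> R) x d : is_derive f x d -> continuous f x.
Proof. intros H. apply (ex_derive_continuous f). exists d. exact H. Qed.

Lemma der_const (k x : R) : is_derive (fun _ : R => k) x 0.
Proof. apply (is_derive_const k x). Qed.
Lemma der_id (x : R) : is_derive (fun y : R => y) x 1.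
Proof. apply (is_derive_id x). Qed.
Lemma der_plus (f g : R -> R) x a b :
  is_derive f x a -> is_derive g x b -> is_derive (fun y => f y + g y) x (a + b).
Proof. intros; now apply (is_derive_plus f g). Qed.
Lemma der_minus (f g : R -> R) x a b :
  is_derive f x a -> is_derive g x b -> is_derive (fun y => f y - g y) x (a - b).
Proof. intros; now apply (is_derive_minus f g). Qed.
Lemma der_opp (f : R -> R) x a :
  is_derive f x a -> is_derive (fun y => - f y) x (- a).
Proof. intros; now apply (is_derive_opp f). Qed.
Lemma der_mult (f g : R -> R) x a b :
  is_derive f x a -> is_derive g x b ->
  is_derive (fun y => f y * g y) x (a * g x + f x * b).
Proof. intros. apply (is_derive_mult f g); auto. intros; apply Rmult_comm. Qed.
Lemma der_scal (f : R -> R) k x a :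
  is_derive f x a -> is_derive (fun y => k * f y) x (k * a).
Proof. intros; now apply is_derive_scal. Qed.
Lemma der_divc (f : R -> R) k x a :
  is_derive f x a -> is_derive (fun y => f y / k) x (a / k).
Proof.
  intros H. evar_last. apply der_mult; [exact H|apply der_const]. unfold Rdiv. ring.
Qed.
Lemma der_comp (f g : R -> R) x a b :
  is_derive g x b -> is_derive f (g x) a -> is_derive (fun y => f (g y)) x (a * b).
Proof.
  intros. evar_last. apply (is_derive_comp f g); eauto. 
  unfold scal; simpl; unfold mult; simpl; ring.
Qed.
Lemma der_exp (g : R -> R) x b :
  is_derive g x b -> is_derive (fun y => exp (g y)) x (exp (g x) * b).
Proof. intros. apply (der_comp exp g); auto. apply is_derive_Reals, derivable_pt_lim_exp. Qed.
Lemma der_ln (g : R -> R) x b :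
  0 < g x -> is_derive g x b -> is_derive (fun y => ln (g y)) x (b / g x).
Proof.
  intros. evar_last. apply (der_comp ln g); eauto.
  apply is_derive_Reals, derivable_pt_lim_ln; auto. unfold Rdiv; ring.
Qed.
Lemma der_inv (g : R -> R) x b :
  g x <> 0 -> is_derive g x b -> is_derive (fun y => / g y) x (- b / (g x) ^ 2).
Proof. intros. now apply is_derive_inv. Qed.
Lemma der_div (f g : R -> R) x a b :
  g x <> 0 -> is_derive f x a -> is_derive g x b ->
  is_derive (fun y => f y / g y) x ((a * g x - f x * b) / (g x) ^ 2).
Proof. intros. apply (is_derive_div f g); auto. Qed.
Lemma der_sqr (f : R -> R) x a :
  is_derive f x a -> is_derive (fun y => f y ^ 2) x (2 * f x * a).
Proof.
  intros. apply is_derive_ext with (fun y => f y * f y); [intros t; change (@eq R (f t * f t) (f t ^ 2)); ring|].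
  evar_last; [apply der_mult; eassumption|ring].
Qed.

(** Succeeds when [f] is constant: a pattern [fun _ => ?k] would also accept a body
    that mentions a variable of the context with the name of the binder. *)
Ltac is_cst f :=
  let _ := constr:(fun X : R => ltac:(let t := eval cbv beta in (f X) in
    lazymatch t with context [X] => fail | _ => exact I end)) in idtac.

(** Differentiates an expression by its outermost operation. The hypotheses of
    the context give the derivatives of the unknown functions. *)
Ltac der_step :=
  lazymatch goal with
  | |- is_derive ?f _ _ =>
    tryif is_cst f then apply der_const else
    lazymatch f with
    | fun y => y => apply der_id
    | fun y => @?a y + @?b y => apply (der_plus a b)
    | fun y => @?a y - @?b y => apply (der_minus a b)
    | fun y => - @?a y => apply (der_opp a)
    | fun y => @?a y * @?b y => apply (der_mult a b)
    | fun y => @?a y / @?b y =>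
        tryif is_cst b
        then (let k := eval cbv beta in (b 0) in apply (der_divc a k))
        else apply (der_div a b)
    | fun y => @?a y ^ 2 => apply (der_sqr a)
    | fun y => exp (@?a y) => apply (der_exp a)
    | fun y => ln (@?a y) => apply (der_ln a)
    | fun y => / @?a y => apply (der_inv a)
    | _ =>
      first [ eassumption
            | match goal with
              | H : forall z, is_derive ?g z _ |- is_derive ?g _ _ => apply H
              | H : forall z, is_derive ?g z _ |- is_derive (fun y => ?g y) _ _ => apply H
              end ]
    end
  end.
Ltac der := evar_last; [ repeat der_step | ].

Lemma mean_value (f df : R -> R) a b :
  a < b -> (forall x, a <= x <= b -> is_derive f x (df x)) ->
  exists c, a < c < b /\ f b - f a = df c * (b - a).
Proof.
  intros Hab H. destruct (MVT_cor2 f df a b Hab) as [c [H1 H2]].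
  - intros c Hc. apply is_derive_Reals; auto.
  - exists c; auto.
Qed.

Lemma last_nonneg (u : R -> R) a b :
  a <= b -> (forall t, a <= t <= b -> continuous u t) -> 0 <= u a -> u b < 0 ->
  exists s, a <= s < b /\ u s = 0 /\ forall t, s < t <= b -> u t < 0.
Proof.
  intros Hab Hc Ha Hb.
  destruct (completeness (fun t => a <= t <= b /\ 0 <= u t)) as [s [Hs1 Hs2]].
  - exists b. intros t [Ht _]. lra.
  - exists a. split; lra.
  - assert (Has : a <= s) by (apply Hs1; split; lra).
    assert (Hsb : s <= b) by (apply Hs2; intros t [Ht _]; lra).
    assert (Hneg : forall t, s < t <= b -> u t < 0).
    { intros t Ht. destruct (Rlt_le_dec (u t) 0) as [|Hp]; auto.
      assert (t <= s) by (apply Hs1; split; lra). lra. }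
    assert (Hge : 0 <= u s).
    { destruct (Rle_lt_dec 0 (u s)) as [|Hn]; auto. exfalso.
      destruct (proj1 (continuous_ed u s) (Hc s (conj Has Hsb)) (- u s)) as [r [Hr Hy]]; [lra|].
      assert (Hub : is_upper_bound (fun t => a <= t <= b /\ 0 <= u t) (s - r)).
      { intros t [Ht Hut]. destruct (Rle_lt_dec t (s - r)) as [|Hlt]; auto. exfalso.
        assert (t <= s) by (apply Hs1; split; lra).
        specialize (Hy t). rewrite Rabs_left1 in Hy by lra.
        specialize (Hy ltac:(lra)). apply Rabs_def2 in Hy. lra. }
      specialize (Hs2 _ Hub). lra. }
    assert (Hsb' : s < b).
    { destruct Hsb as [|E]; auto. subst s. lra. }
    exists s. split; [lra|]. split; auto.
    apply Rle_antisym; auto.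
    destruct (Rle_lt_dec (u s) 0) as [|Hp]; auto. exfalso.
    destruct (proj1 (continuous_ed u s) (Hc s ltac:(lra)) (u s) Hp) as [r [Hr Hy]].
    set (t := Rmin b (s + r / 2)).
    assert (Ht : s < t <= b /\ t <= s + r / 2).
    { unfold t. split; [split|]. apply Rmin_glb_lt; lra. apply Rmin_l. apply Rmin_r. }
    specialize (Hy t). rewrite Rabs_right in Hy by lra.
    specialize (Hy ltac:(lra)). apply Rabs_def2 in Hy.
    specialize (Hneg t ltac:(lra)). lra.
Qed.

(** A function that starts nonnegative stays so if, wherever it is negative,
    [u e^(-A t)] does not decrease: after the last nonnegative time nothing could
    drive it down. All comparisons with barriers below are instances. *)
Lemma barrier (A : R) (u du : R -> R) a b :
  (forall t, a <= t <= b -> is_derive u t (du t)) ->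
  0 <= u a ->
  (forall t, a < t < b -> u t < 0 -> A * u t <= du t) ->
  forall t, a <= t <= b -> 0 <= u t.
Proof.
  intros Hd Ha Hu t Ht.
  destruct (Rle_lt_dec 0 (u t)) as [|Hn]; auto. exfalso.
  destruct (last_nonneg u a t) as [s [Hs [Hus Hneg]]]; auto; try lra.
  { intros x Hx. eapply continuous_of_derive, Hd. lra. }
  destruct (mean_value (fun x => u x * exp (- A * x))
     (fun x => (du x - A * u x) * exp (- A * x)) s t) as [c [Hc E]]; [lra| |].
  { intros x Hx. assert (Hux := Hd x ltac:(lra)). der. ring. }
  assert (He := exp_pos (- A * c)). assert (He' := exp_pos (- A * t)).
  specialize (Hu c ltac:(lra) (Hneg c ltac:(lra))).
  assert (0 <= (du c - A * u c) * exp (- A * c) * (t - s)).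
  { repeat apply Rmult_le_pos; lra. }
  rewrite Hus in E. nra.
Qed.

Lemma gronwall_pos (A : R) (y dy : R -> R) a b :
  (forall t, a <= t <= b -> is_derive y t (dy t)) ->
  (forall t, a <= t <= b -> dy t <= A * y t) ->
  forall t, a <= t <= b -> y t <= y a * exp (A * (t - a)).
Proof.
  intros Hd Hy t Ht.
  cut (0 <= y a * exp (A * (t - a)) - y t); [lra|].
  apply (barrier A (fun t => y a * exp (A * (t - a)) - y t)
           (fun t => A * (y a * exp (A * (t - a))) - dy t) a b); auto.
  - intros s Hs. assert (Hys := Hd s Hs). der. ring.
  - replace (A * (a - a)) with 0 by ring. rewrite exp_0. lra.
  - intros s Hs _. specialize (Hy s ltac:(lra)). lra.
Qed.

Lemma is_derive_reflect (u : R -> R) x d :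
  is_derive u (- x) d -> is_derive (fun t => u (- t)) x (- d).
Proof.
  intros H. evar_last. apply (der_comp u Ropp).
  apply der_opp, der_id. exact H. ring.
Qed.

Lemma gronwall_back (A B : R) (y dy : R -> R) a b :
  0 <= A -> 0 <= B ->
  (forall t, a <= t <= b -> is_derive y t (dy t)) ->
  (forall t, a <= t <= b -> Rabs (dy t) <= A * Rabs (y t) + B) ->
  a <= b ->
  Rabs (y a) <= (Rabs (y b) + B * (b - a)) * exp (A * (b - a)).
Proof.
  intros HA HB Hd Hy Hab.
  assert (Hphi : forall t, is_derive
     (fun t => (Rabs (y b) + B * (t + b)) * exp (A * (t + b))) t
     (A * ((Rabs (y b) + B * (t + b)) * exp (A * (t + b))) + B * exp (A * (t + b)))).
  { intros t. der. ring. }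
  assert (Hexp : forall t, - b <= t -> 1 <= exp (A * (t + b))).
  { intros t Ht. rewrite <- exp_0. destruct (Req_dec (A * (t + b)) 0) as [->|]; [lra|].
    left. apply exp_increasing. assert (0 <= A * (t + b)) by nra. lra. }
  assert (key : forall sg, (sg = 1 \/ sg = -1) ->
     0 <= (Rabs (y b) + B * (- a + b)) * exp (A * (- a + b)) - sg * y a).
  { intros sg Hsg.
    set (u := fun t => (Rabs (y b) + B * (t + b)) * exp (A * (t + b)) - sg * y (- t)).
    replace (y a) with (y (- - a)) by (f_equal; ring).
    apply (barrier A u (fun t => A * ((Rabs (y b) + B * (t + b)) * exp (A * (t + b)))
       + B * exp (A * (t + b)) - sg * - dy (- t)) (- b) (- a)); try lra.
    - intros t Ht. assert (H1 := Hphi t).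
      assert (H2 := is_derive_reflect y t _ (Hd (- t) ltac:(lra))).
      unfold u. apply (der_minus _ (fun t => sg * y (- t))). exact H1.
      apply (der_scal (fun t => y (- t))). exact H2.
    - unfold u. replace (- b + b) with 0 by ring. rewrite !Rmult_0_r, exp_0, Ropp_involutive.
      assert (H := Rle_abs (y b)). assert (H' := Rle_abs (- y b)). rewrite Rabs_Ropp in H'.
      destruct Hsg; subst; lra.
    - intros t Ht Hu. unfold u in *.
      specialize (Hy (- t) ltac:(lra)). specialize (Hexp t ltac:(lra)).
      set (E := exp (A * (t + b))) in *.
      assert (0 <= (Rabs (y b) + B * (t + b)) * E).
      { apply Rmult_le_pos; [|lra]. assert (H := Rabs_pos (y b)). nra. }
      assert (Hab1 : sg * y (- t) = Rabs (y (- t))).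
      { destruct Hsg; subst. rewrite Rabs_right; lra. rewrite Rabs_left1; lra. }
      assert (Hs : - sg * dy (- t) <= Rabs (dy (- t))).
      { assert (H1 := Rle_abs (dy (- t))). assert (H2 := Rle_abs (- dy (- t))).
        rewrite Rabs_Ropp in H2. destruct Hsg; subst; lra. }
      rewrite <- Hab1 in Hy.
      assert (A * Rabs (y (-t)) <= A * Rabs (y (-t))) by lra.
      assert (sg * dy (- t) >= - (A * (sg * y (- t)) + B)) by lra.
      nra. }
  replace (b - a) with (- a + b) by ring.
  assert (K1 := key 1 (or_introl eq_refl)). assert (K2 := key (-1) (or_intror eq_refl)).
  apply Rabs_le. lra.
Qed.

(** Somewhere in the interval the derivative is a mean slope, at most [2 M / r], and
    by Gronwall's inequality it cannot vary much from there. Applied on intervals of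
    length 1 and on the scale [eps] of the layer. *)
Lemma interior_gradient (u du ddu : R -> R) (M A B z r : R) :
  0 < r -> 0 <= A -> 0 <= B -> 0 <= M ->
  (forall t, z <= t <= z + r -> is_derive u t (du t)) ->
  (forall t, z <= t <= z + r -> is_derive du t (ddu t)) ->
  (forall t, z <= t <= z + r -> Rabs (u t) <= M) ->
  (forall t, z <= t <= z + r -> Rabs (ddu t) <= A * Rabs (du t) + B) ->
  Rabs (du z) <= (2 * M / r + B * r) * exp (A * r).
Proof.
  intros Hr HA HB HM Hu Hdu HuM Hddu.
  destruct (mean_value u du z (z + r)) as [x [Hx E]]; [lra|auto|].
  assert (Hdx : Rabs (du x) <= 2 * M / r).
  { replace (du x) with ((u (z + r) - u z) / r) by (rewrite E; field; lra).
    unfold Rdiv. rewrite Rabs_mult, (Rabs_right (/ r)).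
    2: { apply Rle_ge. left. now apply Rinv_0_lt_compat. }
    apply Rmult_le_compat_r. left; now apply Rinv_0_lt_compat.
    assert (H1 := HuM (z + r) ltac:(lra)). assert (H2 := HuM z ltac:(lra)).
    assert (H3 := Rabs_triang (u (z + r)) (- u z)). rewrite Rabs_Ropp in H3.
    unfold Rminus. lra. }
  assert (H := gronwall_back A B du ddu z x HA HB).
  eapply Rle_trans; [apply H; try lra; intros; [apply Hdu|apply Hddu]; lra|].
  assert (0 < exp (A * (x - z))) by apply exp_pos.
  assert (exp (A * (x - z)) <= exp (A * r)).
  { destruct (Req_dec (A * (x - z)) (A * r)) as [->|]; [lra|].
    left. apply exp_increasing. assert (A * (x - z) <= A * r) by (apply Rmult_le_compat_l; lra). lra. }
  apply Rmult_le_compat; try lra.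
  - assert (H3 := Rabs_pos (du x)). assert (0 <= B * (x - z)) by (apply Rmult_le_pos; lra). lra.
  - assert (B * (x - z) <= B * r) by (apply Rmult_le_compat_l; lra). lra.
Qed.

(** At an interior positive maximum [E1] vanishes; if this forces [E1 > 0] just
    after it, then [E] would still grow there. The hypothesis looks only to the
    right of the maximum, so that [E1] may have a corner. *)
Lemma max_principle (E E1 : R -> R) a b :
  a < b -> (forall z, a <= z <= b -> is_derive E z (E1 z)) ->
  E a <= 0 -> E b <= 0 ->
  (forall x, a < x < b -> 0 < E x -> E1 x = 0 ->
     exists r, 0 < r /\ forall z, x < z < x + r -> 0 < E1 z) ->
  forall z, a <= z <= b -> E z <= 0.
Proof.
  intros Hab Hd Ha Hb Hx z Hz.
  destruct (continuity_ab_maj E a b) as [x [Hmax Hxab]]; [lra| |].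
  { intros t Ht. eapply continuity_pt_of_continuous, continuous_of_derive, Hd, Ht. }
  destruct (Rle_lt_dec (E x) 0) as [Hle|Hpos].
  { specialize (Hmax z Hz). lra. }
  exfalso.
  assert (Hxin : a < x < b).
  { destruct (Req_dec x a); [subst; lra|]. destruct (Req_dec x b); [subst; lra|]. lra. }
  assert (E0 : E1 x = 0).
  { assert (pr := proj1 (is_derive_Reals _ _ _) (Hd x ltac:(lra))).
    assert (H := deriv_maximum E a b x (exist _ _ pr) ltac:(lra) ltac:(lra)).
    rewrite <- H; [reflexivity|]. intros; apply Hmax; lra. }
  destruct (Hx x Hxin Hpos E0) as [r [Hr Hr1]].
  set (y := Rmin b (x + r / 2)).
  assert (Hy : x < y <= b /\ y <= x + r / 2).
  { unfold y. split; [split|]. apply Rmin_glb_lt; lra. apply Rmin_l. apply Rmin_r. }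
  destruct (mean_value E E1 x y) as [s [Hs Es]]; [lra|intros; apply Hd; lra|].
  specialize (Hr1 s ltac:(lra)). specialize (Hmax y ltac:(lra)).
  assert (0 < E1 s * (y - x)) by (apply Rmult_lt_0_compat; lra). lra.
Qed.

Lemma pos_after_of_derive (g : R -> R) x d :
  is_derive g x d -> g x = 0 -> 0 < d ->
  exists r, 0 < r /\ forall z, x < z < x + r -> 0 < g z.
Proof.
  intros H H0 Hd. destruct (proj1 (is_derive_ed g x d) H (d / 2)) as [r [Hr Hy]]; [lra|].
  exists r. split; auto. intros z Hz. specialize (Hy z).
  rewrite (Rabs_right (z - x)) in Hy by lra. specialize (Hy ltac:(lra)).
  rewrite H0 in Hy. apply Rabs_le_between in Hy.
  assert (0 < d * (z - x)) by (apply Rmult_lt_0_compat; lra). lra.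
Qed.

Lemma pos_after_of_right_derive (g dg : R -> R) x r :
  continuous g x -> g x = 0 ->
  (forall z, x < z < x + r -> is_derive g z (dg z) /\ 0 < dg z) ->
  forall z, x < z < x + r -> 0 < g z.
Proof.
  intros Hc H0 Hd.
  assert (Hincr : forall y z, x < y < z -> z < x + r -> g y < g z).
  { intros y z Hy Hz. destruct (mean_value g dg y z) as [s [Hs E]]; [lra| |].
    { intros t Ht. apply Hd. lra. }
    destruct (Hd s ltac:(lra)) as [_ Hp].
    assert (0 < dg s * (z - y)) by (apply Rmult_lt_0_compat; lra). lra. }
  intros z Hz. set (m := (x + z) / 2).
  assert (Hm := Hincr m z ltac:(unfold m; lra) ltac:(lra)).
  destruct (Rle_lt_dec 0 (g m)) as [|Hneg]; [lra|]. exfalso.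
  destruct (proj1 (continuous_ed g x) Hc (- g m)) as [d [Hd0 H]]; [lra|].
  set (y := Rmin (x + d / 2) ((x + m) / 2)).
  assert (Hy : x < y /\ y <= x + d / 2 /\ y < m).
  { unfold y, m. split; [apply Rmin_glb_lt; lra|]. split; [apply Rmin_l|].
    eapply Rle_lt_trans; [apply Rmin_r|]. lra. }
  specialize (H y ltac:(rewrite Rabs_right; lra)). rewrite H0, Rminus_0_r in H.
  apply Rabs_def2 in H. specialize (Hincr y m ltac:(lra) ltac:(unfold m; lra)). lra.
Qed.

(** The form of the maximum principle used with equations [g E = e E'' + B E' + s],
    [g > 0]: the equation is only looked at where [E > 0] and [E' = 0]. *)
Lemma max_principle2 (E E1 E2 : R -> R) a b :
  a < b -> (forall z, a <= z <= b -> is_derive E z (E1 z)) ->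
  (forall z, a <= z <= b -> is_derive E1 z (E2 z)) ->
  E a <= 0 -> E b <= 0 ->
  (forall x, a < x < b -> 0 < E x -> E1 x = 0 -> 0 < E2 x) ->
  forall z, a <= z <= b -> E z <= 0.
Proof.
  intros Hab H1 H2 Ha Hb Hx. apply (max_principle E E1); auto.
  intros x Hxi Hp H0. apply (pos_after_of_derive E1 x (E2 x)); auto. apply H2; lra.
Qed.

(** Exchange of limit and derivative under equicontinuity of the derivatives at
    the point, in place of their uniform convergence. *)
Lemma is_derive_limit (u du : nat -> R -> R) (v : R -> R) (dv t R0 : R) :
  0 < R0 ->
  (exists N, forall n, (N <= n)%nat -> forall s, Rabs (s - t) < R0 -> is_derive (u n) s (du n s)) ->
  (forall s, Rabs (s - t) < R0 -> is_lim_seq (fun n => u n s) (v s)) ->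
  is_lim_seq (fun n => du n t) dv ->
  (forall e, 0 < e -> exists r N, 0 < r /\ forall n, (N <= n)%nat -> forall s,
     Rabs (s - t) < r -> Rabs (du n s - du n t) <= e) ->
  is_derive v t dv.
Proof.
  intros HR [N0 Hd] Hu Hdu Heq. apply is_derive_ed. intros e He.
  destruct (Heq e He) as [r [N [Hr Hn]]].
  exists (Rmin r R0). split; [now apply Rmin_glb_lt|]. intros s Hs.
  assert (Hs1 : Rabs (s - t) < r) by (eapply Rlt_le_trans; [exact Hs|apply Rmin_l]).
  assert (Hs2 : Rabs (s - t) < R0) by (eapply Rlt_le_trans; [exact Hs|apply Rmin_r]).
  assert (Hn' : forall n, (N + N0 <= n)%nat ->
     Rabs (u n s - u n t - du n t * (s - t)) <= e * Rabs (s - t)).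
  { intros n Hnn.
    assert (Hin : forall x, Rmin t s <= x <= Rmax t s -> Rabs (x - t) <= Rabs (s - t)).
    { intros x. unfold Rmin, Rmax. destruct (Rle_dec t s).
      intros; rewrite !Rabs_right; lra. intros; rewrite !Rabs_left1; lra. }
    destruct (MVT_gen (u n) t s (du n)) as [x [Hx Ex]].
    - intros x Hx. apply Hd; [lia|]. specialize (Hin x ltac:(lra)). lra.
    - intros x Hx. specialize (Hin x Hx).
      eapply continuity_pt_of_continuous, continuous_of_derive, Hd; [lia|lra].
    - rewrite Ex.
      replace (du n x * (s - t) - du n t * (s - t)) with ((du n x - du n t) * (s - t)) by ring.
      rewrite Rabs_mult. apply Rmult_le_compat_r; [apply Rabs_pos|].
      apply Hn; [lia|]. specialize (Hin x Hx). lra. }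
  assert (L : is_lim_seq (fun n => Rabs (u n s - u n t - du n t * (s - t)))
            (Rabs (v s - v t - dv * (s - t)))).
  { apply (is_lim_seq_abs _ (v s - v t - dv * (s - t))).
    apply is_lim_seq_minus'. apply is_lim_seq_minus'.
    apply Hu; lra. apply Hu. rewrite Rminus_diag, Rabs_R0; lra.
    apply (is_lim_seq_scal_r _ (s - t) dv Hdu). }
  apply (is_lim_seq_le_loc _ (fun _ => e * Rabs (s - t)) _ (e * Rabs (s - t))) in L; auto.
  - exists (N + N0)%nat. exact Hn'.
  - apply is_lim_seq_const.
Qed.

Lemma is_lim_seq_ed (u : nat -> R) (x : R) :
  is_lim_seq u x <->
  (forall e, 0 < e -> exists N, forall n, (N <= n)%nat -> Rabs (u n - x) < e).
Proof.
  rewrite <- is_lim_seq_spec. split.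
  - intros H e He. exact (H (mkposreal e He)).
  - intros H e. exact (H e (cond_pos e)).
Qed.

Lemma lim_seq_of_cauchy (u : nat -> R) :
  (forall e, 0 < e -> exists N, forall n m, (N <= n)%nat -> (N <= m)%nat -> Rabs (u n - u m) < e) ->
  exists x : R, is_lim_seq u x.
Proof.
  intros H. destruct (proj2 (ex_lim_seq_cauchy_corr u)) as [x Hx].
  - intros e. destruct (H e (cond_pos e)) as [N HN]. exists N. auto.
  - now exists x.
Qed.

Lemma bounded_on_segment (f : R -> R) a b :
  (forall x, a <= x <= b -> continuous f x) ->
  exists M, 0 < M /\ forall x, a <= x <= b -> Rabs (f x) <= M.
Proof.
  intros H. destruct (bounded_continuity f a b H) as [M HM].
  exists (Rmax M 1). split. apply Rlt_le_trans with 1; [lra|apply Rmax_r].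
  intros x Hx. left. eapply Rlt_le_trans; [exact (HM x Hx)|apply Rmax_l].
Qed.

Lemma abs_one_sqr s : Rabs s = 1 -> s * s = 1.
Proof. intros H. assert (E := Rsqr_abs s). rewrite H in E. unfold Rsqr in E. lra. Qed.

(** * Second-order initial value problems *)

Lemma is_derive_limit_unif (u du : nat -> R -> R) (v : R -> R) (dv t : R) :
  (forall n s, is_derive (u n) s (du n s)) ->
  (forall n, continuous (du n) t) ->
  (forall s, is_lim_seq (fun n => u n s) (v s)) ->
  is_lim_seq (fun n => du n t) dv ->
  (forall e, 0 < e -> exists N, forall n, (N <= n)%nat -> forall s, Rabs (s - t) < 1 ->
     Rabs (du n s - du N s) <= e) ->
  is_derive v t dv.
Proof.
  intros Hd Hc Hu Hdu Hunif.
  apply (is_derive_limit u du v dv t 1); auto; try lra.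
  - exists O. intros; apply Hd.
  - intros e He. destruct (Hunif (e / 3)) as [N HN]; [lra|].
    destruct (proj1 (continuous_ed (du N) t) (Hc N) (e / 3)) as [r [Hr Hy]]; [lra|].
    exists (Rmin r 1), N. split; [apply Rmin_glb_lt; lra|].
    intros n Hn s Hs.
    assert (Hs1 : Rabs (s - t) < r) by (eapply Rlt_le_trans; [exact Hs|apply Rmin_l]).
    assert (Hs2 : Rabs (s - t) < 1) by (eapply Rlt_le_trans; [exact Hs|apply Rmin_r]).
    assert (H1 := HN n Hn s Hs2). assert (H2 := Hy s Hs1).
    assert (H3 := HN n Hn t ltac:(rewrite Rminus_diag, Rabs_R0; lra)).
    apply Rabs_le_between in H1, H3. apply Rabs_def2 in H2. apply Rabs_le. lra.
Qed.

Lemma antiderivative (g : R -> R) (t0 t : R) :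
  (forall s, continuous g s) -> is_derive (fun s => RInt g t0 s) t (g t).
Proof.
  intros H. apply (is_derive_RInt g (fun s => RInt g t0 s) t0 t); auto.
  exists (mkposreal 1 Rlt_0_1). intros s _. apply (RInt_correct g t0 s).
  apply ex_RInt_continuous. auto.
Qed.

Lemma exp_growth_right (u du : R -> R) (K lam t0 : R) :
  0 < lam -> 0 <= K -> u t0 = 0 ->
  (forall t, is_derive u t (du t)) ->
  (forall t, t0 <= t -> Rabs (du t) <= K * exp (lam * (t - t0))) ->
  forall t, t0 <= t -> Rabs (u t) <= K / lam * exp (lam * (t - t0)).
Proof.
  intros Hl HK H0 Hd Hb t Ht.
  assert (HKl : 0 <= K / lam) by (apply Rmult_le_pos; [lra|left; now apply Rinv_0_lt_compat]).
  assert (key : forall sg, Rabs sg = 1 -> 0 <= K / lam * exp (lam * (t - t0)) - sg * u t).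
  { intros sg Hsg.
    apply (barrier 0 (fun t => K / lam * exp (lam * (t - t0)) - sg * u t)
      (fun t => K * exp (lam * (t - t0)) - sg * du t) t0 t); try lra.
    - intros s Hs. assert (Hds := Hd s). der. field. lra.
    - rewrite H0. replace (lam * (t0 - t0)) with 0 by ring. rewrite exp_0. lra.
    - intros s Hs _. specialize (Hb s ltac:(lra)).
      assert (H := Rle_abs (sg * du s)). rewrite Rabs_mult, Hsg in H. lra. }
  assert (H1 := key 1 Rabs_R1).
  assert (H2 := key (-1) ltac:(rewrite Rabs_left; lra)).
  apply Rabs_le. lra.
Qed.

Lemma exp_growth (u du : R -> R) (K lam t0 : R) :
  0 < lam -> 0 <= K -> u t0 = 0 ->
  (forall t, is_derive u t (du t)) ->
  (forall t, Rabs (du t) <= K * exp (lam * Rabs (t - t0))) ->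
  forall t, Rabs (u t) <= K / lam * exp (lam * Rabs (t - t0)).
Proof.
  intros Hl HK H0 Hd Hb t.
  destruct (Rle_lt_dec t0 t) as [Ht|Ht].
  - rewrite (Rabs_right (t - t0)) by lra. apply (exp_growth_right u du); auto.
    intros s Hs. specialize (Hb s). rewrite (Rabs_right (s - t0)) in Hb; lra.
  - rewrite (Rabs_left (t - t0)) by lra.
    replace (u t) with ((fun s => u (- s)) (- t)) by (simpl; f_equal; ring).
    replace (- (t - t0)) with (- t - - t0) by ring.
    apply (exp_growth_right (fun s => u (- s)) (fun s => - du (- s))); auto; try lra.
    + rewrite Ropp_involutive; auto.
    + intros s. apply is_derive_reflect, Hd.
    + intros s Hs. rewrite Rabs_Ropp. specialize (Hb (- s)).
      rewrite (Rabs_left1 (- s - t0)) in Hb by lra.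
      replace (s - - t0) with (- (- s - t0)) by ring. auto.
Qed.

Lemma geometric_limit (u : nat -> R) (D : R) :
  0 <= D -> (forall n, Rabs (u (S n) - u n) <= D * (1 / 2) ^ n) ->
  exists x : R, is_lim_seq u x /\ forall n, Rabs (u n - x) <= 2 * D * (1 / 2) ^ n.
Proof.
  intros HD H.
  assert (Hk : forall n k, Rabs (u (n + k)%nat - u n) <= 2 * D * (1 / 2) ^ n).
  { intros n k.
    assert (Hp : forall m, 0 < (1 / 2) ^ m) by (intros; apply pow_lt; lra).
    cut (Rabs (u (n + k)%nat - u n) <= 2 * D * ((1 / 2) ^ n - (1 / 2) ^ (n + k))).
    { intros H1. specialize (Hp (n + k)%nat). nra. }
    induction k as [|k IH].
    - rewrite Nat.add_0_r. rewrite !Rminus_diag, Rabs_R0. lra.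
    - rewrite Nat.add_succ_r. specialize (H (n + k)%nat).
      simpl pow. apply Rabs_le_between in H, IH. apply Rabs_le.
      specialize (Hp (n + k)%nat). nra. }
  assert (Hlim0 : forall e, 0 < e -> exists N, 2 * D * (1 / 2) ^ N < e).
  { intros e He. destruct (pow_lt_1_zero (1 / 2) ltac:(rewrite Rabs_right; lra)
      (e / (2 * D + 1)) ltac:(apply Rdiv_lt_0_compat; lra)) as [N HN].
    exists N. specialize (HN N (le_n _)).
    rewrite Rabs_right in HN by (apply Rle_ge; left; apply pow_lt; lra).
    apply (Rmult_lt_compat_r (2 * D + 1)) in HN; [|lra].
    unfold Rdiv in HN. rewrite Rmult_assoc, Rinv_l in HN by lra.
    assert (0 < (1 * / 2) ^ N) by (apply pow_lt; lra). unfold Rdiv. nra. }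
  destruct (lim_seq_of_cauchy u) as [x Hx].
  - intros e He. destruct (Hlim0 (e / 2)) as [N HN]; [lra|].
    exists N. intros n m Hn Hm.
    assert (H1 := Hk N (n - N)%nat). assert (H2 := Hk N (m - N)%nat).
    replace (N + (n - N))%nat with n in H1 by lia.
    replace (N + (m - N))%nat with m in H2 by lia.
    apply Rabs_le_between in H1, H2. apply Rabs_def1; lra.
  - exists x. split; auto. intros n.
    assert (L : is_lim_seq (fun k => Rabs (u (k + n)%nat - u n)) (Rabs (x - u n))).
    { apply (is_lim_seq_abs _ (x - u n)). apply is_lim_seq_minus'.
      now apply (is_lim_seq_incr_n u n). apply is_lim_seq_const. }
    rewrite Rabs_minus_sym.
    apply (is_lim_seq_le _ (fun _ => 2 * D * (1 / 2) ^ n) _ (2 * D * (1 / 2) ^ n)) in L; auto.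
    + intros k. rewrite Nat.add_comm. apply Hk.
    + apply is_lim_seq_const.
Qed.

Section Picard.
Variables (F : R -> R -> R -> R) (Lam Bd t0 x0 y0 : R).
Hypothesis HLam : 0 < Lam.
Hypothesis HF : forall t x y x' y',
  Rabs (F t x y - F t x' y') <= Lam * (Rabs (x - x') + Rabs (y - y')).
Hypothesis HFc : forall x y t, continuous (fun t => F t x y) t.
Hypothesis HFb : forall t, Rabs (F t x0 y0) <= Bd.

Lemma continuous_rhs (X Y : R -> R) t :
  continuous X t -> continuous Y t -> continuous (fun t => F t (X t) (Y t)) t.
Proof.
  intros HX HY. apply continuous_ed. intros e He.
  set (d := e / (4 * Lam)).
  assert (Hd : 0 < d) by (apply Rdiv_lt_0_compat; lra).
  destruct (proj1 (continuous_ed X t) HX d Hd) as [r1 [Hr1 H1]].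
  destruct (proj1 (continuous_ed Y t) HY d Hd) as [r2 [Hr2 H2]].
  destruct (proj1 (continuous_ed _ t) (HFc (X t) (Y t) t) (e / 2)) as [r3 [Hr3 H3]]; [lra|].
  exists (Rmin r1 (Rmin r2 r3)). split; [repeat apply Rmin_glb_lt; auto|].
  intros s Hs.
  assert (Hs1 : Rabs (s - t) < r1) by (eapply Rlt_le_trans; [exact Hs|apply Rmin_l]).
  assert (Hs' : Rabs (s - t) < Rmin r2 r3) by (eapply Rlt_le_trans; [exact Hs|apply Rmin_r]).
  assert (Hs2 : Rabs (s - t) < r2) by (eapply Rlt_le_trans; [exact Hs'|apply Rmin_l]).
  assert (Hs3 : Rabs (s - t) < r3) by (eapply Rlt_le_trans; [exact Hs'|apply Rmin_r]).
  specialize (H1 s Hs1). specialize (H2 s Hs2). specialize (H3 s Hs3).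
  assert (H4 := HF s (X s) (Y s) (X t) (Y t)).
  assert (Lam * (Rabs (X s - X t) + Rabs (Y s - Y t)) < e / 2).
  { apply Rlt_le_trans with (Lam * (d + d)).
    apply Rmult_lt_compat_l; lra. unfold d. right. field. lra. }
  apply Rabs_le_between in H4. apply Rabs_def2 in H3. apply Rabs_def1; lra.
Qed.

Fixpoint picard_iter (n : nat) : (R -> R) * (R -> R) :=
  match n with
  | O => (fun _ => x0, fun _ => y0)
  | S n => (fun t => x0 + RInt (snd (picard_iter n)) t0 t,
            fun t => y0 + RInt (fun s => F s (fst (picard_iter n) s) (snd (picard_iter n) s)) t0 t)
  end.
Let X n := fst (picard_iter n).
Let Y n := snd (picard_iter n).

Lemma picard_continuous n t : continuous (X n) t /\ continuous (Y n) t.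
Proof.
  revert t. induction n as [|n IH]; intros t.
  - split; apply continuous_const.
  - split.
    + apply continuous_of_derive with (0 + Y n t).
      unfold X; simpl. apply (der_plus (fun _ => x0)). apply der_const.
      apply antiderivative. intros s; apply IH.
    + apply continuous_of_derive with (0 + F t (X n t) (Y n t)).
      unfold Y; simpl. apply (der_plus (fun _ => y0)). apply der_const.
      apply (antiderivative (fun s => F s (X n s) (Y n s))).
      intros s; apply continuous_rhs; apply IH.
Qed.

Lemma picard_derive n t :
  is_derive (X (S n)) t (Y n t) /\ is_derive (Y (S n)) t (F t (X n t) (Y n t)).
Proof.
  split.
  - rewrite <- (Rplus_0_l (Y n t)). unfold X; simpl.
    apply (der_plus (fun _ => x0)). apply der_const.
    apply antiderivative. intros s; apply picard_continuous.
  - rewrite <- (Rplus_0_l (F _ _ _)). unfold Y; simpl.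
    apply (der_plus (fun _ => y0)). apply der_const.
    apply (antiderivative (fun s => F s (X n s) (Y n s))).
    intros s; apply continuous_rhs; apply picard_continuous.
Qed.

Lemma picard_start n : X n t0 = x0 /\ Y n t0 = y0.
Proof.
  destruct n; [split; reflexivity|]. unfold X, Y; simpl.
  rewrite !RInt_point. unfold zero; simpl. split; ring.
Qed.

(** The rate of the weight is chosen so that each iteration gains a factor 1/2
    on the whole line at once. *)
Let lam := 2 * (2 * Lam + 1).
Let w t := exp (lam * Rabs (t - t0)).
Let K0 := Rabs y0 + Bd.

Lemma weight_ge_1 t : 1 <= w t.
Proof.
  unfold w. rewrite <- exp_0.
  assert (0 <= lam * Rabs (t - t0)).
  { apply Rmult_le_pos; [unfold lam; lra|apply Rabs_pos]. }
  destruct (Req_dec (lam * Rabs (t - t0)) 0) as [->|]; [lra|].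
  left. apply exp_increasing. lra.
Qed.

Lemma K0_nonneg : 0 <= K0.
Proof. unfold K0. assert (H := HFb t0). assert (H1 := Rabs_pos y0).
  assert (H2 := Rabs_pos (F t0 x0 y0)). lra. Qed.

Lemma picard_contract n t :
  Rabs (X (S n) t - X n t) <= K0 * (1 / 2) ^ n * w t /\
  Rabs (Y (S n) t - Y n t) <= K0 * (1 / 2) ^ n * w t.
Proof.
  assert (Hlam : 2 <= lam) by (unfold lam; lra).
  assert (HK := K0_nonneg).
  revert t. induction n as [|n IH]; intros t.
  - assert (Hw := weight_ge_1). simpl pow. rewrite Rmult_1_r.
    assert (Hred : K0 / lam * w t <= K0 * w t).
    { apply Rmult_le_compat_r; [specialize (Hw t); lra|].
      unfold Rdiv. rewrite <- (Rmult_1_r K0) at 2. apply Rmult_le_compat_l; auto.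
      rewrite <- Rinv_1. apply Rinv_le_contravar; lra. }
    assert (Hb : forall k, Rabs k <= K0 -> forall s, Rabs k <= K0 * w s).
    { intros k Hk s. specialize (Hw s). nra. }
    split; (eapply Rle_trans; [|exact Hred]).
    + apply (exp_growth (fun t => X 1 t - X 0 t) (fun _ => y0)); try lra; auto.
      * destruct (picard_start 1) as [-> _]. unfold X; simpl; ring.
      * intros s. destruct (picard_derive 0 s) as [H _].
        evar_last; [apply der_minus; [exact H|apply (der_const x0)]|].
        unfold Y; simpl; ring.
      * apply Hb. unfold K0. assert (H := HFb t0). assert (H2 := Rabs_pos (F t0 x0 y0)). lra.
    + apply (exp_growth (fun t => Y 1 t - Y 0 t) (fun s => F s x0 y0)); try lra; auto.
      * destruct (picard_start 1) as [_ ->]. unfold Y; simpl; ring.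
      * intros s. destruct (picard_derive 0 s) as [_ H].
        evar_last; [apply der_minus; [exact H|apply (der_const y0)]|].
        unfold X, Y; simpl; ring.
      * intros s. apply Hb. unfold K0. assert (H := HFb s). assert (H2 := Rabs_pos y0). lra.
  - set (q := K0 * (1 / 2) ^ n).
    assert (Hq : 0 <= q) by (apply Rmult_le_pos; [auto|apply pow_le; lra]).
    assert (Hgoal : (2 * Lam + 1) * q / lam * w t = K0 * (1 / 2) ^ S n * w t).
    { unfold q, lam. simpl pow. field. lra. }
    assert (Hw := weight_ge_1).
    rewrite <- Hgoal. split.
    + apply (exp_growth (fun t => X (S (S n)) t - X (S n) t) (fun t => Y (S n) t - Y n t)); try lra.
      * apply Rmult_le_pos; lra.
      * destruct (picard_start (S (S n))) as [-> _]. destruct (picard_start (S n)) as [-> _]. ring.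
      * intros s. apply der_minus; apply picard_derive.
      * intros s. destruct (IH s) as [_ H]. fold q in H. specialize (Hw s).
        fold (w s). assert (0 <= q * w s) by (apply Rmult_le_pos; lra). nra.
    + apply (exp_growth (fun t => Y (S (S n)) t - Y (S n) t)
        (fun t => F t (X (S n) t) (Y (S n) t) - F t (X n t) (Y n t))); try lra.
      * apply Rmult_le_pos; lra.
      * destruct (picard_start (S (S n))) as [_ ->]. destruct (picard_start (S n)) as [_ ->]. ring.
      * intros s. apply der_minus; apply picard_derive.
      * intros s. destruct (IH s) as [H1 H2]. fold q in H1, H2. specialize (Hw s).
        fold (w s). assert (H3 := HF s (X (S n) s) (Y (S n) s) (X n s) (Y n s)).
        assert (0 <= q * w s) by (apply Rmult_le_pos; lra). nra.
Qed.

(** Cauchy-Lipschitz theorem for [x'' = F(t, x, x')], global in time. *)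
Lemma picard_lindelof :
  exists x y : R -> R, x t0 = x0 /\ y t0 = y0 /\
    forall t, is_derive x t (y t) /\ is_derive y t (F t (x t) (y t)).
Proof.
  assert (HK := K0_nonneg).
  assert (HL : forall (u : nat -> R -> R),
     (forall n t, Rabs (u (S n) t - u n t) <= K0 * (1 / 2) ^ n * w t) ->
     forall t, is_lim_seq (fun n => u n t) (real (Lim_seq (fun n => u n t))) /\
       forall n, Rabs (u n t - real (Lim_seq (fun n => u n t))) <= 2 * (K0 * w t) * (1 / 2) ^ n).
  { intros u Hu t. destruct (geometric_limit (fun n => u n t) (K0 * w t)) as [x [Hx1 Hx2]].
    - apply Rmult_le_pos; auto. assert (H := weight_ge_1 t). lra.
    - intros n. specialize (Hu n t). lra.
    - rewrite (is_lim_seq_unique _ _ Hx1). simpl. auto. }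
  assert (HX := HL X (fun n t => proj1 (picard_contract n t))).
  assert (HY := HL Y (fun n t => proj2 (picard_contract n t))).
  set (x := fun t => real (Lim_seq (fun n => X n t))).
  set (y := fun t => real (Lim_seq (fun n => Y n t))).
  exists x, y.
  assert (Hunif : forall t e, 0 < e -> exists N, forall n, (N <= n)%nat ->
    forall s, Rabs (s - t) < 1 -> Rabs (X n s - x s) <= e /\ Rabs (Y n s - y s) <= e).
  { intros t e He.
    set (D := K0 * exp (lam * (Rabs (t - t0) + 1))).
    assert (HD : forall s, Rabs (s - t) < 1 -> K0 * w s <= D).
    { intros s Hs. apply Rmult_le_compat_l; auto. left. apply exp_increasing.
      apply Rmult_lt_compat_l. unfold lam; lra.
      assert (H := Rabs_triang (s - t) (t - t0)).
      replace (s - t + (t - t0)) with (s - t0) in H by ring. lra. }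
    assert (HD0 : 0 <= D) by (apply Rmult_le_pos; auto; left; apply exp_pos).
    destruct (pow_lt_1_zero (1 / 2) ltac:(rewrite Rabs_right; lra)
      (e / (2 * D + 1)) ltac:(apply Rdiv_lt_0_compat; lra)) as [N HN].
    exists N. intros n Hn s Hs. specialize (HN n Hn).
    rewrite Rabs_right in HN by (apply Rle_ge; left; apply pow_lt; lra).
    assert (Hb : 2 * (K0 * w s) * (1 / 2) ^ n <= e).
    { assert (0 < (1 / 2) ^ n) by (apply pow_lt; lra).
      apply Rle_trans with (2 * D * (1 / 2) ^ n).
      { apply Rmult_le_compat_r; [lra|]. specialize (HD s Hs). lra. }
      apply (Rmult_lt_compat_r (2 * D + 1)) in HN; [|lra].
      replace (e / (2 * D + 1) * (2 * D + 1)) with e in HN by (field; lra). nra. }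
    split.
    - destruct (HX s) as [_ H]. specialize (H n). unfold x. lra.
    - destruct (HY s) as [_ H]. specialize (H n). unfold y. lra. }
  split; [|split].
  - unfold x. rewrite (Lim_seq_ext _ (fun _ => x0)) by (intros; apply picard_start).
    rewrite Lim_seq_const. reflexivity.
  - unfold y. rewrite (Lim_seq_ext _ (fun _ => y0)) by (intros; apply picard_start).
    rewrite Lim_seq_const. reflexivity.
  - intros t. split.
    + apply (is_derive_limit_unif (fun n => X (S n)) Y).
      * intros; apply picard_derive.
      * intros; apply picard_continuous.
      * intros s. apply (is_lim_seq_incr_1 (fun n => X n s)). apply HX.
      * apply HY.
      * intros e He. destruct (Hunif t (e / 2)) as [N HN]; [lra|].
        exists N. intros n Hn s Hs.
        destruct (HN n Hn s Hs) as [_ H1]. destruct (HN N (le_n _) s Hs) as [_ H2].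
        apply Rabs_le_between in H1, H2. apply Rabs_le; lra.
    + apply (is_derive_limit_unif (fun n => Y (S n)) (fun n s => F s (X n s) (Y n s))).
      * intros; apply picard_derive.
      * intros; apply continuous_rhs; apply picard_continuous.
      * intros s. apply (is_lim_seq_incr_1 (fun n => Y n s)). apply HY.
      * apply is_lim_seq_ed. intros e He.
        destruct (Hunif t (e / (4 * Lam))) as [N HN]; [apply Rdiv_lt_0_compat; lra|].
        exists N. intros n Hn.
        destruct (HN n Hn t ltac:(rewrite Rminus_diag, Rabs_R0; lra)) as [H1 H2].
        eapply Rle_lt_trans; [apply HF|].
        apply Rle_lt_trans with (Lam * (e / (4 * Lam) + e / (4 * Lam))).
        apply Rmult_le_compat_l; lra.
        replace (Lam * (e / (4 * Lam) + e / (4 * Lam))) with (e / 2) by (field; lra). lra.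
      * intros e He.
        destruct (Hunif t (e / (4 * Lam))) as [N HN]; [apply Rdiv_lt_0_compat; lra|].
        exists N. intros n Hn s Hs.
        destruct (HN n Hn s Hs) as [H1 H2]. destruct (HN N (le_n _) s Hs) as [H3 H4].
        eapply Rle_trans; [apply HF|].
        apply Rle_trans with (Lam * (2 * (e / (4 * Lam)) + 2 * (e / (4 * Lam)))).
        -- apply Rmult_le_compat_l; [lra|].
           apply Rabs_le_between in H1, H2, H3, H4.
           apply Rplus_le_compat; apply Rabs_le; lra.
        -- right. field. lra.
Qed.
End Picard.

(** * Existence of a viscous potential close to an approximate one *)

Definition clamp (a b x : R) : R := Rmax a (Rmin b x).

Lemma clamp_bounds a b x : a <= b -> a <= clamp a b x <= b.
Proof.
  intros H. unfold clamp. split. apply Rmax_l. apply Rmax_lub; auto. apply Rmin_l.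
Qed.
Lemma clamp_id a b x : a <= x <= b -> clamp a b x = x.
Proof.
  intros H. unfold clamp. rewrite Rmin_right by lra. apply Rmax_right. lra.
Qed.
Lemma clamp_above a b x : a <= b -> b < x -> clamp a b x = b.
Proof.
  intros H H'. unfold clamp. rewrite Rmin_left by lra. apply Rmax_right. lra.
Qed.
Lemma clamp_below a b x : a <= b -> x < a -> clamp a b x = a.
Proof.
  intros H H'. unfold clamp. rewrite Rmin_right by lra. apply Rmax_left. lra.
Qed.
Lemma clamp_lipschitz a b x y : Rabs (clamp a b x - clamp a b y) <= Rabs (x - y).
Proof.
  unfold clamp, Rmax, Rmin.
  assert (H := Rle_abs (x - y)). assert (H' := Rle_abs (- (x - y))). rewrite Rabs_Ropp in H'.
  assert (Hp := Rabs_pos (x - y)).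
  destruct (Rle_dec b x); destruct (Rle_dec b y); repeat (destruct Rle_dec);
    apply Rabs_le; lra.
Qed.

Lemma continuous_R_plus (f h : R -> R) x :
  continuous f x -> continuous h x -> continuous (fun t => f t + h t) x.
Proof. intros. now apply (continuous_plus f h). Qed.
Lemma continuous_R_minus (f h : R -> R) x :
  continuous f x -> continuous h x -> continuous (fun t => f t - h t) x.
Proof. intros. now apply (continuous_minus f h). Qed.
Lemma continuous_R_mult (f h : R -> R) x :
  continuous f x -> continuous h x -> continuous (fun t => f t * h t) x.
Proof. intros. now apply (continuous_mult f h). Qed.
Lemma continuous_R_comp (f h : R -> R) x :
  continuous h x -> continuous f (h x) -> continuous (fun t => f (h t)) x.
Proof. intros. now apply (continuous_comp h f). Qed.

Lemma continuous_Rmax (f h : R -> R) x :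
  continuous f x -> continuous h x -> continuous (fun t => Rmax (f t) (h t)) x.
Proof.
  intros Hf Hh. apply continuous_ext with (fun t => (f t + h t + Rabs (f t - h t)) * / 2).
  - intros t. unfold Rmax. destruct (Rle_dec (f t) (h t)).
    rewrite Rabs_left1; lra. rewrite Rabs_right; lra.
  - apply continuous_R_mult; [|apply continuous_const].
    apply continuous_R_plus. now apply continuous_R_plus.
    apply (continuous_R_comp Rabs). now apply continuous_R_minus. apply continuous_Rabs.
Qed.
Lemma continuous_Rmin (f h : R -> R) x :
  continuous f x -> continuous h x -> continuous (fun t => Rmin (f t) (h t)) x.
Proof.
  intros Hf Hh. apply continuous_ext with (fun t => (f t + h t - Rabs (f t - h t)) * / 2).
  - intros t. unfold Rmin. destruct (Rle_dec (f t) (h t)).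
    rewrite Rabs_left1; lra. rewrite Rabs_right; lra.
  - apply continuous_R_mult; [|apply continuous_const].
    apply continuous_R_minus. now apply continuous_R_plus.
    apply (continuous_R_comp Rabs). now apply continuous_R_minus. apply continuous_Rabs.
Qed.
Lemma continuous_clamp (a b f : R -> R) x :
  continuous a x -> continuous b x -> continuous f x ->
  continuous (fun t => clamp (a t) (b t) (f t)) x.
Proof.
  intros. unfold clamp. apply continuous_Rmax; auto. apply continuous_Rmin; auto.
Qed.

Lemma exp_le_compat x y : x <= y -> exp x <= exp y.
Proof. intros [H| ->]; [left; now apply exp_increasing|lra]. Qed.

Lemma abs_ln_le (x L : R) : exp (- L) <= x <= exp L -> Rabs (ln x) <= L.
Proof.
  intros H. assert (Hp := exp_pos (- L)). apply Rabs_le. split.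
  - rewrite <- (ln_exp (- L)). apply ln_le; lra.
  - rewrite <- (ln_exp L). apply ln_le; lra.
Qed.

Lemma xlnx_lipschitz L x y : 0 <= L ->
  exp (- L) <= x <= exp L -> exp (- L) <= y <= exp L ->
  Rabs (x * ln x - y * ln y) <= (L + 1) * Rabs (x - y).
Proof.
  intros HL Hx Hy. assert (Hp := exp_pos (- L)).
  assert (key : forall x y, exp (- L) <= x <= exp L -> exp (- L) <= y <= exp L -> x < y ->
     Rabs (y * ln y - x * ln x) <= (L + 1) * Rabs (y - x)).
  { intros u v Hu Hv Huv.
    destruct (mean_value (fun t => t * ln t) (fun t => ln t + 1) u v Huv) as [m [Hm E]].
    { intros t Ht. der. lra. field. lra. }
    simpl in E. rewrite E, Rabs_mult. apply Rmult_le_compat_r; [apply Rabs_pos|].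
    assert (Hl := abs_ln_le m L ltac:(lra)).
    apply Rabs_le_between in Hl. apply Rabs_le. lra. }
  destruct (Rtotal_order x y) as [H|[->|H]].
  - rewrite (Rabs_minus_sym (x * ln x)), (Rabs_minus_sym x). auto.
  - rewrite !Rminus_diag, Rabs_R0. lra.
  - auto.
Qed.

(** [P] is a potential of a solution [h = P'] of the viscous equation on [A]: an
    antiderivative of that equation is the second relation, in which the zeroth
    order term [g P] makes a maximum principle available. *)
Definition viscous_potential (g l eps : R) (A : R -> Prop) (P h : R -> R) : Prop :=
  forall z, A z -> is_derive P z (h z) /\
    is_derive h z ((g * P z - l * z * h z + h z ^ 2 / 2) / eps).

Section Between.
Variables (g l eps k c : R) (Q q q1 : R -> R).
Hypothesis Hg : 0 < g.
Hypothesis Hl : 0 < l.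
Hypothesis Heps : 0 < eps.
Hypothesis Hk : 0 < k.
Hypothesis HQ : forall z, is_derive Q z (q z).
Hypothesis Hq : forall z, z <> c -> is_derive q z (q1 z).
Hypothesis Hqc : forall z, continuous q z.
Hypothesis Hres : forall z, z <> c ->
  Rabs (eps * q1 z + l * z * q z - q z ^ 2 / 2 - g * Q z) <= g * k / 2.

(** The Hopf-Cole images of [Q - k] ([sg = 1]) and [Q + k] ([sg = -1]). *)
Definition bar (sg z : R) : R := exp (- (Q z - sg * k) / (2 * eps)).
Definition bar1 (sg z : R) : R := - q z / (2 * eps) * bar sg z.
Definition bar2 (sg z : R) : R :=
  (- q1 z / (2 * eps) + q z ^ 2 / (4 * eps ^ 2)) * bar sg z.

Lemma bar_pos sg z : 0 < bar sg z.
Proof. apply exp_pos. Qed.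

Lemma bar_derive sg z : is_derive (bar sg) z (bar1 sg z).
Proof. unfold bar. der. unfold bar1, bar. field. lra. Qed.

Lemma bar1_derive sg z : z <> c -> is_derive (bar1 sg) z (bar2 sg z).
Proof.
  intros Hz. assert (H1 := Hq z Hz). assert (H2 := bar_derive sg z).
  unfold bar1. der. unfold bar2, bar1. field. lra.
Qed.

Lemma bar1_continuous sg z : continuous (bar1 sg) z.
Proof.
  unfold bar1. apply continuous_R_mult.
  - unfold Rdiv. apply continuous_R_mult; [|apply continuous_const].
    apply (continuous_opp q), Hqc.
  - eapply continuous_of_derive, bar_derive.
Qed.

(** Since [|residual| <= g k / 2], the right-hand side has the sign of [- sg]: the two
    bars are a strict supersolution and a strict subsolution of
    [eps v'' + l z v' = g v ln v], the Hopf-Cole form of the viscous equation. *)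
Lemma bar_equation sg z :
  eps * bar2 sg z + l * z * bar1 sg z - g * bar sg z * ln (bar sg z) =
  - (bar sg z / (2 * eps)) *
    (eps * q1 z + l * z * q z - q z ^ 2 / 2 - g * Q z + sg * (g * k)).
Proof.
  unfold bar2, bar1. unfold bar at 4. rewrite ln_exp. field. lra.
Qed.

Lemma bar_order z : bar (-1) z <= bar 1 z.
Proof.
  apply exp_le_compat. unfold Rdiv. apply Rmult_le_compat_r; [|lra].
  left. apply Rinv_0_lt_compat. lra.
Qed.

Section Interval.
Variable n : R.
Hypothesis Hn : 0 < n.
Let tau t := clamp (- n) n t.
Let cl t x := clamp (bar (-1) (tau t)) (bar 1 (tau t)) x.
Let F t x y := (g * (cl t x * ln (cl t x)) - l * tau t * y) / eps.

Lemma bar_bounds : exists L, 0 < L /\ forall sg t, Rabs sg = 1 -> - n <= t <= n ->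
  exp (- L) <= bar sg t <= exp L.
Proof.
  destruct (bounded_on_segment Q (- n) n) as [M [HM HM']].
  { intros x _. eapply continuous_of_derive, HQ. }
  exists ((M + k) / (2 * eps)). split; [apply Rdiv_lt_0_compat; lra|].
  intros sg t Hsg Ht. specialize (HM' t Ht). apply Rabs_le_between in HM'.
  assert (Hs : - k <= sg * k <= k).
  { apply Rabs_le_between. rewrite Rabs_mult, Hsg, (Rabs_right k); lra. }
  unfold bar. rewrite <- Rdiv_opp_l.
  split; apply exp_le_compat; apply Rmult_le_compat_r; try lra;
    left; apply Rinv_0_lt_compat; lra.
Qed.

Lemma tau_in t : - n <= tau t <= n.
Proof. apply clamp_bounds. lra. Qed.

Lemma rhs_regular : exists L G, 0 < L /\ 0 <= G /\
  (forall t x, exp (- L) <= cl t x <= exp L) /\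
  (forall t x y x' y', Rabs (F t x y - F t x' y') <=
     ((g * (L + 1) + l * n) / eps) * (Rabs (x - x') + Rabs (y - y'))) /\
  (forall t x, Rabs (g * (cl t x * ln (cl t x)) / eps) <= G).
Proof.
  destruct bar_bounds as [L [HL Hb]].
  assert (Hcl : forall t x, exp (- L) <= cl t x <= exp L).
  { intros t x.
    assert (H1 := Hb 1 (tau t) Rabs_R1 (tau_in t)).
    assert (H2 := Hb (-1) (tau t) ltac:(rewrite Rabs_left; lra) (tau_in t)).
    assert (H3 := clamp_bounds _ _ x (bar_order (tau t))). unfold cl. lra. }
  assert (He : 0 < / eps) by now apply Rinv_0_lt_compat.
  exists L, (g * (exp L * L) / eps).
  split; auto. split; [|split; [|split]]; auto.
  - assert (0 < exp L) by apply exp_pos.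
    apply Rmult_le_pos; [|lra]. repeat apply Rmult_le_pos; lra.
  - intros t x y x' y'. unfold F.
    replace ((g * (cl t x * ln (cl t x)) - l * tau t * y) / eps -
        (g * (cl t x' * ln (cl t x')) - l * tau t * y') / eps)
      with ((g * (cl t x * ln (cl t x) - cl t x' * ln (cl t x')) - l * (tau t * (y - y'))) * / eps)
      by (field; lra).
    rewrite Rabs_mult, (Rabs_right (/ eps)) by lra.
    replace ((g * (L + 1) + l * n) / eps * (Rabs (x - x') + Rabs (y - y')))
      with (((g * (L + 1) + l * n) * (Rabs (x - x') + Rabs (y - y'))) * / eps) by (field; lra).
    apply Rmult_le_compat_r; [lra|].
    eapply Rle_trans; [apply Rabs_triang|]. rewrite Rabs_Ropp, !Rabs_mult.
    rewrite (Rabs_right g), (Rabs_right l) by lra.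
    assert (H1 := xlnx_lipschitz L (cl t x) (cl t x') ltac:(lra) (Hcl t x) (Hcl t x')).
    assert (H2 : Rabs (cl t x - cl t x') <= Rabs (x - x')) by apply clamp_lipschitz.
    assert (H3 : Rabs (tau t) <= n) by (apply Rabs_le, tau_in).
    assert (H4 := Rabs_pos (x - x')). assert (H5 := Rabs_pos (y - y')).
    assert (g * Rabs (cl t x * ln (cl t x) - cl t x' * ln (cl t x')) <= g * ((L + 1) * Rabs (x - x'))).
    { apply Rmult_le_compat_l; [lra|]. eapply Rle_trans; [exact H1|].
      apply Rmult_le_compat_l; lra. }
    assert (l * (Rabs (tau t) * Rabs (y - y')) <= l * (n * Rabs (y - y'))).
    { apply Rmult_le_compat_l; [lra|]. apply Rmult_le_compat_r; lra. }
    assert (0 <= g * (L + 1) * Rabs (y - y')).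
    { repeat apply Rmult_le_pos; lra. }
    assert (0 <= l * n * Rabs (x - x')).
    { repeat apply Rmult_le_pos; lra. }
    lra.
  - intros t x. unfold Rdiv. rewrite !Rabs_mult, (Rabs_right (/ eps)), (Rabs_right g) by lra.
    apply Rmult_le_compat_r; [lra|]. apply Rmult_le_compat_l; [lra|].
    specialize (Hcl t x). assert (Hp := exp_pos (- L)).
    apply Rmult_le_compat; try apply Rabs_pos.
    rewrite Rabs_right; lra. now apply abs_ln_le.
Qed.

Lemma rhs_continuous x y t : continuous (fun t => F t x y) t.
Proof.
  assert (Ht : continuous tau t).
  { apply continuous_clamp. apply continuous_const. apply continuous_const. apply continuous_id. }
  assert (Hb : forall sg, continuous (fun t => bar sg (tau t)) t).
  { intros sg. apply (continuous_R_comp (bar sg)); auto.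
    eapply continuous_of_derive, bar_derive. }
  assert (Hc : continuous (fun t => cl t x) t).
  { apply continuous_clamp; auto. apply continuous_const. }
  unfold F. unfold Rdiv. apply continuous_R_mult; [|apply continuous_const].
  apply continuous_R_minus.
  - apply continuous_R_mult; [apply continuous_const|].
    apply continuous_R_mult; auto.
    apply (continuous_R_comp ln); auto.
    apply continuous_of_derive with (1 / cl t x).
    apply (der_ln (fun y => y)); [|apply der_id].
    assert (H := clamp_bounds _ _ x (bar_order (tau t))).
    assert (H' := bar_pos (-1) (tau t)). unfold cl. lra.
  - apply continuous_R_mult; [|apply continuous_const].
    apply continuous_R_mult; auto. apply continuous_const.
Qed.

(** Shooting from the left end: the clamped right-hand side is bounded, so large
    initial slopes of either sign send the right end value anywhere. *)
Lemma shooting (x0 x1 : R) : exists X Y : R -> R,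
  X (- n) = x0 /\ X n = x1 /\
  forall t, is_derive X t (Y t) /\ is_derive Y t (F t (X t) (Y t)).
Proof.
  destruct rhs_regular as [L [G [HL [HG [Hcl [HF HGb]]]]]].
  set (Lam := (g * (L + 1) + l * n) / eps) in *.
  assert (He : 0 < / eps) by now apply Rinv_0_lt_compat.
  assert (HLam : 0 < Lam).
  { apply Rdiv_lt_0_compat; auto. apply Rplus_lt_0_compat; apply Rmult_lt_0_compat; lra. }
  assert (Hsol : forall s, exists XY : (R -> R) * (R -> R),
    fst XY (- n) = x0 /\ snd XY (- n) = s /\
    forall t, is_derive (fst XY) t (snd XY t) /\ is_derive (snd XY) t (F t (fst XY t) (snd XY t))).
  { intros s.
    destruct (picard_lindelof F Lam (G + l * n * Rabs s / eps) (- n) x0 s) as [X [Y H]]; auto.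
    - apply rhs_continuous.
    - intros t. unfold F.
      replace ((g * (cl t x0 * ln (cl t x0)) - l * tau t * s) / eps)
        with (g * (cl t x0 * ln (cl t x0)) / eps + - (l * tau t * s / eps)) by (field; lra).
      eapply Rle_trans; [apply Rabs_triang|]. apply Rplus_le_compat; [apply HGb|].
      rewrite Rabs_Ropp. unfold Rdiv. rewrite !Rabs_mult, (Rabs_right (/ eps)), (Rabs_right l) by lra.
      apply Rmult_le_compat_r; [lra|]. apply Rmult_le_compat_r; [apply Rabs_pos|].
      apply Rmult_le_compat_l; [lra|]. apply Rabs_le, tau_in.
    - exists (X, Y). exact H. }
  destruct (functional_choice _ Hsol) as [S HS]. clear Hsol.
  set (V := fun s => fst (S s) n).
  set (A := 1 + 3 * Lam).
  assert (HVlip : forall s1 s2, (V s1 - V s2) ^ 2 <= (s1 - s2) ^ 2 * exp (A * (n - - n))).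
  { intros s1 s2. destruct (HS s1) as [H1 [H2 H3]]. destruct (HS s2) as [H4 [H5 H6]].
    set (X1 := fst (S s1)) in *. set (Y1 := snd (S s1)) in *.
    set (X2 := fst (S s2)) in *. set (Y2 := snd (S s2)) in *.
    assert (H := gronwall_pos A (fun t => (X1 t - X2 t) ^ 2 + (Y1 t - Y2 t) ^ 2)
      (fun t => 2 * (X1 t - X2 t) * (Y1 t - Y2 t) +
         2 * (Y1 t - Y2 t) * (F t (X1 t) (Y1 t) - F t (X2 t) (Y2 t))) (- n) n).
    assert (Hfin : (X1 n - X2 n) ^ 2 + (Y1 n - Y2 n) ^ 2 <=
      ((X1 (- n) - X2 (- n)) ^ 2 + (Y1 (- n) - Y2 (- n)) ^ 2) * exp (A * (n - - n))).
    { apply H; try lra.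
      - intros t _. destruct (H3 t) as [D1 D2]. destruct (H6 t) as [D3 D4].
        der. ring.
      - intros t _. specialize (HF t (X1 t) (Y1 t) (X2 t) (Y2 t)).
        set (dx := X1 t - X2 t) in *. set (dy := Y1 t - Y2 t) in *.
        set (dF := F t (X1 t) (Y1 t) - F t (X2 t) (Y2 t)) in *.
        assert (Hm : dy * dF <= Rabs dy * (Lam * (Rabs dx + Rabs dy))).
        { eapply Rle_trans; [apply Rle_abs|]. rewrite Rabs_mult.
          apply Rmult_le_compat_l; [apply Rabs_pos|auto]. }
        assert (E1 : dx ^ 2 = Rabs dx ^ 2) by (symmetry; apply pow2_abs).
        assert (E2 : dy ^ 2 = Rabs dy ^ 2) by (symmetry; apply pow2_abs).
        assert (Hm2 : dx * dy <= Rabs dx * Rabs dy).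
        { rewrite <- Rabs_mult. apply Rle_abs. }
        rewrite E1, E2. clear E1 E2.
        assert (Hp1 := Rabs_pos dx). assert (Hp2 := Rabs_pos dy).
        set (ax := Rabs dx) in *. set (ay := Rabs dy) in *.
        assert (2 * (ax * ay) <= ax ^ 2 + ay ^ 2) by (assert (0 <= (ax - ay) ^ 2) by apply pow2_ge_0; lra).
        assert (2 * (ay * (ax + ay)) <= 3 * (ax ^ 2 + ay ^ 2)).
        { assert (0 <= ax ^ 2) by apply pow2_ge_0. lra. }
        assert (Lam * (2 * (ay * (ax + ay))) <= Lam * (3 * (ax ^ 2 + ay ^ 2))).
        { apply Rmult_le_compat_l; lra. }
        unfold A. lra. }
    rewrite H1, H2, H4, H5 in Hfin. unfold V. fold X1 X2.
    assert (0 <= (Y1 n - Y2 n) ^ 2) by apply pow2_ge_0.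
    replace (x0 - x0) with 0 in Hfin by ring.
    replace (0 ^ 2 + (s1 - s2) ^ 2) with ((s1 - s2) ^ 2) in Hfin by ring. lra. }
  assert (HVc : continuity V).
  { intros s. apply continuity_pt_of_continuous, continuous_ed. intros e He0.
    set (C := exp (A * (n - - n))) in *.
    assert (HC : 0 < C) by apply exp_pos.
    set (r := e / (C + 1)).
    assert (Hr : 0 < r) by (apply Rdiv_lt_0_compat; lra).
    exists r. split; auto. intros s' Hs'. specialize (HVlip s' s). fold C in HVlip.
    apply Rabs_def2 in Hs'.
    destruct (Rlt_le_dec (Rabs (V s' - V s)) e) as [|Hc]; auto. exfalso.
    assert (e ^ 2 <= (V s' - V s) ^ 2).
    { rewrite <- (pow2_abs (V s' - V s)). apply pow_incr. lra. }
    assert ((s' - s) ^ 2 < r ^ 2) by nra.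
    assert (Er : e = r * (C + 1)) by (unfold r; field; lra).
    assert ((s' - s) ^ 2 * C <= r ^ 2 * C) by (apply Rmult_le_compat_r; lra).
    assert (0 < r ^ 2) by nra.
    assert (e ^ 2 = r ^ 2 * (C + 1) ^ 2) by (rewrite Er; ring).
    nra. }
  assert (Hfar : forall sg m, Rabs sg = 1 -> 0 <= m ->
     2 * n * m <= sg * (V (sg * (2 * n * G + m)) - x0)).
  { intros sg m Hsg Hm. set (s := sg * (2 * n * G + m)).
    assert (Hsg2 : sg * sg = 1).
    { exact (abs_one_sqr sg Hsg). }
    destruct (HS s) as [H1 [H2 H3]].
    set (X := fst (S s)) in *. set (Y := snd (S s)) in *.
    set (E := exp (l * n ^ 2 / (2 * eps))).
    assert (HY : forall t, - n <= t <= n -> m <= sg * Y t).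
    { intros t Ht.
      assert (Hb : 0 <= exp (l * t ^ 2 / (2 * eps)) * (sg * Y t) - E * (2 * n * G + m - G * (t + n))).
      { apply (barrier 0 (fun t => exp (l * t ^ 2 / (2 * eps)) * (sg * Y t) - E * (2 * n * G + m - G * (t + n)))
          (fun t => exp (l * t ^ 2 / (2 * eps)) * (sg * (g * (cl t (X t) * ln (cl t (X t))) / eps)) + E * G)
          (- n) n); auto.
        - intros u Hu. destruct (H3 u) as [_ D]. unfold F in D.
          replace (tau u) with u in D by (symmetry; apply clamp_id; lra).
          der. field. lra.
        - rewrite H2. replace ((- n) ^ 2) with (n ^ 2) by ring. fold E. unfold s.
          replace (sg * (sg * (2 * n * G + m))) with (sg * sg * (2 * n * G + m)) by ring.
          rewrite Hsg2. right; ring.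
        - intros u Hu _. rewrite Rmult_0_l. specialize (HGb u (X u)).
          set (K := g * (cl u (X u) * ln (cl u (X u))) / eps) in *.
          assert (- G <= sg * K).
          { assert (HsK : Rabs (sg * K) <= G) by (rewrite Rabs_mult, Hsg; lra).
            apply Rabs_le_between in HsK; lra. }
          assert (Hle : exp (l * u ^ 2 / (2 * eps)) <= E).
          { apply exp_le_compat. apply Rmult_le_compat_r.
            left; apply Rinv_0_lt_compat; lra. apply Rmult_le_compat_l; [lra|].
            rewrite <- (pow2_abs u). apply pow_incr. split; [apply Rabs_pos|].
            apply Rabs_le; lra. }
          assert (Hep := exp_pos (l * u ^ 2 / (2 * eps))).
          nra. }
      set (e := exp (l * t ^ 2 / (2 * eps))) in *.
      assert (Hle : e <= E).
      { apply exp_le_compat. apply Rmult_le_compat_r.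
        left; apply Rinv_0_lt_compat; lra. apply Rmult_le_compat_l; [lra|].
        rewrite <- (pow2_abs t). apply pow_incr. split; [apply Rabs_pos|].
        apply Rabs_le; lra. }
      assert (Hep : 0 < e) by apply exp_pos.
      assert (m <= 2 * n * G + m - G * (t + n)).
      { assert (G * (t + n) <= G * (2 * n)) by (apply Rmult_le_compat_l; lra). lra. }
      assert (E * m <= E * (2 * n * G + m - G * (t + n))) by (apply Rmult_le_compat_l; lra).
      apply Rmult_le_reg_l with e; auto. nra. }
    destruct (mean_value X Y (- n) n) as [xi [Hxi Exi]]; [lra| |].
    { intros t _; apply H3. }
    rewrite H1 in Exi. unfold V. fold X.
    rewrite Exi. specialize (HY xi ltac:(lra)). nra. }
  set (m := Rabs (x1 - x0) / (2 * n)).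
  assert (Hm : 0 <= m).
  { apply Rmult_le_pos; [apply Rabs_pos|]. left. apply Rinv_0_lt_compat. lra. }
  assert (Em : 2 * n * m = Rabs (x1 - x0)) by (unfold m; field; lra).
  assert (Hp := Hfar 1 m Rabs_R1 Hm). assert (Hq' := Hfar (-1) m ltac:(rewrite Rabs_left; lra) Hm).
  assert (Hr1 := Rle_abs (x1 - x0)). assert (Hr2 := Rle_abs (- (x1 - x0))). rewrite Rabs_Ropp in Hr2.
  destruct (IVT_gen V (-1 * (2 * n * G + m)) (1 * (2 * n * G + m)) x1 HVc) as [s [_ Hs]].
  { rewrite Rmin_left, Rmax_right by lra. lra. }
  destruct (HS s) as [H1 [H2 H3]].
  exists (fst (S s)), (snd (S s)). auto.
Qed.

(** The solution of the clamped problem stays between the two bars, by the maximum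
    principle applied to [sg (X - bar sg)], so that the clamp is not felt. *)
Lemma clamped_between (X Y : R -> R) :
  X (- n) = bar (-1) (- n) -> X n = bar (-1) n ->
  (forall t, is_derive X t (Y t) /\ is_derive Y t (F t (X t) (Y t))) ->
  forall t, - n <= t <= n -> bar (-1) t <= X t <= bar 1 t.
Proof.
  intros Hx0 Hx1 HXY.
  assert (key : forall sg, Rabs sg = 1 ->
     (forall t x, - n <= t <= n -> 0 < sg * (x - bar sg t) -> cl t x = bar sg t) ->
     sg * (X (- n) - bar sg (- n)) <= 0 -> sg * (X n - bar sg n) <= 0 ->
     forall t, - n <= t <= n -> sg * (X t - bar sg t) <= 0).
  { intros sg Hsg Hcl Ha Hb.
    assert (Hsg2 : sg * sg = 1).
    { exact (abs_one_sqr sg Hsg). }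
    assert (HE : forall z, is_derive (fun t => sg * (X t - bar sg t)) z (sg * (Y z - bar1 sg z))).
    { intros z. destruct (HXY z) as [D1 _]. assert (D2 := bar_derive sg z). der. ring. }
    apply (max_principle _ (fun t => sg * (Y t - bar1 sg t))); auto; try lra.
    intros x Hx Hpos Hcrit.
    destruct bar_bounds as [L [HL HLb]].
    set (mu := exp (- L) * (g * k) / (4 * eps * (l * n + 1))).
    assert (Hln : 0 < l * n) by (apply Rmult_lt_0_compat; lra).
    assert (Hmu : 0 < mu).
    { apply Rdiv_lt_0_compat. apply Rmult_lt_0_compat; [apply exp_pos|]. now apply Rmult_lt_0_compat.
      apply Rmult_lt_0_compat; lra. }
    assert (HcE1 : continuous (fun t => sg * (Y t - bar1 sg t)) x).
    { apply continuous_R_mult; [apply continuous_const|].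
      apply continuous_R_minus; [|apply bar1_continuous].
      destruct (HXY x) as [_ D]. eapply continuous_of_derive, D. }
    destruct (proj1 (continuous_ed _ _) HcE1 mu Hmu) as [r1 [Hr1 H1]].
    destruct (proj1 (continuous_ed _ _) (continuous_of_derive _ _ _ (HE x)) _ Hpos) as [r2 [Hr2 H2]].
    assert (Hr3 : exists r3, 0 < r3 /\ forall z, x < z < x + r3 -> z <> c).
    { destruct (Rlt_le_dec x c). exists (c - x). split; [lra|intros; lra].
      exists 1. split; [lra|intros; lra]. }
    destruct Hr3 as [r3 [Hr3 H3]].
    set (r := Rmin (Rmin r1 r2) (Rmin r3 (n - x))).
    assert (Hr : 0 < r /\ r <= r1 /\ r <= r2 /\ r <= r3 /\ r <= n - x).
    { unfold r. split. repeat apply Rmin_glb_lt; lra.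
      assert (Hm1 := Rmin_l (Rmin r1 r2) (Rmin r3 (n - x))).
      assert (Hm2 := Rmin_r (Rmin r1 r2) (Rmin r3 (n - x))).
      assert (Hm3 := Rmin_l r1 r2). assert (Hm4 := Rmin_r r1 r2).
      assert (Hm5 := Rmin_l r3 (n - x)). assert (Hm6 := Rmin_r r3 (n - x)). lra. }
    exists r. split; [lra|].
    assert (HE2 : forall z, x < z < x + r ->
      is_derive (fun t => sg * (Y t - bar1 sg t)) z (sg * (F z (X z) (Y z) - bar2 sg z)) /\
      0 < sg * (F z (X z) (Y z) - bar2 sg z)).
    { intros z Hz. split.
      - destruct (HXY z) as [_ D1]. assert (D2 := bar1_derive sg z (H3 z ltac:(lra))).
        der. ring.
      - assert (Hz1 : Rabs (z - x) < r1) by (rewrite Rabs_right; lra).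
        assert (Hz2 : Rabs (z - x) < r2) by (rewrite Rabs_right; lra).
        specialize (H1 z Hz1). specialize (H2 z Hz2). simpl in H1, H2.
        rewrite Hcrit, Rminus_0_r in H1.
        apply Rabs_def2 in H2.
        assert (Hzpos : 0 < sg * (X z - bar sg z)) by lra.
        unfold F. rewrite (Hcl z (X z)) by lra.
        replace (tau z) with z by (symmetry; apply clamp_id; lra).
        assert (Heq := bar_equation sg z).
        assert (Hrz := Hres z (H3 z ltac:(lra))).
        set (R0 := eps * q1 z + l * z * q z - q z ^ 2 / 2 - g * Q z) in *.
        replace (sg * ((g * (bar sg z * ln (bar sg z)) - l * z * Y z) / eps - bar2 sg z))
          with ((- (l * z) * (sg * (Y z - bar1 sg z)) - sg *
                (eps * bar2 sg z + l * z * bar1 sg z - g * bar sg z * ln (bar sg z))) / eps)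
          by (field; lra).
        rewrite Heq. apply Rdiv_lt_0_compat; auto.
        replace (- sg * (- (bar sg z / (2 * eps)) * (R0 + sg * (g * k))))
          with (bar sg z / (2 * eps) * (sg * R0 + (sg * sg) * (g * k))) by (field; lra).
        assert (Hsr : - (g * k / 2) <= sg * R0).
        { assert (HsR : Rabs (sg * R0) <= g * k / 2) by (rewrite Rabs_mult, Hsg; lra).
          apply Rabs_le_between in HsR; lra. }
        assert (Hgk : 0 < g * k) by now apply Rmult_lt_0_compat.
        assert (Hbz := HLb sg z Hsg ltac:(lra)).
        assert (Hb2 : exp (- L) / (2 * eps) * (g * k / 2) <= bar sg z / (2 * eps) * (sg * R0 + sg * sg * (g * k))).
        { rewrite Hsg2. apply Rmult_le_compat; try lra.
          - apply Rmult_le_pos. left; apply exp_pos. left; apply Rinv_0_lt_compat; lra.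
          - apply Rmult_le_compat_r; [|lra]. left; apply Rinv_0_lt_compat; lra. }
        assert (Hlz : Rabs (l * z * (sg * (Y z - bar1 sg z))) <= l * n * mu).
        { rewrite !Rabs_mult, (Rabs_right l) by lra. rewrite <- Rabs_mult.
          apply Rmult_le_compat; try lra.
          apply Rmult_le_pos; [lra|apply Rabs_pos]. apply Rabs_pos.
          apply Rmult_le_compat_l; [lra|]. apply Rabs_le; lra. }
        assert (Hmu2 : exp (- L) / (2 * eps) * (g * k / 2) = (l * n + 1) * mu).
        { unfold mu. field. split; lra. }
        apply Rabs_le_between in Hlz. 
        replace (- (l * z) * (sg * (Y z - bar1 sg z))) with (- (l * z * (sg * (Y z - bar1 sg z)))) by ring.
        replace (sg * (- (bar sg z / (2 * eps)) * (R0 + sg * (g * k)))) with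
          (- (bar sg z / (2 * eps) * (sg * R0 + sg * sg * (g * k)))) by ring.
        lra. }
    exact (pos_after_of_right_derive _ _ x r HcE1 Hcrit HE2). }
  intros t Ht.
  assert (Ho := bar_order t).
  assert (Ka := key 1 Rabs_R1). assert (Kb := key (-1) ltac:(rewrite Rabs_left; lra)).
  assert (Hoa := bar_order (- n)). assert (Hob := bar_order n).
  assert (Htau : forall u, - n <= u <= n -> tau u = u) by (intros; apply clamp_id; lra).
  split.
  - assert (-1 * (X t - bar (-1) t) <= 0); [|lra].
    apply Kb; auto; try lra.
    intros u x Hu Hx. unfold cl. rewrite Htau by lra. apply clamp_below; [apply bar_order|lra].
  - assert (1 * (X t - bar 1 t) <= 0); [|lra].
    apply Ka; auto; try lra.
    intros u x Hu Hx. unfold cl. rewrite Htau by lra. apply clamp_above; [apply bar_order|lra].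
Qed.

Lemma potential_on_interval : exists P h : R -> R,
  viscous_potential g l eps (fun z => - n <= z <= n) P h /\
  (forall z, - n <= z <= n -> Rabs (P z - Q z) <= k) /\
  P (- n) = Q (- n) + k /\ P n = Q n + k.
Proof.
  destruct (shooting (bar (-1) (- n)) (bar (-1) n)) as [X [Y [H0 [H1 H]]]].
  assert (Hb := clamped_between X Y H0 H1 H).
  assert (Hpos : forall z, - n <= z <= n -> 0 < X z).
  { intros z Hz. specialize (Hb z Hz). assert (Hp := bar_pos (-1) z). lra. }
  exists (fun z => - 2 * eps * ln (X z)), (fun z => - 2 * eps * (Y z / X z)).
  split; [|split; [|split]].
  - intros z Hz. destruct (H z) as [D1 D2]. specialize (Hpos z Hz). specialize (Hb z Hz).
    split.
    + der. exact Hpos. field. lra.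
    + unfold F in D2. replace (tau z) with z in D2 by (symmetry; apply clamp_id; lra).
      assert (E : cl z (X z) = X z).
      { unfold cl. replace (tau z) with z by (symmetry; apply clamp_id; lra).
        apply clamp_id. lra. }
      rewrite E in D2. der. lra. field. lra.
  - intros z Hz. specialize (Hpos z Hz). specialize (Hb z Hz).
    assert (L1 : ln (bar (-1) z) <= ln (X z)) by (apply ln_le; [apply bar_pos|lra]).
    assert (L2 : ln (X z) <= ln (bar 1 z)) by (apply ln_le; lra).
    unfold bar in L1, L2. rewrite ln_exp in L1, L2.
    apply (Rmult_le_compat_l (2 * eps)) in L1; [|lra].
    apply (Rmult_le_compat_l (2 * eps)) in L2; [|lra].
    replace (2 * eps * (- (Q z - -1 * k) / (2 * eps))) with (- Q z - k) in L1 by (field; lra).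
    replace (2 * eps * (- (Q z - 1 * k) / (2 * eps))) with (- Q z + k) in L2 by (field; lra).
    apply Rabs_le. lra.
  - rewrite H0. unfold bar. rewrite ln_exp. field. lra.
  - rewrite H1. unfold bar. rewrite ln_exp. field. lra.
Qed.
End Interval.
End Between.

(** The Hopf-Cole image of a potential solves a linear equation up to a bounded
    term, which gives a gradient bound from a bound on [P] alone. *)
Lemma local_gradient g l eps Z Mp : 0 < g -> 0 < l -> 0 < eps -> 0 < Z -> 0 < Mp ->
  exists C, 0 < C /\ forall P h z, Rabs z <= Z ->
    viscous_potential g l eps (fun t => z <= t <= z + 1) P h ->
    (forall t, z <= t <= z + 1 -> Rabs (P t) <= Mp) -> Rabs (h z) <= C.
Proof.
  intros Hg Hl He HZ HM.
  set (m := exp (Mp / (2 * eps))).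
  assert (Hm : 0 < m) by apply exp_pos.
  set (A := l * (Z + 1) / eps). set (B := g * m * Mp / (2 * eps ^ 2)).
  assert (HA : 0 < A) by (apply Rdiv_lt_0_compat; auto; apply Rmult_lt_0_compat; lra).
  assert (HB : 0 < B).
  { apply Rdiv_lt_0_compat. repeat apply Rmult_lt_0_compat; auto.
    apply Rmult_lt_0_compat; [lra|]. now apply pow_lt. }
  exists (2 * eps * m * ((2 * m / 1 + B * 1) * exp (A * 1))).
  split.
  { repeat apply Rmult_lt_0_compat; try lra; try apply exp_pos. }
  intros P h z Hz HP Hb.
  set (v := fun t => exp (- P t / (2 * eps))).
  set (v1 := fun t => - h t / (2 * eps) * v t).
  assert (Hi2 : 0 < / (2 * eps)) by (apply Rinv_0_lt_compat; lra).
  assert (Hv : forall t, z <= t <= z + 1 -> / m <= v t <= m).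
  { intros t Ht. unfold v, m. rewrite <- exp_Ropp.
    specialize (Hb t Ht). apply Rabs_le_between in Hb.
    split; apply exp_le_compat.
    - rewrite <- Rdiv_opp_l. apply Rmult_le_compat_r; lra.
    - apply Rmult_le_compat_r; lra. }
  assert (Hd : Rabs (v1 z) <= (2 * m / 1 + B * 1) * exp (A * 1)).
  { apply (interior_gradient v v1
      (fun t => (- g * P t / (2 * eps) * v t - l * t * v1 t) / eps) m A B z 1); try lra.
    - intros t Ht. destruct (HP t Ht) as [D1 D2]. unfold v. der. unfold v1, v. field. lra.
    - intros t Ht. destruct (HP t Ht) as [D1 D2].
      assert (D3 : is_derive v t (v1 t)).
      { unfold v. der. unfold v1, v. field. lra. }
      unfold v1. der. unfold v1. field. lra.
    - intros t Ht. specialize (Hv t Ht).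
      assert (0 < / m) by now apply Rinv_0_lt_compat. rewrite Rabs_right; lra.
    - intros t Ht. specialize (Hv t Ht). specialize (Hb t Ht).
      assert (0 < / m) by now apply Rinv_0_lt_compat.
      replace ((- g * P t / (2 * eps) * v t - l * t * v1 t) / eps)
        with (- (l / eps * t * v1 t) + - (g / (2 * eps ^ 2) * (P t * v t))) by (field; lra).
      eapply Rle_trans; [apply Rabs_triang|]. rewrite !Rabs_Ropp.
      assert (Hle : 0 < l / eps) by (apply Rdiv_lt_0_compat; lra).
      assert (Hge : 0 < g / (2 * eps ^ 2)).
      { apply Rdiv_lt_0_compat; auto. apply Rmult_lt_0_compat; [lra|]. now apply pow_lt. }
      apply Rplus_le_compat.
      + rewrite !Rabs_mult, (Rabs_right (l / eps)) by lra.
        apply Rmult_le_compat_r; [apply Rabs_pos|].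
        replace A with (l / eps * (Z + 1)) by (unfold A; field; lra).
        apply Rmult_le_compat_l; [lra|].
        apply Rabs_le_between in Hz. apply Rabs_le; lra.
      + rewrite !Rabs_mult, (Rabs_right (g / (2 * eps ^ 2))) by lra.
        replace B with (g / (2 * eps ^ 2) * (Mp * m)) by (unfold B; field; lra).
        apply Rmult_le_compat_l; [lra|].
        apply Rmult_le_compat; try apply Rabs_pos; auto. rewrite Rabs_right; lra. }
  set (K := (2 * m / 1 + B * 1) * exp (A * 1)) in *.
  specialize (Hv z ltac:(lra)).
  replace (h z) with (- (2 * eps * v1 z / v z)).
  2: { assert (0 < / m) by now apply Rinv_0_lt_compat. unfold v1. field. split; lra. }
  rewrite Rabs_Ropp. unfold Rdiv. rewrite !Rabs_mult, (Rabs_right 2), (Rabs_right eps) by lra.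
  assert (Hvp : 0 < v z) by (assert (0 < / m) by (now apply Rinv_0_lt_compat); lra).
  assert (Hivp : 0 < / v z) by now apply Rinv_0_lt_compat.
  assert (Hiv : / v z <= m).
  { rewrite <- (Rinv_inv m). apply Rinv_le_contravar; [now apply Rinv_0_lt_compat|lra]. }
  rewrite (Rabs_right (/ v z)) by lra.
  assert (Hpz := Rabs_pos (v1 z)).
  assert (H : Rabs (v1 z) * / v z <= K * m).
  { apply Rmult_le_compat; auto. left; auto. }
  apply (Rmult_le_compat_l (2 * eps)) in H; lra.
Qed.

Lemma lipschitz_of_bound (f df : R -> R) (C t r s : R) :
  (forall x, Rabs (x - t) <= r -> is_derive f x (df x)) ->
  (forall x, Rabs (x - t) <= r -> Rabs (df x) <= C) ->
  Rabs (s - t) <= r -> Rabs (f s - f t) <= C * Rabs (s - t).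
Proof.
  intros Hd Hb Hs.
  assert (Hin : forall x, Rmin t s <= x <= Rmax t s -> Rabs (x - t) <= r).
  { intros x. unfold Rmin, Rmax. destruct (Rle_dec t s); intros Hx.
    rewrite Rabs_right in Hs by lra. apply Rabs_le; lra.
    rewrite Rabs_left1 in Hs by lra. apply Rabs_le; lra. }
  destruct (MVT_gen f t s df) as [x [Hx E]].
  - intros x Hx. apply Hd, Hin. lra.
  - intros x Hx. eapply continuity_pt_of_continuous, continuous_of_derive, Hd, Hin, Hx.
  - rewrite E, Rabs_mult. apply Rmult_le_compat_r; [apply Rabs_pos|]. apply Hb, Hin, Hx.
Qed.

Section Exhaustion.
Variables (g l eps k : R) (Q : R -> R).
Hypothesis Hg : 0 < g.
Hypothesis Hl : 0 < l.
Hypothesis Heps : 0 < eps.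
Hypothesis Hk : 0 < k.
Hypothesis HQc : forall z, continuous Q z.
Hypothesis Hint : forall n, 0 < n -> exists P h : R -> R,
  viscous_potential g l eps (fun z => - n <= z <= n) P h /\
  (forall z, - n <= z <= n -> Rabs (P z - Q z) <= k) /\
  P (- n) = Q (- n) + k /\ P n = Q n + k.

Let rad (N : nat) : R := INR N + 1.

Lemma rad_pos N : 0 < rad N.
Proof. unfold rad. assert (H := pos_INR N). lra. Qed.

Lemma rad_large r : exists N, r <= rad N.
Proof.
  destruct (INR_unbounded r) as [N HN]. exists N. unfold rad. lra.
Qed.

Lemma rad_incr N M : (N <= M)%nat -> rad N <= rad M.
Proof. intros H. apply le_INR in H. unfold rad. lra. Qed.

(** The potentials on growing intervals take the largest admissible values at the
    ends, so they decrease with the interval and converge. The local gradient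
    bounds carry the equation to the limit. *)
Lemma potential_on_line : exists P h : R -> R,
  viscous_potential g l eps (fun _ => True) P h /\
  (forall z, Rabs (P z - Q z) <= k).
Proof.
  assert (Hch : forall N, exists Ph : (R -> R) * (R -> R),
    viscous_potential g l eps (fun z => - rad N <= z <= rad N) (fst Ph) (snd Ph) /\
    (forall z, - rad N <= z <= rad N -> Rabs (fst Ph z - Q z) <= k) /\
    fst Ph (- rad N) = Q (- rad N) + k /\ fst Ph (rad N) = Q (rad N) + k).
  { intros N. destruct (Hint (rad N) (rad_pos N)) as [P [h H]]. exists (P, h). exact H. }
  destruct (functional_choice _ Hch) as [S HS]. clear Hch.
  set (p := fun N => fst (S N)). set (s := fun N => snd (S N)).
  assert (HD : forall N, viscous_potential g l eps (fun z => - rad N <= z <= rad N) (p N) (s N))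
    by (intros; apply HS).
  assert (HB : forall N z, - rad N <= z <= rad N -> Rabs (p N z - Q z) <= k)
    by (intros; now apply HS).
  assert (Hdecr : forall N M, (N <= M)%nat -> forall z, - rad N <= z <= rad N -> p M z <= p N z).
  { intros N M HNM z Hz. assert (HR := rad_incr N M HNM). assert (Hp := rad_pos N).
    cut (p M z - p N z <= 0); [lra|].
    apply (max_principle2 (fun z => p M z - p N z) (fun z => s M z - s N z)
      (fun z => (g * p M z - l * z * s M z + s M z ^ 2 / 2) / eps -
                (g * p N z - l * z * s N z + s N z ^ 2 / 2) / eps) (- rad N) (rad N)); auto.
    - lra.
    - intros t Ht. apply (der_minus (p M) (p N)); apply HD; lra.
    - intros t Ht. apply (der_minus (s M) (s N)); apply HD; lra.
    - assert (H := HB M (- rad N) ltac:(lra)). apply Rabs_le_between in H.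
      destruct (HS N) as [_ [_ [E _]]]. fold (p N) in E. lra.
    - assert (H := HB M (rad N) ltac:(lra)). apply Rabs_le_between in H.
      destruct (HS N) as [_ [_ [_ E]]]. fold (p N) in E. lra.
    - intros x Hx Hpos E. assert (Es : s M x = s N x) by lra. rewrite Es.
      replace ((g * p M x - l * x * s N x + s N x ^ 2 / 2) / eps -
        (g * p N x - l * x * s N x + s N x ^ 2 / 2) / eps)
        with (g * (p M x - p N x) / eps) by (field; lra).
      apply Rdiv_lt_0_compat; auto. now apply Rmult_lt_0_compat. }
  assert (Hlim : forall z, exists x : R, is_lim_seq (fun N => p N z) x).
  { intros z. destruct (rad_large (Rabs z)) as [N0 HN0].
    assert (Hin : forall N, - rad (N + N0) <= z <= rad (N + N0)).
    { intros N. apply Rabs_le_between.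
      eapply Rle_trans; [exact HN0|apply rad_incr; lia]. }
    destruct (ex_finite_lim_seq_decr (fun N => p (N + N0)%nat z) (Q z - k)) as [x Hx].
    - intros N. apply Hdecr; [lia|apply Hin].
    - intros N. assert (H := HB (N + N0)%nat z (Hin N)). apply Rabs_le_between in H. lra.
    - exists x. now apply (is_lim_seq_incr_n (fun N => p N z) N0). }
  destruct (functional_choice _ Hlim) as [P HP]. clear Hlim.
  assert (Hloc : forall z, exists C N0, 0 < C /\ forall N, (N0 <= N)%nat ->
     forall t, Rabs (t - z) <= 1 -> - rad N <= t <= rad N /\
       Rabs (s N t) <= C /\
       Rabs ((g * p N t - l * t * s N t + s N t ^ 2 / 2) / eps) <= C /\
       Rabs ((g * s N t - l * s N t - l * t * ((g * p N t - l * t * s N t + s N t ^ 2 / 2) / eps)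
          + s N t * ((g * p N t - l * t * s N t + s N t ^ 2 / 2) / eps)) / eps) <= C).
  { intros z. set (Z := Rabs z + 1).
    assert (HZ : 0 < Z) by (assert (H := Rabs_pos z); unfold Z; lra).
    destruct (bounded_on_segment Q (- (Z + 1)) (Z + 1)) as [M0 [HM0 HM]].
    { intros; apply HQc. }
    set (Mp := M0 + k).
    destruct (local_gradient g l eps Z Mp Hg Hl Heps HZ) as [C1 [HC1 HC]]; [unfold Mp; lra|].
    destruct (rad_large (Z + 1)) as [N0 HN0].
    set (C2 := (g * Mp + l * Z * C1 + C1 ^ 2 / 2) / eps).
    set (C3 := (g * C1 + l * C1 + l * Z * C2 + C1 * C2) / eps).
    assert (Hie : 0 < / eps) by now apply Rinv_0_lt_compat.
    assert (HC2 : 0 < C2).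
    { apply Rdiv_lt_0_compat; auto.
      assert (0 < g * Mp) by (apply Rmult_lt_0_compat; unfold Mp; lra).
      assert (0 < l * Z * C1) by (repeat apply Rmult_lt_0_compat; lra).
      assert (0 < C1 ^ 2) by now apply pow_lt. lra. }
    assert (HC3 : 0 < C3).
    { apply Rdiv_lt_0_compat; auto.
      assert (0 < g * C1) by (apply Rmult_lt_0_compat; lra).
      assert (0 < l * C1) by (apply Rmult_lt_0_compat; lra).
      assert (0 < l * Z * C2) by (apply Rmult_lt_0_compat; [apply Rmult_lt_0_compat|]; lra).
      assert (0 < C1 * C2) by (apply Rmult_lt_0_compat; lra). lra. }
    exists (C1 + C2 + C3), N0. split; [lra|]. intros N HN t Ht.
    assert (HR : Z + 1 <= rad N) by (eapply Rle_trans; [exact HN0|now apply rad_incr]).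
    assert (HtZ : Rabs t <= Z).
    { assert (H := Rabs_triang (t - z) z). replace (t - z + z) with t in H by ring. unfold Z; lra. }
    assert (HtZ' := proj1 (Rabs_le_between _ _) HtZ).
    assert (Hpb : forall u, t <= u <= t + 1 -> Rabs (p N u) <= Mp).
    { intros u Hu. assert (H1 := HB N u ltac:(lra)). assert (H2 := HM u ltac:(lra)).
      apply Rabs_le_between in H1, H2. apply Rabs_le. unfold Mp; lra. }
    assert (Hs : Rabs (s N t) <= C1).
    { apply (HC (p N) (s N) t HtZ); auto.
      intros u Hu. apply HD. lra. }
    assert (Hpt := Hpb t ltac:(lra)).
    assert (Hs1 : Rabs ((g * p N t - l * t * s N t + s N t ^ 2 / 2) / eps) <= C2).
    { unfold Rdiv at 1. rewrite Rabs_mult, (Rabs_right (/ eps)) by lra.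
      apply Rmult_le_compat_r; [lra|].
      eapply Rle_trans; [apply Rabs_triang|]. apply Rplus_le_compat.
      - eapply Rle_trans; [apply Rabs_triang|]. rewrite Rabs_Ropp.
        apply Rplus_le_compat.
        + rewrite Rabs_mult, (Rabs_right g) by lra. apply Rmult_le_compat_l; lra.
        + rewrite !Rabs_mult, (Rabs_right l) by lra.
          apply Rmult_le_compat; try apply Rabs_pos; auto.
          apply Rmult_le_pos; [lra|apply Rabs_pos].
          apply Rmult_le_compat_l; lra.
      - unfold Rdiv. rewrite Rabs_mult, (Rabs_right (/ 2)) by lra.
        apply Rmult_le_compat_r; [lra|]. rewrite <- RPow_abs.
        apply pow_incr. split; [apply Rabs_pos|auto]. }
    split; [lra|]. split; [lra|]. split; [lra|].
    set (s1 := (g * p N t - l * t * s N t + s N t ^ 2 / 2) / eps) in *.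
    apply Rle_trans with C3; [|lra].
    unfold Rdiv. rewrite Rabs_mult, (Rabs_right (/ eps)) by lra.
    apply Rmult_le_compat_r; [lra|].
    eapply Rle_trans; [apply Rabs_triang|]. apply Rplus_le_compat.
    - eapply Rle_trans; [apply Rabs_triang|]. rewrite Rabs_Ropp.
      apply Rplus_le_compat.
      + eapply Rle_trans; [apply Rabs_triang|]. rewrite Rabs_Ropp, !Rabs_mult.
        rewrite (Rabs_right g), (Rabs_right l) by lra.
        apply Rplus_le_compat; apply Rmult_le_compat_l; lra.
      + rewrite !Rabs_mult, (Rabs_right l) by lra.
        apply Rmult_le_compat; try apply Rabs_pos; auto.
        apply Rmult_le_pos; [lra|apply Rabs_pos].
        apply Rmult_le_compat_l; lra.
    - rewrite Rabs_mult. apply Rmult_le_compat; try apply Rabs_pos; auto. }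
  assert (HPs : forall z, exists x : R, is_lim_seq (fun N => s N z) x).
  { intros z. destruct (Hloc z) as [C [N0 [HC HN0]]].
    apply lim_seq_of_cauchy. intros e He.
    set (t := Rmin 1 (e / (8 * C))).
    assert (Het : 0 < e / (8 * C)) by (apply Rdiv_lt_0_compat; lra).
    assert (Ht : 0 < t /\ t <= 1 /\ C * t <= e / 8).
    { unfold t. split; [apply Rmin_glb_lt; lra|]. split; [apply Rmin_l|].
      apply Rle_trans with (C * (e / (8 * C))).
      apply Rmult_le_compat_l; [lra|apply Rmin_r]. right; field; lra. }
    destruct (proj1 (is_lim_seq_ed _ _) (HP z) (e * t / 8)) as [N1 HN1].
    { assert (0 < e * t) by (apply Rmult_lt_0_compat; lra). lra. }
    destruct (proj1 (is_lim_seq_ed _ _) (HP (z + t)) (e * t / 8)) as [N2 HN2].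
    { assert (0 < e * t) by (apply Rmult_lt_0_compat; lra). lra. }
    assert (Hap : forall N, (N0 <= N)%nat -> Rabs (p N (z + t) - p N z - s N z * t) <= e / 8 * t).
    { intros N HN.
      destruct (mean_value (p N) (s N) z (z + t)) as [x [Hx E]]; [lra| |].
      { intros u Hu. apply HD. apply (HN0 N HN u). rewrite Rabs_right; lra. }
      replace (p N (z + t) - p N z - s N z * t) with ((s N x - s N z) * t) by (rewrite E; ring).
      rewrite Rabs_mult, (Rabs_right t) by lra. apply Rmult_le_compat_r; [lra|].
      assert (H := lipschitz_of_bound (s N)
        (fun t => (g * p N t - l * t * s N t + s N t ^ 2 / 2) / eps) C z 1 x).
      eapply Rle_trans; [apply H|].
      - intros y Hy. destruct (HN0 N HN y Hy) as [Hin _]. apply HD, Hin.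
      - intros y Hy. apply (HN0 N HN y Hy).
      - rewrite Rabs_right; lra.
      - rewrite Rabs_right by lra. apply Rle_trans with (C * t); [|lra].
        apply Rmult_le_compat_l; lra. }
    exists (N0 + N1 + N2)%nat. intros n m Hn Hm.
    assert (A1 := Hap n ltac:(lia)). assert (A2 := Hap m ltac:(lia)).
    assert (B1 := HN1 n ltac:(lia)). assert (B2 := HN1 m ltac:(lia)).
    assert (B3 := HN2 n ltac:(lia)). assert (B4 := HN2 m ltac:(lia)).
    apply Rabs_le_between in A1, A2. apply Rabs_def2 in B1, B2, B3, B4.
    assert (Hsum : Rabs ((s n z - s m z) * t) < e * t).
    { assert (0 < e * t) by (apply Rmult_lt_0_compat; lra). apply Rabs_def1; lra. }
    rewrite Rabs_mult, (Rabs_right t) in Hsum by lra.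
    apply Rmult_lt_reg_r with t; lra. }
  destruct (functional_choice _ HPs) as [h Hh]. clear HPs.
  exists P, h. split.
  - intros z _. destruct (Hloc z) as [C [N0 [HC HN0]]]. split.
    + apply (is_derive_limit p s P (h z) z 1); auto; try lra.
      * exists N0. intros n Hn t Ht. apply HD. apply (HN0 n Hn t). lra.
      * intros e He. exists (Rmin 1 (e / C)), N0.
        assert (HeC : 0 < e / C) by now apply Rdiv_lt_0_compat.
        split; [apply Rmin_glb_lt; lra|]. intros n Hn t Ht.
        assert (Ht1 : Rabs (t - z) < 1) by (eapply Rlt_le_trans; [exact Ht|apply Rmin_l]).
        assert (Ht2 : Rabs (t - z) < e / C) by (eapply Rlt_le_trans; [exact Ht|apply Rmin_r]).
        eapply Rle_trans.
        -- apply (lipschitz_of_bound (s n)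
             (fun t => (g * p n t - l * t * s n t + s n t ^ 2 / 2) / eps) C z 1 t).
           ++ intros y Hy. apply HD. apply (HN0 n Hn y Hy).
           ++ intros y Hy. apply (HN0 n Hn y Hy).
           ++ lra.
        -- replace e with (C * (e / C)) by (field; lra). apply Rmult_le_compat_l; lra.
    + apply (is_derive_limit s
        (fun n t => (g * p n t - l * t * s n t + s n t ^ 2 / 2) / eps) h _ z 1); auto; try lra.
      * exists N0. intros n Hn t Ht. apply HD. apply (HN0 n Hn t). lra.
      * unfold Rdiv. apply (is_lim_seq_scal_r _ (/ eps) (g * P z - l * z * h z + h z ^ 2 * / 2)).
        apply is_lim_seq_plus'; [apply is_lim_seq_minus'|].
        -- apply (is_lim_seq_scal_l _ g (P z)), HP.
        -- apply (is_lim_seq_scal_l _ (l * z) (h z)), Hh.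
        -- apply (is_lim_seq_scal_r _ (/ 2) (h z ^ 2)). simpl.
           apply is_lim_seq_mult'; [apply Hh|]. apply is_lim_seq_mult'; [apply Hh|].
           apply is_lim_seq_const.
      * intros e He. exists (Rmin 1 (e / C)), N0.
        assert (HeC : 0 < e / C) by now apply Rdiv_lt_0_compat.
        split; [apply Rmin_glb_lt; lra|]. intros n Hn t Ht.
        assert (Ht1 : Rabs (t - z) < 1) by (eapply Rlt_le_trans; [exact Ht|apply Rmin_l]).
        assert (Ht2 : Rabs (t - z) < e / C) by (eapply Rlt_le_trans; [exact Ht|apply Rmin_r]).
        eapply Rle_trans.
        -- apply (lipschitz_of_bound (fun t => (g * p n t - l * t * s n t + s n t ^ 2 / 2) / eps)
             (fun t => (g * s n t - l * s n t - l * t * ((g * p n t - l * t * s n t + s n t ^ 2 / 2) / eps)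
          + s n t * ((g * p n t - l * t * s n t + s n t ^ 2 / 2) / eps)) / eps) C z 1 t).
           ++ intros y Hy. destruct (HN0 n Hn y Hy) as [Hin _]. destruct (HD n y Hin) as [D1 D2].
              der. field. lra.
           ++ intros y Hy. apply (HN0 n Hn y Hy).
           ++ lra.
        -- replace e with (C * (e / C)) by (field; lra). apply Rmult_le_compat_l; lra.
  - intros z. destruct (rad_large (Rabs z)) as [N0 HN0].
    assert (L : is_lim_seq (fun N => Rabs (p N z - Q z)) (Rabs (P z - Q z))).
    { apply (is_lim_seq_abs _ (P z - Q z)). apply is_lim_seq_minus'; [apply HP|apply is_lim_seq_const]. }
    apply (is_lim_seq_le_loc _ (fun _ => k) _ k) in L; auto.
    + exists N0. intros N HN. apply HB. apply Rabs_le_between.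
      eapply Rle_trans; [exact HN0|now apply rad_incr].
    + apply is_lim_seq_const.
Qed.
End Exhaustion.

(** * The inviscid profile *)

Lemma at_right_ed (f : R -> R) c L : filterlim f (at_right c) (locally L) ->
  forall e, 0 < e -> exists d, 0 < d /\ forall z, c < z < c + d -> Rabs (f z - L) < e.
Proof.
  intros H e He. destruct (proj1 (filterlim_locally f L) H (mkposreal e He)) as [d Hd].
  exists d. split; [apply cond_pos|]. intros z Hz. apply (Hd z); [|lra].
  change (Rabs (z - c) < d). rewrite Rabs_right; lra.
Qed.

Lemma at_left_ed (f : R -> R) c L : filterlim f (at_left c) (locally L) ->
  forall e, 0 < e -> exists d, 0 < d /\ forall z, c - d < z < c -> Rabs (f z - L) < e.
Proof.
  intros H e He. destruct (proj1 (filterlim_locally f L) H (mkposreal e He)) as [d Hd].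
  exists d. split; [apply cond_pos|]. intros z Hz. apply (Hd z); [|lra].
  change (Rabs (z - c) < d). rewrite Rabs_left; lra.
Qed.

(** A mean value estimate that starts from a one-sided limit: [u] has no value at [c]. *)
Lemma from_right (u du : R -> R) (c L m z : R) : c < z ->
  (forall e, 0 < e -> exists d, 0 < d /\ forall p, c < p < c + d -> Rabs (u p - L) < e) ->
  (forall t, c < t -> is_derive u t (du t)) -> (forall t, c < t -> m <= du t) ->
  L + m * (z - c) <= u z.
Proof.
  intros Hz HL Hd Hm. apply le_epsilon. intros e He.
  destruct (HL (e / 2)) as [d [Hd0 H]]; [lra|].
  set (e' := e / (2 * (Rabs m + 1))).
  assert (Hmp : 0 < Rabs m + 1) by (assert (Hp := Rabs_pos m); lra).
  assert (He' : 0 < e') by (apply Rdiv_lt_0_compat; lra).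
  set (p := c + Rmin (Rmin (d / 2) ((z - c) / 2)) e').
  assert (Hp : c < p /\ p < c + d /\ p < z /\ p <= c + e').
  { unfold p. assert (0 < Rmin (Rmin (d / 2) ((z - c) / 2)) e') by (repeat apply Rmin_glb_lt; lra).
    assert (K1 := Rmin_l (Rmin (d / 2) ((z - c) / 2)) e').
    assert (K2 := Rmin_r (Rmin (d / 2) ((z - c) / 2)) e').
    assert (K3 := Rmin_l (d / 2) ((z - c) / 2)). assert (K4 := Rmin_r (d / 2) ((z - c) / 2)). lra. }
  specialize (H p ltac:(lra)). apply Rabs_def2 in H.
  destruct (mean_value u du p z) as [s [Hs E]]; [lra|intros; apply Hd; lra|].
  specialize (Hm s ltac:(lra)).
  assert (m * (z - p) <= du s * (z - p)) by (apply Rmult_le_compat_r; lra).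
  assert (Hmm : m * (p - c) <= e / 2).
  { apply Rle_trans with ((Rabs m + 1) * e').
    - apply Rle_trans with (Rabs m * (p - c)). apply Rmult_le_compat_r; [lra|apply Rle_abs].
      apply Rmult_le_compat; try lra. apply Rabs_pos.
    - unfold e'. right. field. lra. }
  lra.
Qed.

Lemma from_left (u du : R -> R) (c L m z : R) : z < c ->
  (forall e, 0 < e -> exists d, 0 < d /\ forall p, c - d < p < c -> Rabs (u p - L) < e) ->
  (forall t, t < c -> is_derive u t (du t)) -> (forall t, t < c -> m <= du t) ->
  u z <= L - m * (c - z).
Proof.
  intros Hz HL Hd Hm.
  assert (K : - L + m * (- z - - c) <= - u (- - z)).
  { apply (from_right (fun t => - u (- t)) (fun t => du (- t))); try lra.
    - intros e He. destruct (HL e He) as [d [Hd0 H]]. exists d. split; auto. intros p Hp.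
      replace (- u (- p) - - L) with (- (u (- p) - L)) by ring. rewrite Rabs_Ropp. apply H. lra.
    - intros t Ht. assert (D := is_derive_reflect u t _ (Hd (- t) ltac:(lra))).
      evar_last; [apply der_opp, D|ring].
    - intros t Ht. apply Hm. lra. }
  rewrite Ropp_involutive in K. lra.
Qed.

(** What the asymptotic analysis uses of the profile: off the jump [c] it solves
    the inviscid equation, is bounded with its derivative, and the characteristic
    speed [l z - h0 z] points away from [c] and grows linearly. *)
Record inviscid_profile (l c a k0 Hm H1 : R) (h0 h1 : R -> R) : Prop := {
  ip_c : 0 < c;
  ip_a : 0 < a;
  ip_k0 : 0 < k0;
  ip_k0a : k0 <= a;
  ip_Hm : 0 < Hm;
  ip_H1 : 0 < H1;
  ip_derive : forall z, z <> c -> is_derive h0 z (h1 z);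
  ip_eq : forall z, z <> c -> (1 - l) * h0 z + (l * z - h0 z) * h1 z = 0;
  ip_bound : forall z, z <> c -> Rabs (h0 z) <= Hm;
  ip_bound1 : forall z, z <> c -> Rabs (h1 z) <= H1;
  ip_right : forall z, c < z -> k0 * (1 + (z - c)) <= l * z - h0 z;
  ip_left : forall z, z < c -> k0 * (1 + (c - z)) <= h0 z - l * z;
  ip_right_c : forall z, c < z -> Rabs (l * z - h0 z - a) <= (l + H1) * (z - c);
  ip_left_c : forall z, z < c -> Rabs (h0 z - l * z - a) <= (l + H1) * (c - z) }.
Arguments ip_c {l c a k0 Hm H1 h0 h1} _.
Arguments ip_a {l c a k0 Hm H1 h0 h1} _.
Arguments ip_k0 {l c a k0 Hm H1 h0 h1} _.
Arguments ip_k0a {l c a k0 Hm H1 h0 h1} _.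
Arguments ip_Hm {l c a k0 Hm H1 h0 h1} _.
Arguments ip_H1 {l c a k0 Hm H1 h0 h1} _.
Arguments ip_derive {l c a k0 Hm H1 h0 h1} _.
Arguments ip_eq {l c a k0 Hm H1 h0 h1} _.
Arguments ip_bound {l c a k0 Hm H1 h0 h1} _.
Arguments ip_bound1 {l c a k0 Hm H1 h0 h1} _.
Arguments ip_right {l c a k0 Hm H1 h0 h1} _.
Arguments ip_left {l c a k0 Hm H1 h0 h1} _.
Arguments ip_right_c {l c a k0 Hm H1 h0 h1} _.
Arguments ip_left_c {l c a k0 Hm H1 h0 h1} _.

Section Profile.
Variables (l c a : R) (h0 h1 : R -> R).
Hypothesis Hl : / 2 < l < 1.
Hypothesis Hc : 0 < c.
Hypothesis Ha : (1 - l) * c < a < l * c.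
Hypothesis Hpos : forall z, z <> c -> 0 < h0 z.
Hypothesis Hder : forall z, z <> c -> is_derive h0 z (h1 z).
Hypothesis Heq : forall z, z <> c -> (1 - l) * h0 z + (l * z - h0 z) * h1 z = 0.
Hypothesis Hright : forall e, 0 < e -> exists d, 0 < d /\
  forall z, c < z < c + d -> Rabs (h0 z - (l * c - a)) < e.
Hypothesis Hleft : forall e, 0 < e -> exists d, 0 < d /\
  forall z, c - d < z < c -> Rabs (h0 z - (l * c + a)) < e.

Let a_pos : 0 < a.
Proof. assert (0 < (1 - l) * c) by (apply Rmult_lt_0_compat; lra). lra. Qed.

Lemma speed_nonzero z : z <> c -> l * z - h0 z <> 0.
Proof.
  intros Hz E. assert (H := Heq z Hz). rewrite E, Rmult_0_l, Rplus_0_r in H.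
  assert (0 < (1 - l) * h0 z) by (apply Rmult_lt_0_compat; [lra|auto]). lra.
Qed.

Lemma speed_pos_right z : c < z -> 0 < l * z - h0 z.
Proof.
  intros Hz. destruct (Rtotal_order 0 (l * z - h0 z)) as [H|[H|H]]; auto.
  - exfalso. apply (speed_nonzero z); lra.
  - exfalso. destruct (Hright (a / 4)) as [d [Hd Hn]]; [lra|].
    set (p := c + Rmin (Rmin (d / 2) (z - c)) (a / 4)).
    assert (Hp : c < p /\ p < c + d /\ p <= z /\ p <= c + a / 4).
    { unfold p. assert (0 < Rmin (Rmin (d / 2) (z - c)) (a / 4)) by (repeat apply Rmin_glb_lt; lra).
      assert (H1 := Rmin_l (Rmin (d / 2) (z - c)) (a / 4)).
      assert (H2 := Rmin_r (Rmin (d / 2) (z - c)) (a / 4)).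
      assert (H3 := Rmin_l (d / 2) (z - c)). assert (H4 := Rmin_r (d / 2) (z - c)). lra. }
    specialize (Hn p ltac:(lra)). apply Rabs_def2 in Hn.
    assert (Hlp : l * c <= l * p) by (apply Rmult_le_compat_l; lra).
    destruct (last_nonneg (fun t => l * t - h0 t) p z) as [s [Hs [E _]]]; try lra.
    + intros t Ht. assert (D := Hder t ltac:(lra)).
      apply continuous_of_derive with (l * 1 - h1 t). der. ring.
    + apply (speed_nonzero s); lra.
Qed.

Lemma speed_neg_left z : z < c -> 0 < h0 z - l * z.
Proof.
  intros Hz. destruct (Rtotal_order 0 (h0 z - l * z)) as [H|[H|H]]; auto.
  - exfalso. apply (speed_nonzero z); lra.
  - exfalso. destruct (Hleft (a / 4)) as [d [Hd Hn]]; [lra|].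
    set (p := Rmax (c - d / 2) z).
    assert (Hp : c - d < p < c /\ z <= p).
    { unfold p. assert (H1 := Rmax_l (c - d / 2) z). assert (H2 := Rmax_r (c - d / 2) z).
      split; [split|]; try lra. apply Rmax_lub_lt; lra. }
    specialize (Hn p ltac:(lra)). apply Rabs_def2 in Hn.
    assert (Hlp : l * p <= l * c) by (apply Rmult_le_compat_l; lra).
    destruct (last_nonneg (fun t => l * t - h0 t) z p) as [s [Hs [E _]]]; try lra.
    + intros t Ht. assert (D := Hder t ltac:(lra)).
      apply continuous_of_derive with (l * 1 - h1 t). der. ring.
    + apply (speed_nonzero s); lra.
Qed.

Lemma slope_right z : c < z -> h1 z < 0.
Proof.
  intros Hz. assert (H := Heq z ltac:(lra)). assert (Hp := speed_pos_right z Hz).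
  assert (0 < (1 - l) * h0 z) by (apply Rmult_lt_0_compat; [lra|apply Hpos; lra]).
  destruct (Rlt_le_dec (h1 z) 0) as [|Hn]; auto.
  assert (0 <= (l * z - h0 z) * h1 z) by (apply Rmult_le_pos; lra). lra.
Qed.

Lemma slope_left z : z < c -> 0 < h1 z.
Proof.
  intros Hz. assert (H := Heq z ltac:(lra)). assert (Hp := speed_neg_left z Hz).
  assert (0 < (1 - l) * h0 z) by (apply Rmult_lt_0_compat; [lra|apply Hpos; lra]).
  destruct (Rlt_le_dec 0 (h1 z)) as [|Hn]; auto.
  assert (0 <= (h0 z - l * z) * - h1 z) by (apply Rmult_le_pos; lra). lra.
Qed.

Lemma limit_affine_right (s k L : R) : Rabs s = 1 ->
  L = s * (l * c - a) + k * c ->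
  forall e, 0 < e -> exists d, 0 < d /\ forall p, c < p < c + d ->
    Rabs (s * h0 p + k * p - L) < e.
Proof.
  intros Hs EL e He. destruct (Hright (e / 2)) as [d [Hd H]]; [lra|].
  set (r := e / (2 * (Rabs k + 1))).
  assert (Hkp : 0 < Rabs k + 1) by (assert (Hp := Rabs_pos k); lra).
  assert (Hr : 0 < r) by (apply Rdiv_lt_0_compat; lra).
  exists (Rmin d r). split; [apply Rmin_glb_lt; lra|]. intros p Hp.
  assert (K1 := Rmin_l d r). assert (K2 := Rmin_r d r).
  replace (s * h0 p + k * p - L) with (s * (h0 p - (l * c - a)) + k * (p - c)) by (rewrite EL; ring).
  eapply Rle_lt_trans; [apply Rabs_triang|]. rewrite !Rabs_mult, Hs, Rmult_1_l.
  specialize (H p ltac:(lra)).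
  assert (Rabs k * Rabs (p - c) <= e / 2); [|lra].
  apply Rle_trans with ((Rabs k + 1) * r).
  apply Rmult_le_compat; try apply Rabs_pos; try lra. rewrite Rabs_right; lra.
  unfold r; right; field; lra.
Qed.

Lemma limit_affine_left (s k L : R) : Rabs s = 1 ->
  L = s * (l * c + a) + k * c ->
  forall e, 0 < e -> exists d, 0 < d /\ forall p, c - d < p < c ->
    Rabs (s * h0 p + k * p - L) < e.
Proof.
  intros Hs EL e He. destruct (Hleft (e / 2)) as [d [Hd H]]; [lra|].
  set (r := e / (2 * (Rabs k + 1))).
  assert (Hkp : 0 < Rabs k + 1) by (assert (Hp := Rabs_pos k); lra).
  assert (Hr : 0 < r) by (apply Rdiv_lt_0_compat; lra).
  exists (Rmin d r). split; [apply Rmin_glb_lt; lra|]. intros p Hp.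
  assert (K1 := Rmin_l d r). assert (K2 := Rmin_r d r).
  replace (s * h0 p + k * p - L) with (s * (h0 p - (l * c + a)) + k * (p - c)) by (rewrite EL; ring).
  eapply Rle_lt_trans; [apply Rabs_triang|]. rewrite !Rabs_mult, Hs, Rmult_1_l.
  specialize (H p ltac:(lra)).
  assert (Rabs k * Rabs (p - c) <= e / 2); [|lra].
  apply Rle_trans with ((Rabs k + 1) * r).
  apply Rmult_le_compat; try apply Rabs_pos; try lra. rewrite Rabs_left; lra.
  unfold r; right; field; lra.
Qed.

Let x0 := a - (1 - l) * c.

(** To the left, [h0 - z] is positive at the jump and satisfies a linear equation,
    so it never vanishes and increases away from the jump. This is where the lower
    bound on [a] enters. *)
Lemma gap_left z : z < c -> x0 <= h0 z - z.
Proof.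
  intros Hz0.
  assert (Hx0 : 0 < x0) by (unfold x0; lra).
  assert (Hd : forall t, t < c -> is_derive (fun t => h0 t - t) t (- l * (h0 t - t) / (h0 t - l * t))).
  { intros t Ht. assert (D := Hder t ltac:(lra)). assert (Hm := speed_neg_left t Ht).
    assert (E := Heq t ltac:(lra)). der.
    assert (E1 : h1 t = (1 - l) * h0 t / (h0 t - l * t)).
    { apply Rmult_eq_reg_r with (h0 t - l * t); [|lra].
      unfold Rdiv. rewrite Rmult_assoc, Rinv_l; lra. }
    rewrite E1. field. lra. }
  assert (Hlim := limit_affine_left 1 (-1) x0 Rabs_R1 ltac:(unfold x0; lra)).
  assert (Hp : forall z, z < c -> 0 < h0 z - z).
  { intros t Ht. destruct (Rlt_le_dec 0 (h0 t - t)) as [|Hn]; auto. exfalso.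
    destruct (Hlim x0 Hx0) as [d [Hd0 H]].
    set (p := Rmax (c - d / 2) t).
    assert (Hpb : c - d < p < c /\ t <= p).
    { unfold p. assert (K1 := Rmax_l (c - d / 2) t). assert (K2 := Rmax_r (c - d / 2) t).
      split; [split|]; try lra. apply Rmax_lub_lt; lra. }
    specialize (H p ltac:(lra)). apply Rabs_def2 in H.
    assert (0 <= - (h0 p - p)); [|lra].
    apply (barrier 0 (fun t => - (h0 t - t)) (fun t => - (- l * (h0 t - t) / (h0 t - l * t))) t p); try lra.
    - intros s Hs. apply (der_opp (fun t => h0 t - t)). apply Hd. lra.
    - intros s Hs Hneg. rewrite Rmult_0_l.
      assert (Hm := speed_neg_left s ltac:(lra)).
      replace (- (- l * (h0 s - s) / (h0 s - l * s))) with (l * (h0 s - s) / (h0 s - l * s))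
        by (field; lra).
      left. apply Rdiv_lt_0_compat; auto. apply Rmult_lt_0_compat; lra. }
  assert (Hfin : - (h0 z - z) <= - x0 - 0 * (c - z)); [|lra].
  apply (from_left (fun t => - (h0 t - t)) (fun t => - (- l * (h0 t - t) / (h0 t - l * t)))); auto.
  - intros e He. destruct (Hlim e He) as [d [Hd0 H]]. exists d. split; auto.
    intros p Hpd. specialize (H p Hpd).
    replace (- (h0 p - p) - - x0) with (- (1 * h0 p + -1 * p - x0)) by ring.
    now rewrite Rabs_Ropp.
  - intros t Ht. apply (der_opp (fun t => h0 t - t)). auto.
  - intros t Ht. assert (Hm := speed_neg_left t Ht). specialize (Hp t Ht).
    replace (- (- l * (h0 t - t) / (h0 t - l * t))) with (l * (h0 t - t) / (h0 t - l * t))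
        by (field; lra).
    left. apply Rdiv_lt_0_compat; auto. apply Rmult_lt_0_compat; lra.
Qed.

Lemma profile_facts : exists k0 Hm H1, inviscid_profile l c a k0 Hm H1 h0 h1.
Proof.
  assert (Hx0 : 0 < x0) by (unfold x0; lra).
  assert (Hx0a : x0 <= a).
  { assert (0 < (1 - l) * c) by (apply Rmult_lt_0_compat; lra). unfold x0; lra. }
  set (th := x0 / (1 + c + x0)).
  assert (Hth : 0 < th) by (apply Rdiv_lt_0_compat; lra).
  assert (Eth : th * (1 + c + x0) = x0) by (unfold th; field; lra).
  assert (Hth1 : th < 1) by nra.
  assert (Htha : th < x0) by nra.
  set (k0 := th * l).
  assert (Hk0 : 0 < k0) by (apply Rmult_lt_0_compat; lra).
  assert (Hk0l : k0 <= l) by (unfold k0; nra).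
  assert (Hk0a : k0 <= a) by (unfold k0; nra).
  set (Hm := l * c + a).
  assert (HHm : 0 < Hm) by (assert (0 < l * c) by (apply Rmult_lt_0_compat; lra); unfold Hm; lra).
  assert (Rt : forall z, c < z -> a + l * (z - c) <= l * z - h0 z).
  { intros z Hz. apply (from_right (fun t => l * t - h0 t) (fun t => l - h1 t)); auto.
    - intros e He. destruct (limit_affine_right (-1) l a ltac:(rewrite Rabs_left; lra) ltac:(ring) e He)
        as [d [Hd H]]. exists d. split; auto. intros p Hp. specialize (H p Hp).
      replace (l * p - h0 p - a) with (-1 * h0 p + l * p - a) by ring. auto.
    - intros t Ht. assert (D := Hder t ltac:(lra)). der. ring.
    - intros t Ht. assert (H := slope_right t Ht). lra. }
  assert (Lt : forall z, z < c -> k0 * (1 + (c - z)) <= h0 z - l * z).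
  { intros z Hz. assert (G := gap_left z Hz). assert (Hp := Hpos z ltac:(lra)).
    assert (B1 : l * x0 <= h0 z - l * z).
    { destruct (Rle_lt_dec 0 z) as [H|H].
      - assert (0 <= (1 - l) * z) by (apply Rmult_le_pos; lra). nra.
      - assert (l * x0 <= l * (h0 z - z)) by (apply Rmult_le_compat_l; lra). nra. }
    assert (B2 : l * (c - z) - l * c <= h0 z - l * z) by lra.
    assert (E : k0 * (1 + (c - z)) = (1 - th) * (l * x0) + th * (l * (c - z) - l * c)
       + l * (th * (1 + c + x0) - x0)) by (unfold k0; ring).
    rewrite E, Eth, Rminus_diag, Rmult_0_r, Rplus_0_r.
    assert ((1 - th) * (l * x0) <= (1 - th) * (h0 z - l * z)) by (apply Rmult_le_compat_l; lra).
    assert (th * (l * (c - z) - l * c) <= th * (h0 z - l * z)) by (apply Rmult_le_compat_l; lra).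
    lra. }
  assert (Rt' : forall z, c < z -> k0 * (1 + (z - c)) <= l * z - h0 z).
  { intros z Hz. specialize (Rt z Hz).
    assert (k0 * (z - c) <= l * (z - c)) by (apply Rmult_le_compat_r; lra). lra. }
  assert (Hb : forall z, z <> c -> h0 z <= Hm).
  { intros z Hz. destruct (Rtotal_order z c) as [H|[H|H]]; [|lra|].
    - assert (h0 z <= Hm - 0 * (c - z)); [|lra].
      apply (from_left h0 h1); auto.
      + intros t Ht; apply Hder; lra.
      + intros t Ht. left. now apply slope_left.
    - specialize (Rt z H). unfold Hm. lra. }
  set (H1 := (1 - l) * Hm / k0).
  assert (HH1 : 0 < H1) by (apply Rdiv_lt_0_compat; auto; apply Rmult_lt_0_compat; lra).
  assert (Hb1 : forall z, z <> c -> Rabs (h1 z) <= H1).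
  { intros z Hz. assert (E := Heq z Hz).
    assert (Hsp : k0 <= Rabs (l * z - h0 z)).
    { destruct (Rtotal_order z c) as [H|[H|H]]; [|lra|].
      - specialize (Lt z H). assert (0 <= k0 * (c - z)) by (apply Rmult_le_pos; lra).
        rewrite Rabs_left; lra.
      - specialize (Rt' z H). assert (0 <= k0 * (z - c)) by (apply Rmult_le_pos; lra).
        rewrite Rabs_right; lra. }
    assert (E2 : Rabs (l * z - h0 z) * Rabs (h1 z) = (1 - l) * h0 z).
    { rewrite <- Rabs_mult. replace ((l * z - h0 z) * h1 z) with (- ((1 - l) * h0 z)) by lra.
      rewrite Rabs_Ropp, Rabs_right; auto.
      assert (0 < (1 - l) * h0 z) by (apply Rmult_lt_0_compat; [lra|auto]). lra. }
    assert (Hp := Rabs_pos (h1 z)). specialize (Hb z Hz).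
    apply Rmult_le_reg_l with k0; auto.
    replace (k0 * H1) with ((1 - l) * Hm) by (unfold H1; field; lra).
    apply Rle_trans with (Rabs (l * z - h0 z) * Rabs (h1 z)).
    apply Rmult_le_compat_r; lra. rewrite E2. apply Rmult_le_compat_l; lra. }
  exists k0, Hm, H1. constructor; auto.
  - intros z Hz. specialize (Hb z Hz). assert (Hp := Hpos z Hz). rewrite Rabs_right; lra.
  - intros z Hz. apply Rabs_le. split.
    + assert (0 <= (l + H1) * (z - c)) by (apply Rmult_le_pos; lra).
      assert (0 <= l * (z - c)) by (apply Rmult_le_pos; lra). specialize (Rt z Hz). lra.
    + assert (- a + - (l + H1) * (z - c) <= -1 * h0 z * -1 + - l * z).
      { apply (from_right (fun t => -1 * h0 t * -1 + - l * t) (fun t => h1 t - l)); auto.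
        - intros e He. destruct (limit_affine_right 1 (- l) (- a) Rabs_R1 ltac:(ring) e He)
            as [d [Hd H]]. exists d. split; auto. intros p Hp. specialize (H p Hp).
          replace (-1 * h0 p * -1 + - l * p - - a) with (1 * h0 p + - l * p - - a) by ring. auto.
        - intros t Ht. assert (D := Hder t ltac:(lra)). der. ring.
        - intros t Ht. specialize (Hb1 t ltac:(lra)). apply Rabs_le_between in Hb1. lra. }
      lra.
  - intros z Hz. apply Rabs_le.
    assert (Hsl : forall t, t < c -> - H1 <= h1 t <= H1).
    { intros t Ht. specialize (Hb1 t ltac:(lra)). now apply Rabs_le_between in Hb1. }
    split.
    + assert (-1 * h0 z + l * z <= - a - - (l + H1) * (c - z)).
      { apply (from_left (fun t => -1 * h0 t + l * t) (fun t => - h1 t + l)); auto.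
        - apply (limit_affine_left (-1) l (- a) ltac:(rewrite Rabs_left; lra) ltac:(ring)).
        - intros t Ht. assert (D := Hder t ltac:(lra)). der. ring.
        - intros t Ht. specialize (Hsl t Ht). lra. }
      lra.
    + assert (1 * h0 z + - l * z <= a - - (l + H1) * (c - z)).
      { apply (from_left (fun t => 1 * h0 t + - l * t) (fun t => h1 t - l)); auto.
        - apply (limit_affine_left 1 (- l) a Rabs_R1 ltac:(ring)).
        - intros t Ht. assert (D := Hder t ltac:(lra)). der. ring.
        - intros t Ht. specialize (Hsl t Ht). lra. }
      lra.
Qed.
End Profile.

(** * The profile with a viscous layer *)

Lemma exp_ge_1 x : 0 <= x -> 1 <= exp x.
Proof. intros H. rewrite <- exp_0. now apply exp_le_compat. Qed.

Lemma exp_ge_linear x : 1 + x <= exp x.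
Proof. destruct (Req_dec x 0) as [->|H]; [rewrite exp_0; lra|left; now apply exp_ineq1]. Qed.

Lemma log_cosh_bounds x : 0 <= x -> x <= ln (exp x + exp (- x)) <= x + 1.
Proof.
  intros Hx. assert (H1 := exp_pos x). assert (H2 := exp_pos (- x)).
  assert (Hle : exp (- x) <= exp x) by (apply exp_le_compat; lra).
  split.
  - rewrite <- (ln_exp x) at 1. apply ln_le; lra.
  - rewrite <- (ln_exp (x + 1)). apply ln_le; [lra|]. rewrite exp_plus.
    assert (1 + 1 <= exp 1) by apply exp_ge_linear. nra.
Qed.

Lemma cosh_sum_pos x : 0 < exp x + exp (- x).
Proof. assert (H := exp_pos x). assert (H' := exp_pos (- x)). lra. Qed.

Lemma tanh_exp x : tanh x = (exp x - exp (- x)) / (exp x + exp (- x)).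
Proof. assert (H := cosh_sum_pos x). unfold tanh, sinh, cosh. field. lra. Qed.

Lemma tanh_nonneg x : 0 <= x -> 0 <= tanh x.
Proof.
  intros H. rewrite tanh_exp. assert (exp (- x) <= exp x) by (apply exp_le_compat; lra).
  apply Rmult_le_pos; [lra|]. left. apply Rinv_0_lt_compat, cosh_sum_pos.
Qed.

Lemma tanh_0 : tanh 0 = 0.
Proof. rewrite tanh_exp, Ropp_0. unfold Rdiv. ring. Qed.

Lemma tanh_odd x : tanh (- x) = - tanh x.
Proof.
  rewrite !tanh_exp, Ropp_involutive. assert (H := cosh_sum_pos x). field. lra.
Qed.

Lemma tanh_gap x : 0 <= x -> 0 <= 1 - tanh x /\ x * (1 - tanh x) <= 1.
Proof.
  intros Hx. assert (H1 := exp_pos x). assert (H2 := exp_pos (- x)).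
  replace (1 - tanh x) with (2 * exp (- x) / (exp x + exp (- x)))
    by (rewrite tanh_exp; field; lra).
  split.
  - left. apply Rdiv_lt_0_compat; lra.
  - apply Rmult_le_reg_r with (exp x + exp (- x)); [lra|].
    replace (x * (2 * exp (- x) / (exp x + exp (- x))) * (exp x + exp (- x)))
      with (2 * x * exp (- x)) by (field; lra).
    assert (E : exp x = exp (2 * x) * exp (- x)) by (rewrite <- exp_plus; f_equal; ring).
    assert (H3 := exp_ge_linear (2 * x)). rewrite E. nra.
Qed.

(** The profile of the layer solves the Riccati equation [eps tau' = (A^2 - tau^2)/2]. *)
Lemma tanh_layer_derive A p eps z : 0 < eps ->
  is_derive (fun z => A * tanh (A * (z - p) / (2 * eps))) z
    ((A ^ 2 - (A * tanh (A * (z - p) / (2 * eps))) ^ 2) / (2 * eps)).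
Proof.
  intros He. set (x := fun z => A * (z - p) / (2 * eps)).
  apply is_derive_ext with (fun z => A * ((exp (x z) - exp (- x z)) / (exp (x z) + exp (- x z)))).
  { intros t. now rewrite tanh_exp. }
  rewrite tanh_exp. fold (x z). assert (H := cosh_sum_pos (x z)).
  assert (Dx : is_derive x z (A / (2 * eps))) by (unfold x; der; field; lra).
  der. lra. field. split; lra.
Qed.

(** By the mean value theorem the difference quotients at [c] are values of [df] at
    points close to [c]. *)
Lemma is_derive_removable (f df : R -> R) c :
  continuous f c -> continuous df c -> (forall z, z <> c -> is_derive f z (df z)) ->
  is_derive f c (df c).
Proof.
  intros Hf Hdf Hd. apply is_derive_ed. intros e He.
  destruct (proj1 (continuous_ed df c) Hdf e He) as [r [Hr H]].
  exists r. split; auto. intros y Hy.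
  destruct (Req_dec y c) as [->|Hn].
  { rewrite !Rminus_diag, Rmult_0_r, Rminus_diag, Rabs_R0. lra. }
  destruct (MVT_gen f c y df) as [x [Hx E]].
  - intros x Hx. apply Hd. unfold Rmin, Rmax in Hx. destruct (Rle_dec c y); lra.
  - intros x Hx. apply continuity_pt_of_continuous.
    destruct (Req_dec x c) as [->|Hxc]; auto. eapply continuous_of_derive, Hd, Hxc.
  - rewrite E. replace (df x * (y - c) - df c * (y - c)) with ((df x - df c) * (y - c)) by ring.
    rewrite Rabs_mult. apply Rmult_le_compat_r; [apply Rabs_pos|]. left. apply H.
    eapply Rle_lt_trans; [|exact Hy]. unfold Rmin, Rmax in Hx.
    destruct (Rle_dec c y); [rewrite !Rabs_right|rewrite !Rabs_left1]; lra.
Qed.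

Lemma der_abs_right c z : c < z -> is_derive (fun t => Rabs (t - c)) z 1.
Proof.
  intros H. apply is_derive_ext_loc with (fun t => t - c).
  - generalize (open_gt c z H). apply filter_imp. intros t Ht. rewrite Rabs_right; auto. lra.
  - der. ring.
Qed.
Lemma der_abs_left c z : z < c -> is_derive (fun t => Rabs (t - c)) z (- 1).
Proof.
  intros H. apply is_derive_ext_loc with (fun t => - (t - c)).
  - generalize (open_lt c z H). apply filter_imp. intros t Ht. rewrite Rabs_left; auto. lra.
  - der. ring.
Qed.
Lemma locally_ne (c z : R) : z <> c -> locally z (fun t : R => t <> c).
Proof. intros H. apply (open_neq c z H). Qed.

Lemma continuous_of_lipschitz_at (f : R -> R) c L :
  (forall z, Rabs (f z - f c) <= L * Rabs (z - c)) -> continuous f c.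
Proof.
  intros H. apply continuous_ed. intros e He.
  assert (HL : 0 < Rabs L + 1) by (assert (Hp := Rabs_pos L); lra).
  exists (e / (Rabs L + 1)). split; [apply Rdiv_lt_0_compat; lra|]. intros z Hz.
  apply (Rmult_lt_compat_l (Rabs L + 1)) in Hz; [|lra].
  replace ((Rabs L + 1) * (e / (Rabs L + 1))) with e in Hz by (field; lra).
  eapply Rle_lt_trans; [apply H|]. eapply Rle_lt_trans; [|exact Hz].
  apply Rmult_le_compat_r; [apply Rabs_pos|]. assert (K := Rle_abs L). lra.
Qed.

(** [|l z - h0 z|], completed at the jump by its common one-sided limit. *)
Definition speed0 (l c a : R) (h0 : R -> R) (z : R) : R :=
  if Req_EM_T z c then a else Rabs (l * z - h0 z).

(** The inviscid potential: [(2l-1) P0 = l z h0 - h0^2 / 2] off the jump, and [P0]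
    is continuous there by the Rankine-Hugoniot condition. *)
Definition potential0 (l c a : R) (h0 : R -> R) (z : R) : R :=
  (l ^ 2 * z ^ 2 - speed0 l c a h0 z ^ 2) / (2 * (2 * l - 1)).

Section Approximation.
Variables (l c a k0 Hm H1 : R) (h0 h1 : R -> R).
Hypothesis Hl : / 2 < l < 1.
Hypothesis IP : inviscid_profile l c a k0 Hm H1 h0 h1.
Let g := 2 * l - 1.
Let phi := speed0 l c a h0.
Let P0 := potential0 l c a h0.

Let Hg : 0 < g.
Proof. unfold g. lra. Qed.

Lemma speed0_ne z : z <> c -> phi z = Rabs (l * z - h0 z).
Proof. intros H. unfold phi, speed0. destruct (Req_EM_T z c); tauto. Qed.
Lemma speed0_c : phi c = a.
Proof. unfold phi, speed0. destruct (Req_EM_T c c); tauto. Qed.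
Lemma speed0_right z : c < z -> phi z = l * z - h0 z.
Proof.
  intros H. rewrite speed0_ne by lra. apply Rabs_right. apply Rle_ge.
  eapply Rle_trans; [|apply (ip_right IP z H)].
  apply Rmult_le_pos; [left; apply (ip_k0 IP)|lra].
Qed.
Lemma speed0_left z : z < c -> phi z = h0 z - l * z.
Proof.
  intros H. rewrite speed0_ne by lra. rewrite Rabs_left1; [ring|].
  assert (K := ip_left IP z H).
  assert (0 <= k0 * (1 + (c - z))).
  { apply Rmult_le_pos; [left; apply (ip_k0 IP)|lra]. }
  lra.
Qed.

Lemma speed0_ge z : k0 * (1 + Rabs (z - c)) <= phi z.
Proof.
  destruct (Rtotal_order z c) as [H|[->|H]].
  - rewrite speed0_left, Rabs_left by lra.
    assert (K := ip_left IP z H). replace (- (z - c)) with (c - z) by ring. lra.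
  - rewrite speed0_c, Rminus_diag, Rabs_R0. assert (K := ip_k0a IP). lra.
  - rewrite speed0_right, Rabs_right by lra. apply (ip_right IP z H).
Qed.

Lemma speed0_near z : Rabs (phi z - a) <= (l + H1) * Rabs (z - c).
Proof.
  destruct (Rtotal_order z c) as [H|[->|H]].
  - rewrite speed0_left, (Rabs_left (z - c)) by lra.
    replace (- (z - c)) with (c - z) by ring. apply (ip_left_c IP z H).
  - rewrite speed0_c, !Rminus_diag, Rabs_R0. lra.
  - rewrite speed0_right, (Rabs_right (z - c)) by lra. apply (ip_right_c IP z H).
Qed.

Lemma potential0_eq z : z <> c -> g * P0 z = l * z * h0 z - h0 z ^ 2 / 2.
Proof.
  intros H. unfold P0, potential0. fold phi. rewrite speed0_ne, pow2_abs by auto.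
  unfold g. field. lra.
Qed.

Lemma potential0_derive z : z <> c -> is_derive P0 z (h0 z).
Proof.
  intros H. apply is_derive_ext_loc with (fun t => (l * t * h0 t - h0 t ^ 2 / 2) / g).
  - generalize (locally_ne c z H). apply filter_imp. intros t Ht.
    change (@eq R ((l * t * h0 t - h0 t ^ 2 / 2) / g) (P0 t)).
    rewrite <- (potential0_eq t Ht). field. lra.
  - assert (D := ip_derive IP z H).
    assert (E := ip_eq IP z H).
    der. apply Rmult_eq_reg_r with g; [|lra]. 
    replace ((((0 * z + l * 1) * h0 z + l * z * h1 z - 2 * h0 z * h1 z / 2) / g) * g)
      with (l * h0 z + (l * z - h0 z) * h1 z) by (field; lra).
    unfold g. lra.
Qed.

Lemma potential0_continuous z : continuous P0 z.
Proof.
  destruct (Req_dec z c) as [->|H].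
  - assert (Hphi : continuous phi c).
    { apply continuous_of_lipschitz_at with (l + H1). intros z. rewrite speed0_c. apply speed0_near. }
    apply continuous_ext with (fun z => (l ^ 2 * (z * z) - phi z * phi z) * / (2 * (2 * l - 1))).
    { intros t. unfold P0, potential0, Rdiv. fold phi.
      change (@eq R ((l ^ 2 * (t * t) - phi t * phi t) * / (2 * (2 * l - 1)))
        ((l ^ 2 * t ^ 2 - phi t ^ 2) * / (2 * (2 * l - 1)))). ring. }
    apply continuous_R_mult; [|apply continuous_const].
    apply continuous_R_minus; [|now apply continuous_R_mult].
    apply continuous_R_mult; [apply continuous_const|].
    apply continuous_R_mult; apply continuous_id.
  - eapply continuous_of_derive, potential0_derive, H.
Qed.

Section Layer.
Variable eps : R.
Hypothesis Heps : 0 < eps.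
(* [S = - 2 eps ln (2 cosh (a (z - c) / (2 eps)))] and [S' = - tau], where
   [tau = a tanh (a (z - c) / (2 eps))] is the stationary profile of the layer. As
   [P0 + a |z - c|] is differentiable at [c], replacing the corner [- a |z - c|] by
   [S] gives a differentiable [Q]. *)
Let E z := exp (a * (z - c) / (2 * eps)).
Let E' z := exp (- (a * (z - c) / (2 * eps))).
Let S z := - 2 * eps * ln (E z + E' z).
Let tau z := a * tanh (a * (z - c) / (2 * eps)).
Let sg z := if Rlt_dec z c then -1 else 1.
Let Q z := P0 z + a * Rabs (z - c) + S z.
Let q z := l * z - sg z * (phi z - a) - tau z.
Let q1 z := h1 z - (a ^ 2 - tau z ^ 2) / (2 * eps).

Let Ha : 0 < a.
Proof. apply (ip_a IP). Qed.

Lemma layer_sum_pos z : 0 < E z + E' z.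
Proof. assert (K1 := exp_pos (a * (z - c) / (2 * eps))).
  assert (K2 := exp_pos (- (a * (z - c) / (2 * eps)))). unfold E, E'. lra. Qed.

Lemma S_derive z : is_derive S z (- tau z).
Proof.
  assert (Hp := layer_sum_pos z). unfold S, E, E'. der. exact Hp.
  fold (E z) (E' z). unfold tau. rewrite tanh_exp. fold (E z) (E' z). field. split; lra.
Qed.

Lemma tau_derive z : is_derive tau z ((a ^ 2 - tau z ^ 2) / (2 * eps)).
Proof. apply tanh_layer_derive, Heps. Qed.

Lemma layer_right z : c <= z -> - (2 * eps) <= a * (z - c) + S z <= 0 /\
  0 <= a - tau z /\ (a - tau z) * (z - c) <= 2 * eps.
Proof.
  intros Hz. set (x := a * (z - c) / (2 * eps)).
  assert (Ex : a * (z - c) = 2 * eps * x) by (unfold x; field; lra).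
  assert (Hx : 0 <= x).
  { apply Rmult_le_pos. apply Rmult_le_pos; lra. left; apply Rinv_0_lt_compat; lra. }
  assert (K := log_cosh_bounds x Hx). destruct (tanh_gap x Hx) as [T1 T2].
  unfold S, tau, E, E'. fold x. rewrite Ex.
  set (L := ln (exp x + exp (- x))) in *. set (T := tanh x) in *.
  split; [nra|]. split.
  - assert (0 <= a * (1 - T)) by (apply Rmult_le_pos; lra). lra.
  - replace ((a - a * T) * (z - c)) with (a * (z - c) * (1 - T)) by ring. rewrite Ex.
    replace (2 * eps * x * (1 - T)) with (2 * eps * (x * (1 - T))) by ring.
    rewrite <- (Rmult_1_r (2 * eps)) at 2. apply Rmult_le_compat_l; lra.
Qed.

Lemma layer_even z : S (2 * c - z) = S z /\ tau (2 * c - z) = - tau z.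
Proof.
  assert (A1 : E (2 * c - z) = E' z) by (unfold E, E'; f_equal; field; lra).
  assert (A2 : E' (2 * c - z) = E z) by (unfold E, E'; f_equal; field; lra).
  unfold S, tau. rewrite A1, A2. split; [f_equal; f_equal; ring|].
  replace (a * (2 * c - z - c) / (2 * eps)) with (- (a * (z - c) / (2 * eps))) by (field; lra).
  rewrite tanh_odd. ring.
Qed.

Lemma layer_gap z : - (2 * eps) <= a * Rabs (z - c) + S z <= 0 /\
  Rabs (sg z * a - tau z) * Rabs (z - c) <= 2 * eps.
Proof.
  unfold sg. destruct (Rlt_dec z c) as [Hz|Hz].
  - destruct (layer_right (2 * c - z)) as [K1 [K2 K3]]; [lra|].
    destruct (layer_even z) as [E1 E2]. rewrite E1 in K1. rewrite E2 in K2, K3.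
    rewrite (Rabs_left (z - c)) by lra.
    replace (- (z - c)) with (2 * c - z - c) by ring. split; auto.
    rewrite Rabs_left1 by lra. lra.
  - destruct (layer_right z) as [K1 [K2 K3]]; [lra|].
    rewrite (Rabs_right (z - c)) by lra. split; auto. rewrite Rabs_right by lra. lra.
Qed.

Lemma q_ne z : z <> c -> q z = h0 z + sg z * a - tau z.
Proof.
  intros H. unfold q, sg. destruct (Rlt_dec z c) as [Hz|Hz].
  - rewrite speed0_left by auto. ring.
  - rewrite speed0_right by lra. ring.
Qed.

Lemma q_continuous_c : continuous q c.
Proof.
  unfold q. apply continuous_R_minus; [|eapply continuous_of_derive, tau_derive].
  apply continuous_of_lipschitz_at with (l + (l + H1)). intros z.
  rewrite speed0_c. unfold sg.
  replace (l * z - (if Rlt_dec z c then -1 else 1) * (phi z - a) -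
    (l * c - (if Rlt_dec c c then -1 else 1) * (a - a)))
   with (l * (z - c) + (- (if Rlt_dec z c then -1 else 1)) * (phi z - a)) by ring.
  eapply Rle_trans; [apply Rabs_triang|]. rewrite !Rabs_mult, Rabs_Ropp, (Rabs_right l) by lra.
  assert (K := speed0_near z).
  replace (Rabs (if Rlt_dec z c then -1 else 1)) with 1.
  2: { destruct (Rlt_dec z c). rewrite Rabs_left; lra. rewrite Rabs_right; lra. }
  lra.
Qed.

Lemma Q_derive z : is_derive Q z (q z).
Proof.
  assert (Hne : forall z, z <> c -> is_derive Q z (q z)).
  { intros t Ht. assert (D1 := potential0_derive t Ht). assert (D2 := S_derive t).
    rewrite q_ne by auto. unfold sg. destruct (Rlt_dec t c) as [H|H].
    - assert (D3 := der_abs_left c t H). unfold Q.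
      evar_last. apply der_plus; [apply der_plus; [exact D1|]|exact D2].
      apply der_scal, D3. ring.
    - assert (D3 := der_abs_right c t ltac:(lra)). unfold Q.
      evar_last. apply der_plus; [apply der_plus; [exact D1|]|exact D2].
      apply der_scal, D3. ring. }
  destruct (Req_dec z c) as [->|H]; auto.
  apply is_derive_removable; auto.
  - unfold Q. apply continuous_R_plus; [apply continuous_R_plus|].
    + apply potential0_continuous.
    + apply continuous_R_mult; [apply continuous_const|].
      apply (continuous_R_comp Rabs). apply continuous_R_minus. apply continuous_id. apply continuous_const.
      apply continuous_Rabs.
    + eapply continuous_of_derive, S_derive.
  - apply q_continuous_c.
Qed.

Lemma q_derive z : z <> c -> is_derive q z (q1 z).
Proof.
  intros H. assert (D := ip_derive IP z H). assert (T := tau_derive z).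
  unfold q1. destruct (Rlt_dec z c) as [Hz|Hz].
  - apply is_derive_ext_loc with (fun t => h0 t + - a - tau t).
    + generalize (open_lt c z Hz). apply filter_imp. intros t Ht.
      change (@eq R (h0 t + - a - tau t) (q t)). rewrite q_ne by lra.
      unfold sg. destruct (Rlt_dec t c); [ring|lra].
    + apply (der_minus (fun t => h0 t + - a) tau); auto. der. ring.
  - apply is_derive_ext_loc with (fun t => h0 t + a - tau t).
    + generalize (open_gt c z ltac:(lra)). apply filter_imp. intros t Ht.
      change (@eq R (h0 t + a - tau t) (q t)). rewrite q_ne by lra.
      unfold sg. destruct (Rlt_dec t c); [lra|ring].
    + apply (der_minus (fun t => h0 t + a) tau); auto. der. ring.
Qed.

(** The layer [tau] solves [eps tau' = (a^2 - tau^2)/2], so its contributions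
    cancel but for the product of its distance to its end values [a] and [- a] with the
    variation of the outer speed. *)
Lemma Q_residual z : z <> c ->
  Rabs (eps * q1 z + l * z * q z - q z ^ 2 / 2 - g * Q z) <= (H1 + 2 * (l + H1) + 2 * g) * eps.
Proof.
  intros H. rewrite q_ne by auto. unfold q1.
  destruct (layer_gap z) as [G1 G2].
  assert (K0 := speed0_near z). assert (K1 := ip_bound1 IP z H).
  assert (Hsf : phi z = sg z * (l * z - h0 z)).
  { unfold sg. destruct (Rlt_dec z c). rewrite speed0_left by lra; ring. rewrite speed0_right by lra; ring. }
  assert (Hsg : sg z * sg z = 1) by (unfold sg; destruct (Rlt_dec z c); ring).
  assert (Hsa : Rabs (sg z) = 1).
  { unfold sg; destruct (Rlt_dec z c); [rewrite Rabs_left|rewrite Rabs_right]; lra. }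
  assert (Heq : eps * (h1 z - (a ^ 2 - tau z ^ 2) / (2 * eps)) + l * z * (h0 z + sg z * a - tau z)
     - (h0 z + sg z * a - tau z) ^ 2 / 2 - g * Q z =
     eps * h1 z + (sg z * a - tau z) * (sg z * (phi z - a)) - g * (a * Rabs (z - c) + S z)).
  { unfold Q. rewrite 2!Rmult_plus_distr_l, potential0_eq by auto. rewrite Hsf.
    replace (sg z * (sg z * (l * z - h0 z) - a)) with (sg z * sg z * (l * z - h0 z) - sg z * a) by ring.
    rewrite Hsg.
    replace (eps * (h1 z - (a ^ 2 - tau z ^ 2) / (2 * eps))) with
      (eps * h1 z - (a ^ 2 - tau z ^ 2) / 2) by (field; lra).
    replace (a ^ 2) with (sg z * sg z * a ^ 2) by (rewrite Hsg; ring). field. }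
  rewrite Heq.
  assert (B1 : Rabs (eps * h1 z) <= eps * H1).
  { rewrite Rabs_mult, (Rabs_right eps) by lra. apply Rmult_le_compat_l; lra. }
  assert (B2 : Rabs ((sg z * a - tau z) * (sg z * (phi z - a))) <= (l + H1) * (2 * eps)).
  { rewrite !Rabs_mult, Hsa, Rmult_1_l.
    apply Rle_trans with (Rabs (sg z * a - tau z) * ((l + H1) * Rabs (z - c))).
    apply Rmult_le_compat_l; [apply Rabs_pos|auto].
    replace (Rabs (sg z * a - tau z) * ((l + H1) * Rabs (z - c)))
      with ((l + H1) * (Rabs (sg z * a - tau z) * Rabs (z - c))) by ring.
    apply Rmult_le_compat_l; auto. assert (K2 := ip_H1 IP). lra. }
  assert (B3 : - (g * (2 * eps)) <= g * (a * Rabs (z - c) + S z) <= 0) by nra.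
  apply Rabs_le_between in B1, B2. apply Rabs_le. lra.
Qed.

(** The residual of [Q] and the distance from [Q] to [P0] are both of order [eps],
    and the maximum principle loses only a constant. *)
Lemma viscous_potential_near : exists P h : R -> R,
  viscous_potential g l eps (fun _ => True) P h /\
  forall z, Rabs (P z - P0 z) <= (2 * (H1 + 2 * (l + H1) + 2 * g) / g + 2) * eps.
Proof.
  set (k := 2 * ((H1 + 2 * (l + H1) + 2 * g) * eps) / g).
  assert (HH1 := ip_H1 IP).
  assert (Hk : 0 < k).
  { apply Rdiv_lt_0_compat; auto. apply Rmult_lt_0_compat; [lra|].
    apply Rmult_lt_0_compat; lra. }
  destruct (potential_on_line g l eps k Q) as [P [h [HP HPQ]]]; try lra; auto.
  - intros z. eapply continuous_of_derive, Q_derive.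
  - intros n Hn. apply (potential_on_interval g l eps k c Q q q1); auto; try lra.
    + apply Q_derive.
    + intros z Hz. now apply q_derive.
    + intros z. destruct (Req_dec z c) as [->|Hz]; [apply q_continuous_c|].
      eapply continuous_of_derive, q_derive, Hz.
    + intros z Hz. eapply Rle_trans; [now apply Q_residual|].
      unfold k. right. field. lra.
  - exists P, h. split; auto. intros z. specialize (HPQ z).
    destruct (layer_gap z) as [G1 _].
    replace (P z - P0 z) with (P z - Q z + (a * Rabs (z - c) + S z)) by (unfold Q; ring).
    apply Rabs_le_between in HPQ. 
    assert (Ek : (2 * (H1 + 2 * (l + H1) + 2 * g) / g + 2) * eps = k + 2 * eps)
      by (unfold k; field; lra).
    rewrite Ek. apply Rabs_le. lra.
Qed.
End Layer.
End Approximation.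

(** * Riccati estimates on one side of the layer *)

(** With [f = l z - h] and [W = eps l + l^2 z^2/2 - g P], the viscous equation reads
    [eps f' = W - f^2/2], and [W' = g f + l (1-l) z]. The data describe the
    half-line to the right of the zero [p] of [f], where the inviscid speed is
    [f0]; the other half-line is reduced to it by [z |-> -z]. *)
Record half_line (g l Cc kw Kw L1 k K0 C1 eps p c : R) (f W f0 f01 : R -> R) : Prop := {
  hl_f : forall z, is_derive f z ((W z - f z ^ 2 / 2) / eps);
  hl_W : forall z, is_derive W z (g * f z + l * (1 - l) * z);
  hl_zero : f p = 0;
  hl_pos : forall z, p < z -> 0 < f z;
  hl_p : Rabs (p - c) <= / 2;
  hl_c : Rabs c <= Cc;
  hl_W_low : forall z, kw <= W z;
  hl_W_up : forall z, W z <= Kw * (1 + Rabs (z - c)) ^ 2;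
  hl_f0 : forall z, c < z -> is_derive f0 z (f01 z);
  hl_f01 : forall z, c < z -> Rabs (f01 z) <= L1;
  hl_f0_low : forall z, c < z -> k * (1 + (z - c)) <= f0 z;
  hl_f0_up : forall z, c < z -> f0 z <= K0 * (1 + (z - c));
  hl_outer : forall z, c < z -> Rabs (W z - f0 z ^ 2 / 2) <= C1 * eps }.
Arguments hl_f {g l Cc kw Kw L1 k K0 C1 eps p c f W f0 f01} _.
Arguments hl_W {g l Cc kw Kw L1 k K0 C1 eps p c f W f0 f01} _.
Arguments hl_zero {g l Cc kw Kw L1 k K0 C1 eps p c f W f0 f01} _.
Arguments hl_pos {g l Cc kw Kw L1 k K0 C1 eps p c f W f0 f01} _.
Arguments hl_p {g l Cc kw Kw L1 k K0 C1 eps p c f W f0 f01} _.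
Arguments hl_c {g l Cc kw Kw L1 k K0 C1 eps p c f W f0 f01} _.
Arguments hl_W_low {g l Cc kw Kw L1 k K0 C1 eps p c f W f0 f01} _.
Arguments hl_W_up {g l Cc kw Kw L1 k K0 C1 eps p c f W f0 f01} _.
Arguments hl_f0 {g l Cc kw Kw L1 k K0 C1 eps p c f W f0 f01} _.
Arguments hl_f01 {g l Cc kw Kw L1 k K0 C1 eps p c f W f0 f01} _.
Arguments hl_f0_low {g l Cc kw Kw L1 k K0 C1 eps p c f W f0 f01} _.
Arguments hl_f0_up {g l Cc kw Kw L1 k K0 C1 eps p c f W f0 f01} _.
Arguments hl_outer {g l Cc kw Kw L1 k K0 C1 eps p c f W f0 f01} _.

Section HalfLine.
Variables (g l Cc kw Kw L1 k K0 C1 eps p c : R) (f W f0 f01 : R -> R).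
Hypothesis Hg : 0 < g < 1.
Hypothesis Hl : 0 < l < 1.
Hypothesis HCc : 0 < Cc.
Hypothesis Hkw : 0 < kw.
Hypothesis HKw : 0 < Kw.
Hypothesis HL1 : 0 < L1.
Hypothesis Hk : 0 < k.
Hypothesis HK0 : 0 < K0.
Hypothesis HC1 : 0 < C1.
Hypothesis Heps : 0 < eps <= 1.
Hypothesis Hepsk : eps <= k / 4.
Hypothesis D : half_line g l Cc kw Kw L1 k K0 C1 eps p c f W f0 f01.

Let pc : p - c <= / 2 /\ c - p <= / 2.
Proof. assert (H := hl_p D). apply Rabs_le_between in H. lra. Qed.

Let c_bound : - Cc <= c <= Cc.
Proof. assert (H := hl_c D). now apply Rabs_le_between. Qed.

Lemma f_nonneg z : p <= z -> 0 <= f z.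
Proof.
  intros [H| <-]. left; apply (hl_pos D z H).
  right. symmetry. apply (hl_zero D).
Qed.

Lemma weight_shift z : p <= z -> 1 + Rabs (z - c) <= 2 * (1 + (z - p)) /\
  1 + (z - p) <= 2 * (1 + Rabs (z - c)).
Proof.
  intros Hz. destruct (Rle_lt_dec c z).
  - rewrite (Rabs_right (z - c)); lra.
  - rewrite (Rabs_left (z - c)); lra.
Qed.

Let M := 4 * Kw + 1.

Lemma f_upper z : p <= z -> f z <= M * (1 + (z - p)).
Proof.
  intros Hz. cut (0 <= M * (1 + (z - p)) - f z); [lra|].
  apply (barrier 0 (fun z => M * (1 + (z - p)) - f z)
    (fun z => M - (W z - f z ^ 2 / 2) / eps) p z); try lra.
  - intros t Ht. assert (D1 := hl_f D t). der. ring.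
  - rewrite (hl_zero D), Rminus_diag. unfold M. lra.
  - intros t Ht Hneg. rewrite Rmult_0_l.
    assert (HW := hl_W_up D t).
    destruct (weight_shift t ltac:(lra)) as [Hw _].
    assert (Hr := Rabs_pos (t - c)).
    set (y := 1 + (t - p)) in *. set (r := 1 + Rabs (t - c)) in *.
    assert (Hy : 1 <= y) by (unfold y; lra).
    assert (H1 : r ^ 2 <= (2 * y) ^ 2) by (apply pow_incr; unfold r; unfold r in Hw; lra).
    assert (H2 : (M * y) ^ 2 <= f t ^ 2).
    { apply pow_incr. split; [apply Rmult_le_pos; unfold M; lra|lra]. }
    assert (H3 : Kw * r ^ 2 <= Kw * (2 * y) ^ 2) by (apply Rmult_le_compat_l; lra).
    assert (H4 : 8 * Kw * y ^ 2 <= (M * y) ^ 2).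
    { replace ((M * y) ^ 2) with (M ^ 2 * y ^ 2) by ring.
      apply Rmult_le_compat_r; [apply pow2_ge_0|]. unfold M. nra. }
    assert (H5 : W t - f t ^ 2 / 2 <= 0) by lra.
    assert ((W t - f t ^ 2 / 2) / eps <= 0).
    { apply Rmult_le_reg_r with eps; [lra|]. unfold Rdiv. rewrite Rmult_assoc, Rinv_l by lra. lra. }
    unfold M; lra.
Qed.

(** When [W - f^2/2] is negative [f] is bounded below, so that the damping term
    [- f (W - f^2/2) / eps] of its equation beats the source [l (1-l) z], which may
    be negative. *)
Lemma riccati_defect_low z : p <= z -> - ((Cc + 1) / sqrt (2 * kw)) * eps <= W z - f z ^ 2 / 2.
Proof.
  intros Hz. set (s := sqrt (2 * kw)). assert (Hs : 0 < s) by (apply sqrt_lt_R0; lra).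
  assert (Hs2 : s * s = 2 * kw) by (apply sqrt_sqrt; lra).
  set (N := (Cc + 1) / s). assert (HN : 0 < N) by (apply Rdiv_lt_0_compat; lra).
  assert (ENs : N * s = Cc + 1) by (unfold N; field; lra).
  cut (0 <= W z - f z ^ 2 / 2 + N * eps); [lra|].
  apply (barrier 0 (fun z => W z - f z ^ 2 / 2 + N * eps)
    (fun z => g * f z + l * (1 - l) * z - f z * ((W z - f z ^ 2 / 2) / eps)) p z); try lra.
  - intros t Ht. assert (D1 := hl_f D t).
    assert (D2 := hl_W D t). der. field. lra.
  - rewrite (hl_zero D).
    assert (H := hl_W_low D p).
    assert (0 < N * eps) by (apply Rmult_lt_0_compat; lra). simpl. lra.
  - intros t Ht Hneg. rewrite Rmult_0_l.
    assert (Hf := f_nonneg t ltac:(lra)).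
    assert (HW := hl_W_low D t).
    assert (HNe : 0 < N * eps) by (apply Rmult_lt_0_compat; lra).
    assert (Hfs : s <= f t).
    { destruct (Rle_lt_dec s (f t)) as [|Hlt]; auto. exfalso.
      assert (f t ^ 2 <= s * s) by nra. lra. }
    set (X := (W t - f t ^ 2 / 2) / eps).
    assert (HX : X < - N).
    { apply Rmult_lt_reg_r with eps; [lra|]. unfold X, Rdiv. rewrite Rmult_assoc, Rinv_l by lra. lra. }
    assert (HfX : f t * N <= f t * - X) by (apply Rmult_le_compat_l; lra).
    assert (HsN : s * N <= f t * N) by (apply Rmult_le_compat_r; lra).
    assert (Hgf : 0 <= g * f t) by (apply Rmult_le_pos; lra).
    assert (Hz2 : - (Cc + 1) <= l * (1 - l) * t).
    { assert (0 < l * (1 - l) < 1) by nra. nra. }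
    lra.
Qed.

Let C2 := 2 * M + Cc + 2.

Lemma W_lipschitz z : p <= z <= p + 1 -> Rabs (W z - W p) <= C2 * (z - p).
Proof.
  intros Hz. destruct (Req_dec z p) as [->|Hn]; [rewrite !Rminus_diag, Rabs_R0; lra|].
  destruct (mean_value W (fun z => g * f z + l * (1 - l) * z) p z) as [x [Hx E]]; [lra| |].
  { intros t _. apply (hl_W D). }
  rewrite E, Rabs_mult, (Rabs_right (z - p)) by lra.
  apply Rmult_le_compat_r; [lra|].
  assert (Hf := f_nonneg x ltac:(lra)). assert (Hf2 := f_upper x ltac:(lra)).
  assert (0 <= g * f x <= f x) by nra.
  assert (M * (1 + (x - p)) <= M * 2) by (apply Rmult_le_compat_l; unfold M; lra).
  assert (Hz2 : - (Cc + 2) <= l * (1 - l) * x <= Cc + 2).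
  { assert (0 < l * (1 - l) < 1) by nra. nra. }
  unfold C2. apply Rabs_le. lra.
Qed.

Lemma layer_profile A z : 0 < A -> A ^ 2 / 2 = W p - eps * l -> p <= z <= p + 1 ->
  Rabs (f z - A * tanh (A * (z - p) / (2 * eps))) <= C2 * ((z - p) ^ 2 / eps + (z - p)).
Proof.
  intros HA EA Hz.
  assert (HM : 0 < M) by (unfold M; lra).
  assert (HC2 : 2 < C2) by (unfold C2; lra).
  set (tau := fun z => A * tanh (A * (z - p) / (2 * eps))).
  assert (Htau0 : tau p = 0).
  { unfold tau. rewrite Rminus_diag, Rmult_0_r, Rdiv_0_l, tanh_0. ring. }
  assert (key : forall s, Rabs s = 1 ->
    0 <= C2 * ((z - p) ^ 2 / (2 * eps)) + (z - p) - s * (f z - tau z)).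
  { intros s Hs.
    apply (barrier 0 (fun z => C2 * ((z - p) ^ 2 / (2 * eps)) + (z - p) - s * (f z - tau z))
      (fun z => C2 * (z - p) / eps + 1 -
        s * ((W z - f z ^ 2 / 2) / eps - (A ^ 2 - tau z ^ 2) / (2 * eps))) p z); try lra.
    - intros t Ht. assert (D1 := hl_f D t).
      assert (D2 := tanh_layer_derive A p eps t ltac:(lra)). fold (tau t) in D2.
      change (fun z => A * tanh (A * (z - p) / (2 * eps))) with tau in D2.
      der. field. lra.
    - rewrite (hl_zero D), Htau0, !Rminus_diag.
      right. field. lra.
    - intros t Ht Hneg. rewrite Rmult_0_l.
      assert (Ht2 : 0 <= tau t).
      { apply Rmult_le_pos; [lra|]. apply tanh_nonneg.
        apply Rmult_le_pos; [apply Rmult_le_pos; lra|left; apply Rinv_0_lt_compat; lra]. }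
      assert (Hf := f_nonneg t ltac:(lra)).
      assert (Hpos : 0 < s * (f t - tau t)).
      { assert (0 <= C2 * ((t - p) ^ 2 / (2 * eps))).
        { apply Rmult_le_pos; [lra|]. apply Rmult_le_pos; [apply pow2_ge_0|].
          left; apply Rinv_0_lt_compat; lra. }
        lra. }
      assert (HW := W_lipschitz t ltac:(lra)).
      assert (HWA : s * (W t - A ^ 2 / 2) <= C2 * (t - p) + eps).
      { eapply Rle_trans; [apply Rle_abs|]. rewrite Rabs_mult, Hs, Rmult_1_l, EA.
        replace (W t - (W p - eps * l)) with ((W t - W p) + eps * l) by ring.
        eapply Rle_trans; [apply Rabs_triang|]. apply Rplus_le_compat; auto.
        rewrite Rabs_right by nra. nra. }
      replace (C2 * (t - p) / eps + 1 - s * ((W t - f t ^ 2 / 2) / eps - (A ^ 2 - tau t ^ 2) / (2 * eps)))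
        with ((C2 * (t - p) + eps - s * (W t - A ^ 2 / 2) + s * (f t - tau t) * ((f t + tau t) / 2)) / eps)
        by (field; lra).
      apply Rmult_le_pos; [|left; apply Rinv_0_lt_compat; lra].
      assert (0 <= s * (f t - tau t) * ((f t + tau t) / 2)) by (apply Rmult_le_pos; lra). lra. }
  assert (K1 := key 1 Rabs_R1). assert (K2 := key (-1) ltac:(rewrite Rabs_left; lra)).
  fold (tau z).
  assert (Hy : 0 <= (z - p) ^ 2 / eps).
  { apply Rmult_le_pos; [apply pow2_ge_0|left; apply Rinv_0_lt_compat; lra]. }
  replace ((z - p) ^ 2 / (2 * eps)) with ((z - p) ^ 2 / eps / 2) in K1, K2 by (field; lra).
  apply Rabs_le. split; nra.
Qed.

(** Outside the layer [f - f0] obeys a linear equation with damping rate of order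
    [(1 + z - c) / eps], hence the decay. *)
Lemma outer_decay z1 m : c < z1 -> p <= z1 -> 4 * (C1 + L1) / k * eps <= m ->
  Rabs (f z1 - f0 z1) * (1 + (z1 - c)) <= m ->
  forall z, z1 <= z -> Rabs (f z - f0 z) * (1 + (z - c)) <= m.
Proof.
  intros Hz1 Hp Hm H1 z Hz.
  assert (HL : 0 < C1 + L1) by lra.
  assert (Hm0 : 0 < m).
  { apply Rlt_le_trans with (4 * (C1 + L1) / k * eps); auto.
    apply Rmult_lt_0_compat; [|lra]. apply Rdiv_lt_0_compat; lra. }
  assert (Hkm : 4 * (C1 + L1) * eps <= k * m).
  { apply (Rmult_le_compat_l k) in Hm; [|lra].
    replace (k * (4 * (C1 + L1) / k * eps)) with (4 * (C1 + L1) * eps) in Hm by (field; lra). lra. }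
  assert (key : forall s, Rabs s = 1 -> 0 <= m / (1 + (z - c)) - s * (f z - f0 z)).
  { intros s Hs.
    apply (barrier 0 (fun z => m / (1 + (z - c)) - s * (f z - f0 z))
      (fun z => - m / (1 + (z - c)) ^ 2 - s * ((W z - f z ^ 2 / 2) / eps - f01 z)) z1 z); try lra.
    - intros t Ht. assert (D1 := hl_f D t).
      assert (D2 := hl_f0 D t ltac:(lra)).
      der. lra. field. lra.
    - assert (Hr : s * (f z1 - f0 z1) <= Rabs (f z1 - f0 z1)).
      { eapply Rle_trans; [apply Rle_abs|]. rewrite Rabs_mult, Hs. lra. }
      assert (Rabs (f z1 - f0 z1) <= m / (1 + (z1 - c))); [|lra].
      apply Rmult_le_reg_r with (1 + (z1 - c)); [lra|].
      unfold Rdiv. rewrite (Rmult_assoc m), Rinv_l; lra.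
    - intros t Ht Hneg. rewrite Rmult_0_l.
      set (r := 1 + (t - c)) in *. assert (Hr : 1 < r) by (unfold r; lra).
      assert (Hf := f_nonneg t ltac:(lra)).
      assert (Hf0 := hl_f0_low D t ltac:(lra)). fold r in Hf0.
      assert (HW := hl_outer D t ltac:(lra)).
      assert (Hf1 := hl_f01 D t ltac:(lra)).
      set (d := s * (f t - f0 t)) in *.
      assert (Hmr : 0 < m / r) by (apply Rdiv_lt_0_compat; lra).
      assert (Hd : m < d * r).
      { apply Rle_lt_trans with (m / r * r). right; field; lra. apply Rmult_lt_compat_r; lra. }
      assert (Hdk : k * m <= (f t + f0 t) * d).
      { assert (k * r * d <= (f t + f0 t) * d) by (apply Rmult_le_compat_r; lra).
        assert (k * m <= k * (d * r)) by (apply Rmult_le_compat_l; lra). lra. }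
      assert (Hs1 : s * (W t - f0 t ^ 2 / 2) <= C1 * eps).
      { eapply Rle_trans; [apply Rle_abs|]. rewrite Rabs_mult, Hs. lra. }
      assert (Hs2 : - L1 <= s * f01 t).
      { assert (HH : Rabs (s * f01 t) <= L1) by (rewrite Rabs_mult, Hs; lra).
        apply Rabs_le_between in HH. lra. }
      assert (Hr2 : m / r ^ 2 <= m).
      { assert (Hr1 : 1 <= r ^ 2) by nra.
        apply Rmult_le_reg_r with (r ^ 2); [lra|]. unfold Rdiv. rewrite Rmult_assoc, Rinv_l by lra.
        apply Rmult_le_compat_l; lra. }
      replace (- m / r ^ 2 - s * ((W t - f t ^ 2 / 2) / eps - f01 t))
        with ((- (m / r ^ 2) * eps + s * f01 t * eps - s * (W t - f0 t ^ 2 / 2) + (f t + f0 t) * d / 2) / eps)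
        by (unfold d; field; lra).
      apply Rmult_le_pos; [|left; apply Rinv_0_lt_compat; lra].
      assert (m / r ^ 2 * eps <= m * (k / 4)).
      { apply Rmult_le_compat; try lra. left; apply Rdiv_lt_0_compat; [lra|nra]. }
      assert (- L1 * eps <= s * f01 t * eps) by (apply Rmult_le_compat_r; lra).
      lra. }
  assert (K1 := key 1 Rabs_R1). assert (K2 := key (-1) ltac:(rewrite Rabs_left; lra)).
  assert (H : Rabs (f z - f0 z) <= m / (1 + (z - c))) by (apply Rabs_le; lra).
  apply (Rmult_le_compat_r (1 + (z - c))) in H; [|lra].
  replace (m / (1 + (z - c)) * (1 + (z - c))) with m in H by (field; lra). lra.
Qed.

Let m1 := 5 * (M + K0) + 4 * (C1 + L1) / k.

Lemma outer_bound z : c + 1 <= z -> Rabs (f z - f0 z) * (1 + (z - c)) <= m1.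
Proof.
  intros Hz. assert (HCk : 0 < 4 * (C1 + L1) / k) by (apply Rdiv_lt_0_compat; lra).
  assert (HM : 0 < M) by (unfold M; lra).
  apply (outer_decay (c + 1)); try lra.
  - unfold m1. assert (4 * (C1 + L1) / k * eps <= 4 * (C1 + L1) / k * 1) by (apply Rmult_le_compat_l; lra).
    lra.
  - assert (B1 := f_nonneg (c + 1) ltac:(lra)). assert (B2 := f_upper (c + 1) ltac:(lra)).
    assert (B3 := hl_f0_low D (c + 1) ltac:(lra)).
    assert (B4 := hl_f0_up D (c + 1) ltac:(lra)).
    replace (1 + (c + 1 - c)) with 2 in * by ring.
    assert (M * (1 + (c + 1 - p)) <= M * (5 / 2)) by (apply Rmult_le_compat_l; lra).
    assert (Rabs (f (c + 1) - f0 (c + 1)) <= M * (5 / 2) + K0 * 2).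
    { apply Rabs_le. assert (0 < k * 2) by lra. lra. }
    unfold m1. lra.
Qed.

Let K2 := Kw * 9 + (3 * M) ^ 2 + C1 + m1 * (2 * M + K0).

Lemma riccati_defect_abs z : p <= z -> Rabs (W z - f z ^ 2 / 2) <= K2.
Proof.
  intros Hz. assert (HM : 0 < M) by (unfold M; lra).
  assert (HCk : 0 < 4 * (C1 + L1) / k) by (apply Rdiv_lt_0_compat; lra).
  assert (Hm1 : 0 < m1) by (unfold m1; lra).
  assert (Hf := f_nonneg z Hz). assert (Hf2 := f_upper z Hz).
  assert (Hmm : 0 < m1 * (2 * M + K0)) by (apply Rmult_lt_0_compat; lra).
  assert (HM2 : 0 < M ^ 2) by nra.
  destruct (Rle_lt_dec (c + 1) z) as [H|H].
  - assert (Ho := hl_outer D z ltac:(lra)).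
    assert (Hd := outer_bound z H).
    assert (B3 := hl_f0_low D z ltac:(lra)).
    assert (B4 := hl_f0_up D z ltac:(lra)).
    set (r := 1 + (z - c)) in *. assert (Hr : 2 <= r) by (unfold r; lra).
    assert (Hkr : 0 < k * r) by (apply Rmult_lt_0_compat; lra).
    assert (Hfr : f z <= 2 * M * r).
    { eapply Rle_trans; [exact Hf2|]. replace (2 * M * r) with (M * (2 * r)) by ring.
      apply Rmult_le_compat_l; [lra|]. unfold r. lra. }
    replace (W z - f z ^ 2 / 2) with ((W z - f0 z ^ 2 / 2) + - ((f z - f0 z) * ((f z + f0 z) / 2))) by field.
    eapply Rle_trans; [apply Rabs_triang|]. rewrite Rabs_Ropp, Rabs_mult.
    assert (C1 * eps <= C1) by nra.
    assert (Hprod : Rabs (f z - f0 z) * Rabs ((f z + f0 z) / 2) <= m1 * (2 * M + K0)).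
    { apply Rle_trans with (Rabs (f z - f0 z) * (r * (2 * M + K0))).
      - apply Rmult_le_compat_l; [apply Rabs_pos|]. rewrite Rabs_right; nra.
      - rewrite <- Rmult_assoc. apply Rmult_le_compat_r; lra. }
    unfold K2. assert (0 <= (3 * M) ^ 2) by apply pow2_ge_0. lra.
  - assert (HWl := hl_W_low D z).
    assert (HWu := hl_W_up D z).
    assert (Hr : Rabs (z - c) <= 1) by (apply Rabs_le; lra).
    assert ((1 + Rabs (z - c)) ^ 2 <= 2 ^ 2).
    { apply pow_incr. assert (Hp := Rabs_pos (z - c)). lra. }
    assert (Kw * (1 + Rabs (z - c)) ^ 2 <= Kw * 2 ^ 2) by (apply Rmult_le_compat_l; lra).
    assert (M * (1 + (z - p)) <= 3 * M) by nra.
    assert (f z ^ 2 <= (3 * M) ^ 2) by (apply pow_incr; lra).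
    assert (0 <= f z ^ 2) by apply pow2_ge_0.
    unfold K2. apply Rabs_le. lra.
Qed.
End HalfLine.

(** The estimates on a half-line, with one constant for all of them that does not
    depend on [eps]. *)
Lemma half_line_estimates (g l Cc kw Kw L1 k K0 C1 : R) :
  0 < g < 1 -> 0 < l < 1 -> 0 < Cc -> 0 < kw -> 0 < Kw -> 0 < L1 -> 0 < k -> 0 < K0 -> 0 < C1 ->
  exists N, 0 < N /\ forall eps p c f W f0 f01, 0 < eps <= 1 -> eps <= k / 4 ->
    half_line g l Cc kw Kw L1 k K0 C1 eps p c f W f0 f01 ->
    (forall z, p <= z -> 0 <= f z <= N * (1 + Rabs (z - c))) /\
    (forall z, p <= z -> - N * eps <= W z - f z ^ 2 / 2) /\
    (forall z, p <= z -> Rabs (W z - f z ^ 2 / 2) <= N) /\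
    (forall A z, 0 < A -> A ^ 2 / 2 = W p - eps * l -> p <= z <= p + 1 ->
       Rabs (f z - A * tanh (A * (z - p) / (2 * eps))) <= N * ((z - p) ^ 2 / eps + (z - p))) /\
    (forall z1 m, c < z1 -> p <= z1 -> N * eps <= m ->
       Rabs (f z1 - f0 z1) * (1 + (z1 - c)) <= m ->
       forall z, z1 <= z -> Rabs (f z - f0 z) * (1 + (z - c)) <= m) /\
    (forall z, c + 1 <= z -> Rabs (f z - f0 z) * (1 + (z - c)) <= N).
Proof.
  intros Hg Hl HCc Hkw HKw HL1 Hk HK0 HC1.
  set (M := 4 * Kw + 1). set (N1 := (Cc + 1) / sqrt (2 * kw)).
  set (m0 := 4 * (C1 + L1) / k). set (m1 := 5 * (M + K0) + m0).
  set (K2 := Kw * 9 + (3 * M) ^ 2 + C1 + m1 * (2 * M + K0)).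
  set (C2 := 2 * M + Cc + 2).
  assert (HM : 0 < M) by (unfold M; lra).
  assert (HN1 : 0 < N1) by (apply Rdiv_lt_0_compat; [lra|apply sqrt_lt_R0; lra]).
  assert (Hm0 : 0 < m0) by (apply Rdiv_lt_0_compat; lra).
  assert (Hm1 : 0 < m1) by (unfold m1; lra).
  assert (HK2 : 0 < K2).
  { assert (0 < m1 * (2 * M + K0)) by (apply Rmult_lt_0_compat; lra).
    assert (0 <= (3 * M) ^ 2) by apply pow2_ge_0. unfold K2. lra. }
  assert (HC2 : 0 < C2) by (unfold C2; lra).
  exists (2 * M + N1 + m0 + m1 + K2 + C2). split; [lra|].
  intros eps p c f W f0 f01 Heps Hek D.
  split; [|split; [|split; [|split; [|split]]]].
  - intros z Hz. split.
    + eapply f_nonneg; try exact D; eauto.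
    + assert (U : f z <= M * (1 + (z - p))) by (eapply f_upper; try exact D; eauto).
      assert (S : 1 + (z - p) <= 2 * (1 + Rabs (z - c))) by (eapply weight_shift; try exact D; eauto).
      assert (M * (1 + (z - p)) <= M * (2 * (1 + Rabs (z - c)))) by (apply Rmult_le_compat_l; lra).
      assert (Hp := Rabs_pos (z - c)).
      assert (0 <= (N1 + m0 + m1 + K2 + C2) * (1 + Rabs (z - c))) by (apply Rmult_le_pos; lra).
      lra.
  - intros z Hz.
    assert (U : - N1 * eps <= W z - f z ^ 2 / 2) by (eapply riccati_defect_low; try exact D; eauto). nra.
  - intros z Hz.
    assert (U : Rabs (W z - f z ^ 2 / 2) <= K2) by (eapply riccati_defect_abs; try exact D; eauto). lra.
  - intros A z HA EA Hz.
    assert (U : Rabs (f z - A * tanh (A * (z - p) / (2 * eps))) <= C2 * ((z - p) ^ 2 / eps + (z - p)))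
      by (eapply layer_profile; try exact D; eauto).
    eapply Rle_trans; [exact U|]. apply Rmult_le_compat_r; [|lra].
    assert (0 <= (z - p) ^ 2 / eps).
    { apply Rmult_le_pos; [apply pow2_ge_0|left; apply Rinv_0_lt_compat; lra]. }
    lra.
  - intros z1 m Hz1 Hp Hm H z Hz.
    eapply outer_decay with (z1 := z1); try exact D; eauto. fold m0. nra.
  - intros z Hz.
    assert (U : Rabs (f z - f0 z) * (1 + (z - c)) <= m1) by (eapply outer_bound; try exact D; eauto). lra.
Qed.

(** * Each viscous solution near the profile *)

(** [a^2], when [a] is defined from [P] by [P''(z) = - a^2 / (2 eps)] at a point [z]
    where [P'(z) = l z]. *)
Definition amplitude2 (l z p : R) : R := l ^ 2 * z ^ 2 - 2 * (2 * l - 1) * p.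

(** The second derivative of a potential with value [p] and slope [s] at [z], read off
    the viscous equation. *)
Definition slope_of (l eps z p s : R) : R := ((2 * l - 1) * p - l * z * s + s ^ 2 / 2) / eps.

(** The estimates on a viscous potential [P] with derivative [h], which crosses the
    line of slope [l] at [zc], with one constant [N], meant to be independent of
    [eps]. Outside the layer the error is measured by [1 + |z - c|], a weight that
    dominates [(1 + |z|)^alpha]. *)
Record solution_facts (l c a : R) (h0 : R -> R) (N eps : R) (P h : R -> R) (zc : R) : Prop := {
  sf_zero : h zc = l * zc;
  sf_right : forall z, zc < z -> h z < l * z;
  sf_left : forall z, z < zc -> l * z < h z;
  sf_loc : Rabs (zc - c) <= N * eps;
  sf_h : forall z, Rabs (h z) <= N;
  sf_h1_up : forall z, slope_of l eps z (P z) (h z) <= N;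
  sf_h1 : forall z, Rabs (slope_of l eps z (P z) (h z)) <= N / eps;
  sf_amp_low : / N <= amplitude2 l zc (P zc);
  sf_amp : Rabs (amplitude2 l zc (P zc) - a ^ 2) <= N * eps;
  sf_layer : forall z, Rabs (z - zc) <= 1 ->
    Rabs (l * z - h z - sqrt (amplitude2 l zc (P zc)) *
        tanh (sqrt (amplitude2 l zc (P zc)) * (z - zc) / (2 * eps)))
      <= N * ((z - zc) ^ 2 / eps + Rabs (z - zc));
  sf_outer_right : forall z1 m, c < z1 -> zc <= z1 -> N * eps <= m ->
    Rabs (h z1 - h0 z1) * (1 + (z1 - c)) <= m ->
    forall z, z1 <= z -> Rabs (h z - h0 z) * (1 + (z - c)) <= m;
  sf_outer_left : forall z1 m, z1 < c -> z1 <= zc -> N * eps <= m ->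
    Rabs (h z1 - h0 z1) * (1 + (c - z1)) <= m ->
    forall z, z <= z1 -> Rabs (h z - h0 z) * (1 + (c - z)) <= m;
  sf_tail : forall z, 1 <= Rabs (z - c) -> Rabs (h z - h0 z) * (1 + Rabs (z - c)) <= N }.
Arguments sf_zero {l c a h0 N eps P h zc} _.
Arguments sf_right {l c a h0 N eps P h zc} _.
Arguments sf_left {l c a h0 N eps P h zc} _.
Arguments sf_loc {l c a h0 N eps P h zc} _.
Arguments sf_h {l c a h0 N eps P h zc} _.
Arguments sf_h1_up {l c a h0 N eps P h zc} _.
Arguments sf_h1 {l c a h0 N eps P h zc} _.
Arguments sf_amp_low {l c a h0 N eps P h zc} _.
Arguments sf_amp {l c a h0 N eps P h zc} _.
Arguments sf_layer {l c a h0 N eps P h zc} _.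
Arguments sf_outer_right {l c a h0 N eps P h zc} _.
Arguments sf_outer_left {l c a h0 N eps P h zc} _.
Arguments sf_tail {l c a h0 N eps P h zc} _.

Lemma mean_value_open (f df : R -> R) a b : a < b ->
  (forall x, a <= x <= b -> continuous f x) ->
  (forall x, a < x < b -> is_derive f x (df x)) ->
  exists c, a < c < b /\ f b - f a = df c * (b - a).
Proof.
  intros Hab Hc Hd.
  assert (pr1 : forall x, a < x < b -> derivable_pt f x).
  { intros x Hx. exists (df x). apply is_derive_Reals, Hd, Hx. }
  assert (pr2 : forall x, a < x < b -> derivable_pt id x).
  { intros x _. apply derivable_pt_id. }
  destruct (MVT f id a b pr1 pr2 Hab) as [x [Hx E]].
  - intros x Hx. apply continuity_pt_of_continuous; auto.
  - intros x _. apply derivable_continuous_pt, derivable_pt_id.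
  - exists x. split; auto.
    rewrite (derive_pt_eq_0 f x (df x)) in E by (apply is_derive_Reals, Hd, Hx).
    rewrite (derive_pt_eq_0 id x 1) in E by apply derivable_pt_lim_id.
    unfold id in E. lra.
Qed.

Section Solution.
Variables (l c a k0 Hm H1 C0 : R) (h0 h1 : R -> R).
Hypothesis Hl : / 2 < l < 1.
Hypothesis IP : inviscid_profile l c a k0 Hm H1 h0 h1.
Hypothesis HC0 : 0 < C0.
Let g := 2 * l - 1.
Let phi := speed0 l c a h0.
Let P0 := potential0 l c a h0.
Let F := l + H1.
Let K0 := a + F.
Let C1 := 1 + C0.
Let kw := k0 ^ 2 / 4.
Let Kw := K0 ^ 2 / 2 + kw.

Let Hg : 0 < g < 1.
Proof. unfold g. lra. Qed.
Let Hc := ip_c IP.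
Let Ha := ip_a IP.
Let Hk0 := ip_k0 IP.
Let HHm := ip_Hm IP.
Let HH1 := ip_H1 IP.

Let HF : 0 < F.
Proof. unfold F. lra. Qed.
Let Hkw : 0 < kw.
Proof. unfold kw. assert (0 < k0 ^ 2) by now apply pow_lt. lra. Qed.

Lemma speed0_le z : phi z <= K0 * (1 + Rabs (z - c)).
Proof.
  assert (K := speed0_near _ _ _ _ _ _ _ _ Hl IP z). fold phi F in K.
  apply Rabs_le_between in K. assert (Hp := Rabs_pos (z - c)).
  unfold K0. assert (0 <= a * Rabs (z - c)) by (apply Rmult_le_pos; lra). lra.
Qed.

Lemma speed0_sq_ge z : 2 * kw <= phi z ^ 2 / 2.
Proof.
  assert (K := speed0_ge _ _ _ _ _ _ _ _ Hl IP z). fold phi in K.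
  assert (Hp := Rabs_pos (z - c)).
  assert (k0 <= k0 * (1 + Rabs (z - c))) by nra.
  assert (k0 ^ 2 <= phi z ^ 2) by (apply pow_incr; lra). unfold kw. lra.
Qed.

Section OneSolution.
Variables (eps : R) (P h : R -> R).
Hypothesis Heps : 0 < eps.
Hypothesis Heps1 : eps <= 1.
Hypothesis Heps2 : eps <= k0 / 4.
Hypothesis Heps3 : eps <= kw / C1.
Hypothesis Heps4 : eps <= k0 / (4 * C0).
Hypothesis HP : viscous_potential g l eps (fun _ => True) P h.
Hypothesis HPP : forall z, Rabs (P z - P0 z) <= C0 * eps.

Let f z := l * z - h z.
Let W z := eps * l + l ^ 2 * z ^ 2 / 2 - g * P z.

Lemma f_derive z : is_derive f z ((W z - f z ^ 2 / 2) / eps).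
Proof. destruct (HP z I) as [D1 D2]. unfold f. der. unfold W, f. field. lra. Qed.

Lemma W_derive z : is_derive W z (g * f z + l * (1 - l) * z).
Proof. destruct (HP z I) as [D1 D2]. unfold W. der. unfold f, g. field. Qed.

(** [phi^2 / 2] is the function [W] of the inviscid potential. *)
Lemma W_near z : Rabs (W z - phi z ^ 2 / 2) <= C1 * eps.
Proof.
  assert (E : phi z ^ 2 / 2 = l ^ 2 * z ^ 2 / 2 - g * P0 z).
  { unfold P0, potential0. fold phi. unfold g. field. lra. }
  replace (W z - phi z ^ 2 / 2) with (eps * l + - (g * (P z - P0 z))) by (rewrite E; unfold W; ring).
  eapply Rle_trans; [apply Rabs_triang|]. rewrite Rabs_Ropp, (Rabs_mult g), (Rabs_right g) by lra.
  specialize (HPP z). assert (Hp := Rabs_pos (P z - P0 z)).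
  rewrite Rabs_right by (assert (0 < eps * l) by (apply Rmult_lt_0_compat; lra); lra).
  unfold C1. nra.
Qed.

Lemma C1eps : C1 * eps <= kw.
Proof.
  apply (Rmult_le_compat_l C1) in Heps3; [|unfold C1; lra].
  replace (C1 * (kw / C1)) with kw in Heps3 by (unfold C1; field; lra). lra.
Qed.

Lemma W_ge z : kw <= W z.
Proof.
  assert (K1 := W_near z). assert (K2 := speed0_sq_ge z). assert (K3 := C1eps).
  apply Rabs_le_between in K1. lra.
Qed.

Lemma W_le z : W z <= Kw * (1 + Rabs (z - c)) ^ 2.
Proof.
  assert (K1 := W_near z). assert (K2 := speed0_le z). assert (K3 := C1eps).
  assert (K4 := speed0_ge _ _ _ _ _ _ _ _ Hl IP z). fold phi in K4.
  apply Rabs_le_between in K1. assert (Hp := Rabs_pos (z - c)).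
  set (r := 1 + Rabs (z - c)) in *.
  assert (0 <= k0 * r) by (apply Rmult_le_pos; unfold r; lra).
  assert (phi z ^ 2 <= (K0 * r) ^ 2) by (apply pow_incr; lra).
  assert (1 <= r ^ 2) by (unfold r; nra).
  unfold Kw. nra.
Qed.

Let Mf z := l * z ^ 2 / 2 - P z.
Let Ef z := exp (Mf z / (2 * eps)).

(** [e^(M / 2 eps) f], where [M' = f], has derivative [e^(M / 2 eps) W / eps > 0]: hence
    [f] vanishes only once. *)
Lemma f_weighted_increasing y z : y < z -> f y * Ef y < f z * Ef z.
Proof.
  intros Hyz.
  destruct (mean_value (fun t => f t * Ef t) (fun t => W t / eps * Ef t) y z Hyz) as [x [Hx E]].
  - intros t _. assert (D1 := f_derive t). destruct (HP t I) as [D2 _].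
    unfold Ef, Mf. der. unfold f. field. lra.
  - simpl in E. assert (0 < W x / eps * Ef x).
    { apply Rmult_lt_0_compat; [|apply exp_pos]. apply Rdiv_lt_0_compat; auto.
      assert (K := W_ge x). lra. }
    assert (0 < W x / eps * Ef x * (z - y)) by (apply Rmult_lt_0_compat; lra). lra.
Qed.

Lemma P_increment z : (c < z \/ z + 1 < c) ->
  exists x, z < x < z + 1 /\ Rabs (h x) <= Hm + 2 * C0.
Proof.
  intros Hz.
  destruct (mean_value P h z (z + 1)) as [x [Hx E]]; [lra|intros; apply HP; exact I|].
  destruct (mean_value P0 h0 z (z + 1)) as [y [Hy E0]]; [lra| |].
  { intros t Ht. apply (potential0_derive l c a k0 Hm H1 h0 h1); auto. lra. }
  exists x. split; auto.
  assert (K1 := HPP z). assert (K2 := HPP (z + 1)).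
  assert (K3 := ip_bound IP y ltac:(lra)).
  apply Rabs_le_between in K1, K2, K3.
  assert (C0 * eps <= C0 * 1) by (apply Rmult_le_compat_l; lra).
  replace (z + 1 - z) with 1 in E, E0 by ring. apply Rabs_le. lra.
Qed.

Lemma crossing : exists zc, f zc = 0 /\
  (forall z, zc < z -> 0 < f z) /\ (forall z, z < zc -> f z < 0).
Proof.
  set (B := Hm + 2 * C0). assert (HB : 0 < B) by (unfold B; lra).
  assert (HBl : 0 < B / l) by (apply Rdiv_lt_0_compat; lra).
  assert (EBl : l * (B / l) = B) by (field; lra).
  destruct (P_increment (B / l + c + 2)) as [x [Hx1 Hx2]]; [left; lra|].
  destruct (P_increment (- (B / l) - 3)) as [y [Hy1 Hy2]]; [right; lra|].
  fold B in Hx2, Hy2. apply Rabs_le_between in Hx2, Hy2.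
  assert (Hfx : 0 < f x).
  { assert (l * (B / l + c + 2) <= l * x) by (apply Rmult_le_compat_l; lra).
    assert (0 < l * (c + 2)) by (apply Rmult_lt_0_compat; lra). unfold f. lra. }
  assert (Hfy : f y < 0).
  { assert (l * y <= l * (- (B / l) - 2)) by (apply Rmult_le_compat_l; lra). unfold f. lra. }
  destruct (last_nonneg (fun t => - f t) y x) as [s [_ [Hs _]]]; try lra.
  { intros t _. apply continuous_of_derive with (- ((W t - f t ^ 2 / 2) / eps)).
    apply (der_opp f). apply f_derive. }
  exists s. assert (Hs0 : f s = 0) by lra. split; auto.
  split; intros z Hz.
  - assert (K := f_weighted_increasing s z Hz). rewrite Hs0, Rmult_0_l in K.
    assert (He := exp_pos (Mf z / (2 * eps))). fold (Ef z) in He.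
    apply Rmult_lt_reg_r with (Ef z); auto. lra.
  - assert (K := f_weighted_increasing z s Hz). rewrite Hs0, Rmult_0_l in K.
    assert (He := exp_pos (Mf z / (2 * eps))). fold (Ef z) in He.
    apply Rmult_lt_reg_r with (Ef z); auto. lra.
Qed.

(** [l z^2/2 - P] is minimal at the crossing, and it is uniformly close to
    [l z^2/2 - P0], which has a sharp corner at its minimum [c]. *)
Lemma crossing_near zc : f zc = 0 -> (forall z, zc < z -> 0 < f z) ->
  (forall z, z < zc -> f z < 0) -> Rabs (zc - c) <= 2 * C0 / k0 * eps.
Proof.
  intros H0 Hr Hleft.
  assert (Hmin : Mf zc <= Mf c).
  { assert (D : forall t, is_derive Mf t (f t)).
    { intros t. destruct (HP t I) as [D _]. unfold Mf. der. unfold f. field. }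
    destruct (Rtotal_order zc c) as [H|[->|H]].
    - destruct (mean_value Mf f zc c H) as [x [Hx E]]; [intros; apply D|].
      specialize (Hr x ltac:(lra)). assert (0 < f x * (c - zc)) by (apply Rmult_lt_0_compat; lra). lra.
    - lra.
    - destruct (mean_value Mf f c zc H) as [x [Hx E]]; [intros; apply D|].
      specialize (Hleft x ltac:(lra)).
      assert (0 < - f x * (zc - c)) by (apply Rmult_lt_0_compat; lra). lra. }
  set (M0 := fun z => l * z ^ 2 / 2 - P0 z).
  assert (Hcorner : k0 * Rabs (zc - c) <= M0 zc - M0 c).
  { assert (Hcont : forall x, continuous M0 x).
    { intros x. apply continuous_R_minus.
      - apply continuous_of_derive with (l * x). der. field.
      - apply (potential0_continuous l c a k0 Hm H1 h0 h1); auto. }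
    assert (Hd : forall x, x <> c -> is_derive M0 x (l * x - h0 x)).
    { intros x Hx. assert (D := potential0_derive l c a k0 Hm H1 h0 h1 Hl IP x Hx).
      fold P0 in D. unfold M0. der. field. }
    destruct (Rtotal_order zc c) as [H|[->|H]].
    - destruct (mean_value_open M0 (fun x => l * x - h0 x) zc c H) as [x [Hx E]]; auto.
      { intros x Hx. apply Hd; lra. }
      assert (K := ip_left IP x ltac:(lra)).
      assert (0 <= k0 * (c - x)) by (apply Rmult_le_pos; lra).
      rewrite Rabs_left by lra.
      assert (k0 * (c - zc) <= (h0 x - l * x) * (c - zc)) by (apply Rmult_le_compat_r; lra).
      lra.
    - rewrite !Rminus_diag, Rabs_R0. lra.
    - destruct (mean_value_open M0 (fun x => l * x - h0 x) c zc H) as [x [Hx E]]; auto.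
      { intros x Hx. apply Hd; lra. }
      assert (K := ip_right IP x ltac:(lra)).
      assert (0 <= k0 * (x - c)) by (apply Rmult_le_pos; lra).
      rewrite Rabs_right by lra.
      assert (k0 * (zc - c) <= (l * x - h0 x) * (zc - c)) by (apply Rmult_le_compat_r; lra).
      lra. }
  assert (K1 := HPP zc). assert (K2 := HPP c). apply Rabs_le_between in K1, K2.
  unfold M0, Mf in *.
  apply Rmult_le_reg_l with k0; auto.
  replace (k0 * (2 * C0 / k0 * eps)) with (2 * (C0 * eps)) by (field; lra). lra.
Qed.

Lemma near_half zc : Rabs (zc - c) <= 2 * C0 / k0 * eps -> Rabs (zc - c) <= / 2.
Proof.
  intros H. eapply Rle_trans; [exact H|].
  assert (H2C : 0 < 2 * C0 / k0) by (apply Rdiv_lt_0_compat; lra).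
  apply Rle_trans with (2 * C0 / k0 * (k0 / (4 * C0))).
  - apply Rmult_le_compat_l; lra.
  - right. field. lra.
Qed.

Lemma half_line_right zc : f zc = 0 -> (forall z, zc < z -> 0 < f z) ->
  Rabs (zc - c) <= 2 * C0 / k0 * eps ->
  half_line g l (c + 1) kw Kw F k0 K0 C1 eps zc c f W
    (fun z => l * z - h0 z) (fun z => l - h1 z).
Proof.
  intros H0 Hr Hn.
  assert (Hph : forall z, c < z -> phi z = l * z - h0 z).
  { intros z Hz. apply (speed0_right l c a k0 Hm H1 h0 h1); auto. }
  constructor; auto.
  - apply f_derive.
  - apply W_derive.
  - now apply near_half.
  - rewrite Rabs_right; lra.
  - apply W_ge.
  - apply W_le.
  - intros z Hz. assert (D := ip_derive IP z ltac:(lra)). der. ring.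
  - intros z Hz. assert (K := ip_bound1 IP z ltac:(lra)).
    apply Rabs_le_between in K. unfold F. apply Rabs_le. lra.
  - intros z Hz. apply (ip_right IP z Hz).
  - intros z Hz. assert (K := speed0_le z). rewrite Hph, Rabs_right in K by lra. lra.
  - intros z Hz. assert (K := W_near z). rewrite Hph in K by lra. exact K.
Qed.

Lemma half_line_left zc : f zc = 0 -> (forall z, z < zc -> f z < 0) ->
  Rabs (zc - c) <= 2 * C0 / k0 * eps ->
  half_line g l (c + 1) kw Kw F k0 K0 C1 eps (- zc) (- c)
    (fun z => - f (- z)) (fun z => W (- z))
    (fun z => h0 (- z) - l * - z) (fun z => l - h1 (- z)).
Proof.
  intros H0 Hr Hn.
  assert (Hph : forall z, - c < z -> phi (- z) = h0 (- z) - l * - z).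
  { intros z Hz. apply (speed0_left l c a k0 Hm H1 h0 h1); auto. lra. }
  assert (Hab : forall z, Rabs (z - - c) = Rabs (- z - c)).
  { intros z. rewrite <- Rabs_Ropp. f_equal. ring. }
  constructor.
  - intros z. assert (D := is_derive_reflect f z _ (f_derive (- z))).
    evar_last. apply der_opp, D. field. lra.
  - intros z. assert (D := is_derive_reflect W z _ (W_derive (- z))).
    evar_last. exact D. ring.
  - rewrite Ropp_involutive, H0. ring.
  - intros z Hz. specialize (Hr (- z) ltac:(lra)). lra.
  - replace (- zc - - c) with (- (zc - c)) by ring. rewrite Rabs_Ropp. now apply near_half.
  - rewrite Rabs_left; lra.
  - intros z. apply W_ge.
  - intros z. rewrite Hab. apply W_le.
  - intros z Hz. assert (D := is_derive_reflect h0 z _ (ip_derive IP (- z) ltac:(lra))).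
    evar_last. apply der_minus. exact D. apply der_scal, der_opp, der_id. ring.
  - intros z Hz. assert (K := ip_bound1 IP (- z) ltac:(lra)).
    apply Rabs_le_between in K. unfold F. apply Rabs_le. lra.
  - intros z Hz. assert (K := ip_left IP (- z) ltac:(lra)).
    replace (z - - c) with (c - - z) by ring. lra.
  - intros z Hz. assert (K := speed0_le (- z)). rewrite Hph, <- Hab, Rabs_right in K by lra. lra.
  - intros z Hz. assert (K := W_near (- z)). rewrite Hph in K by lra. exact K.
Qed.
End OneSolution.

Lemma solution_facts_uniform : exists N e1, 0 < N /\ 0 < e1 /\
  forall eps P h, 0 < eps < e1 -> viscous_potential g l eps (fun _ => True) P h ->
    (forall z, Rabs (P z - P0 z) <= C0 * eps) ->
    exists zc, solution_facts l c a h0 N eps P h zc.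
Proof.
  assert (HC1 : 0 < C1) by (unfold C1; lra).
  assert (HK0 : 0 < K0) by (unfold K0; lra).
  assert (HKw : 0 < Kw) by (unfold Kw; assert (0 < K0 ^ 2) by (now apply pow_lt); lra).
  destruct (half_line_estimates g l (c + 1) kw Kw F k0 K0 C1) as [N0 [HN0 HL]]; try lra.
  set (C3 := 2 * C0 / k0). assert (HC3 : 0 < C3) by (apply Rdiv_lt_0_compat; lra).
  set (N := 2 * N0 + (l * (c + 2) + 4 * N0) + (Hm + N0) + (l + N0) + C3 + / kw
       + (F * C3 * (2 * a + F) + 2 * C1)).
  assert (Hikw : 0 < / kw) by now apply Rinv_0_lt_compat.
  assert (HFC : 0 < F * C3 * (2 * a + F)).
  { apply Rmult_lt_0_compat; [|lra]. now apply Rmult_lt_0_compat. }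
  assert (Hlc : 0 < l * (c + 2)) by (apply Rmult_lt_0_compat; lra).
  exists N, (Rmin (Rmin 1 (k0 / 4)) (Rmin (kw / C1) (k0 / (4 * C0)))).
  assert (HN : 0 < N) by (unfold N; lra).
  split; [lra|]. split.
  { repeat apply Rmin_glb_lt; try lra; apply Rdiv_lt_0_compat; lra. }
  intros eps P h [Heps Hsm] HP HPP.
  assert (Hs1 := Rmin_l (Rmin 1 (k0 / 4)) (Rmin (kw / C1) (k0 / (4 * C0)))).
  assert (Hs2 := Rmin_r (Rmin 1 (k0 / 4)) (Rmin (kw / C1) (k0 / (4 * C0)))).
  assert (Hs3 := Rmin_l 1 (k0 / 4)). assert (Hs4 := Rmin_r 1 (k0 / 4)).
  assert (Hs5 := Rmin_l (kw / C1) (k0 / (4 * C0))). assert (Hs6 := Rmin_r (kw / C1) (k0 / (4 * C0))).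
  assert (He1 : eps <= 1) by lra. assert (He2 : eps <= k0 / 4) by lra.
  assert (He3 : eps <= kw / C1) by lra. assert (He4 : eps <= k0 / (4 * C0)) by lra.
  clear Hsm Hs1 Hs2 Hs3 Hs4 Hs5 Hs6.
  set (f := fun z => l * z - h z). set (W := fun z => eps * l + l ^ 2 * z ^ 2 / 2 - g * P z).
  assert (Hcr : exists zc, f zc = 0 /\ (forall z, zc < z -> 0 < f z) /\ (forall z, z < zc -> f z < 0))
    by (apply (crossing eps P h); auto).
  destruct Hcr as [zc [Hz0 [Hzr Hzl]]].
  assert (Hn : Rabs (zc - c) <= 2 * C0 / k0 * eps) by (apply (crossing_near eps P h); auto).
  assert (Hh : Rabs (zc - c) <= / 2) by (apply (near_half eps); auto). apply Rabs_le_between in Hh.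
  assert (DR : half_line g l (c + 1) kw Kw F k0 K0 C1 eps zc c f W
    (fun z => l * z - h0 z) (fun z => l - h1 z)) by (apply (half_line_right eps P h); auto).
  assert (DL : half_line g l (c + 1) kw Kw F k0 K0 C1 eps (- zc) (- c)
    (fun z => - f (- z)) (fun z => W (- z))
    (fun z => h0 (- z) - l * - z) (fun z => l - h1 (- z))) by (apply (half_line_left eps P h); auto).
  destruct (HL eps zc c f W _ _ (conj Heps He1) He2 DR) as [R1 [R2 [R3 [R4 [R5 R6]]]]].
  destruct (HL eps (- zc) (- c) _ _ _ _ (conj Heps He1) He2 DL) as [L1 [L2 [L3 [L4 [L5 L6]]]]].
  clear DR DL HL.
  assert (Hslope : forall z, slope_of l eps z (P z) (h z) = l - (W z - f z ^ 2 / 2) / eps).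
  { intros z. unfold slope_of, W, f. fold g. field. lra. }
  assert (HAW : amplitude2 l zc (P zc) = 2 * (W zc - eps * l)).
  { unfold amplitude2, W. fold g. field. }
  assert (HW1 : Rabs (W zc - phi zc ^ 2 / 2) <= C1 * eps) by (apply (W_near eps P); auto).
  assert (HW2 := speed0_sq_ge zc).
  assert (Hamp : kw <= amplitude2 l zc (P zc)).
  { rewrite HAW. assert (K := HPP zc).
    assert (E : phi zc ^ 2 / 2 = l ^ 2 * zc ^ 2 / 2 - g * P0 zc).
    { unfold P0, potential0. fold phi. unfold g. field. lra. }
    assert (K3 : C1 * eps <= kw) by (apply C1eps; auto). unfold C1 in K3.
    apply Rabs_le_between in K. unfold W.
    assert (g * (P zc - P0 zc) <= C0 * eps).
    { assert (0 < C0 * eps) by (apply Rmult_lt_0_compat; lra). nra. }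
    lra. }
  set (A := sqrt (amplitude2 l zc (P zc))).
  assert (HA : 0 < A) by (apply sqrt_lt_R0; lra).
  assert (EA : A ^ 2 / 2 = W zc - eps * l).
  { unfold A. rewrite pow2_sqrt by lra. rewrite HAW. field. }
  assert (Hdefect : forall z, - N0 * eps <= W z - f z ^ 2 / 2 /\ Rabs (W z - f z ^ 2 / 2) <= N0).
  { intros z. destruct (Rle_lt_dec zc z) as [H|H]; [split; auto|].
    specialize (L2 (- z) ltac:(lra)). specialize (L3 (- z) ltac:(lra)).
    rewrite Ropp_involutive in L2, L3.
    replace ((- f z) ^ 2) with (f z ^ 2) in L2, L3 by ring. auto. }
  assert (Htail : forall z, 1 <= Rabs (z - c) -> Rabs (h z - h0 z) * (1 + Rabs (z - c)) <= N0).
  { intros z Hz. destruct (Rle_lt_dec c z) as [H|H].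
    - rewrite Rabs_right in Hz by lra. rewrite (Rabs_right (z - c)) by lra.
      specialize (R6 z ltac:(lra)). unfold f in R6.
      replace (h z - h0 z) with (- (l * z - h z - (l * z - h0 z))) by ring.
      rewrite Rabs_Ropp. exact R6.
    - rewrite Rabs_left in Hz by lra. rewrite (Rabs_left (z - c)) by lra.
      specialize (L6 (- z) ltac:(lra)). unfold f in L6. rewrite Ropp_involutive in L6.
      replace (h z - h0 z) with (- (l * z - h z) - (h0 z - l * z)) by ring.
      replace (- (z - c)) with (- z - - c) by ring. exact L6. }
  exists zc. constructor.
  - unfold f in Hz0. lra.
  - intros z Hz. specialize (Hzr z Hz). unfold f in Hzr. lra.
  - intros z Hz. specialize (Hzl z Hz). unfold f in Hzl. lra.
  - fold C3 in Hn. eapply Rle_trans; [exact Hn|]. apply Rmult_le_compat_r; [lra|unfold N; lra].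
  - intros z. destruct (Rle_lt_dec 1 (Rabs (z - c))) as [H|H].
    + specialize (Htail z H). assert (Hp := Rabs_pos (h z - h0 z)).
      assert (Rabs (h z - h0 z) <= N0) by nra.
      assert (Hzc : z <> c).
      { intros ->. rewrite Rminus_diag, Rabs_R0 in H. lra. }
      assert (K := ip_bound IP z Hzc).
      apply Rabs_le_between in H0, K. unfold N. apply Rabs_le. lra.
    + assert (Hf : Rabs (f z) <= 2 * N0).
      { destruct (Rle_lt_dec zc z) as [H'|H'].
        - specialize (R1 z H'). assert (N0 * (1 + Rabs (z - c)) <= N0 * 2) by (apply Rmult_le_compat_l; lra).
          apply Rabs_le. lra.
        - specialize (L1 (- z) ltac:(lra)). rewrite Ropp_involutive in L1.
          replace (- z - - c) with (- (z - c)) in L1 by ring. rewrite Rabs_Ropp in L1.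
          assert (N0 * (1 + Rabs (z - c)) <= N0 * 2) by (apply Rmult_le_compat_l; lra).
          apply Rabs_le. lra. }
      apply Rabs_def2 in H. apply Rabs_le_between in Hf. unfold f in Hf.
      assert (l * z <= l * (c + 2)) by (apply Rmult_le_compat_l; lra).
      assert (- (l * (c + 2)) <= l * z).
      { assert (- l * (c + 2) <= l * z) by nra. lra. }
      unfold N. apply Rabs_le. lra.
  - intros z. rewrite Hslope. destruct (Hdefect z) as [K _].
    assert (- N0 <= (W z - f z ^ 2 / 2) / eps).
    { apply Rmult_le_reg_r with eps; auto. unfold Rdiv at 1. rewrite Rmult_assoc, Rinv_l; lra. }
    unfold N. lra.
  - intros z. rewrite Hslope. destruct (Hdefect z) as [_ K].
    replace (l - (W z - f z ^ 2 / 2) / eps) with ((l * eps + - (W z - f z ^ 2 / 2)) / eps) by (field; lra).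
    unfold Rdiv at 1. rewrite Rabs_mult, (Rabs_right (/ eps)).
    2: { apply Rle_ge. left. now apply Rinv_0_lt_compat. }
    apply Rmult_le_compat_r; [left; now apply Rinv_0_lt_compat|].
    eapply Rle_trans; [apply Rabs_triang|]. rewrite Rabs_Ropp.
    rewrite Rabs_right by nra. assert (l * eps <= l) by nra. unfold N. lra.
  - apply Rle_trans with kw; auto. rewrite <- (Rinv_inv kw). apply Rinv_le_contravar; auto.
    unfold N. lra.
  - assert (K := speed0_near l c a k0 Hm H1 h0 h1 Hl IP zc). fold phi F in K.
    assert (K2 := speed0_ge l c a k0 Hm H1 h0 h1 Hl IP zc). fold phi in K2.
    rewrite HAW. fold C3 in Hn.
    assert (Hpz := Rabs_pos (zc - c)).
    assert (Hd : Rabs (phi zc ^ 2 - a ^ 2) <= F * C3 * (2 * a + F) * eps).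
    { replace (phi zc ^ 2 - a ^ 2) with ((phi zc - a) * (phi zc - a + 2 * a)) by ring.
      rewrite Rabs_mult.
      assert (Rabs (phi zc - a) <= F * (C3 * eps)).
      { eapply Rle_trans; [exact K|]. apply Rmult_le_compat_l; lra. }
      assert (Rabs (phi zc - a + 2 * a) <= 2 * a + F).
      { eapply Rle_trans; [apply Rabs_triang|]. rewrite (Rabs_right (2 * a)) by lra.
        assert (Rabs (zc - c) <= 1) by (apply Rabs_le; lra). nra. }
      apply Rle_trans with (F * (C3 * eps) * (2 * a + F)).
      apply Rmult_le_compat; auto; apply Rabs_pos. right; ring. }
    apply Rabs_le_between in HW1, Hd.
    assert (0 < eps * l < eps) by nra.
    apply Rabs_le.
    assert (Hmore : (F * C3 * (2 * a + F) + 2 * C1) * eps <= N * eps).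
    { apply Rmult_le_compat_r; [lra|]. unfold N. lra. }
    assert (HWn : Rabs (2 * (W zc - eps * l) - phi zc ^ 2) <= 2 * C1 * eps).
    { assert (E : phi zc ^ 2 / 2 = l ^ 2 * zc ^ 2 / 2 - g * P0 zc).
      { unfold P0, potential0. fold phi. unfold g. field. lra. }
      assert (KP := HPP zc). apply Rabs_le_between in KP.
      assert (0 < C0 * eps) by (apply Rmult_lt_0_compat; lra).
      assert (- (C0 * eps) <= g * (P zc - P0 zc) <= C0 * eps) by nra.
      unfold W. apply Rabs_le. unfold C1. lra. }
    apply Rabs_le_between in HWn. lra.
  - intros z Hz. fold A.
    assert (HN2 : forall y, 0 <= y -> N0 * (y ^ 2 / eps + y) <= N * (y ^ 2 / eps + y)).
    { intros y Hy. apply Rmult_le_compat_r; [|unfold N; lra].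
      assert (0 <= y ^ 2 / eps).
      { apply Rmult_le_pos; [apply pow2_ge_0|left; now apply Rinv_0_lt_compat]. }
      lra. }
    destruct (Rle_lt_dec zc z) as [H|H].
    + rewrite Rabs_right in Hz by lra.
      specialize (R4 A z HA EA ltac:(lra)). unfold f in R4.
      rewrite (Rabs_right (z - zc)) by lra.
      eapply Rle_trans; [exact R4|]. apply HN2. lra.
    + rewrite Rabs_left in Hz by lra.
      specialize (L4 A (- z) HA). rewrite Ropp_involutive in L4.
      specialize (L4 EA ltac:(lra)). unfold f in L4. rewrite Ropp_involutive in L4.
      rewrite (Rabs_left (z - zc)) by lra.
      replace (A * (- z - - zc) / (2 * eps)) with (- (A * (z - zc) / (2 * eps))) in L4 by (field; lra).
      rewrite tanh_odd in L4.
      replace (- (l * z - h z) - A * - tanh (A * (z - zc) / (2 * eps))) with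
        (- (l * z - h z - A * tanh (A * (z - zc) / (2 * eps)))) in L4 by ring.
      rewrite Rabs_Ropp in L4.
      replace (- z - - zc) with (- (z - zc)) in L4 by ring.
      replace ((z - zc) ^ 2) with ((- (z - zc)) ^ 2) by ring.
      eapply Rle_trans; [exact L4|]. apply HN2. lra.
  - intros z1 m Hz1 Hz2 Hm0 Hd z Hz.
    assert (Hab : forall t, h t - h0 t = - (f t - (l * t - h0 t))) by (intros; unfold f; ring).
    rewrite Hab, Rabs_Ropp. apply (R5 z1); auto.
    + assert (N0 * eps <= N * eps) by (apply Rmult_le_compat_r; unfold N; lra). lra.
    + rewrite <- Rabs_Ropp, <- Hab. exact Hd.
  - intros z1 m Hz1 Hz2 Hm0 Hd z Hz.
    assert (Hab : forall t, h t - h0 t = - f t - (h0 t - l * t)) by (intros; unfold f; ring).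
    assert (E1 : - z1 - - c = c - z1) by ring. assert (E2 : - z - - c = c - z) by ring.
    assert (HNm : N0 * eps <= m).
    { assert (N0 * eps <= N * eps) by (apply Rmult_le_compat_r; unfold N; lra). lra. }
    assert (K := L5 (- z1) m ltac:(lra) ltac:(lra) HNm).
    rewrite Ropp_involutive, <- Hab, E1 in K. specialize (K Hd (- z) ltac:(lra)).
    rewrite Ropp_involutive, <- Hab, E2 in K. exact K.
  - intros z Hz. specialize (Htail z Hz). unfold N. lra.
Qed.
End Solution.

(** * Dependence on the viscosity *)

(** A slowly growing supersolution of all the linear operators
    [g E - eps E'' - (l z - m z) E'] with [|m| <= N] and [eps <= 1]: it allows the
    maximum principle on the whole line for bounded functions. *)
Definition weight (g N z : R) : R := ln (1 + z ^ 2) + (N + 6) / g.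

Section Weight.
Variables (g l N : R).
Hypothesis Hg : 0 < g < 1.
Hypothesis Hl : 0 < l < 1.
Hypothesis HN : 0 < N.

Lemma weight_pos z : 1 < weight g N z.
Proof.
  unfold weight. assert (Hz := pow2_ge_0 z).
  assert (0 <= ln (1 + z ^ 2)) by (rewrite <- ln_1; apply ln_le; lra).
  assert (1 < (N + 6) / g).
  { apply Rmult_lt_reg_r with g; [lra|]. unfold Rdiv. rewrite Rmult_assoc, Rinv_l; lra. }
  lra.
Qed.

Lemma weight_mono y z : Rabs y <= z -> weight g N y <= weight g N z.
Proof.
  intros H. unfold weight. apply Rplus_le_compat_r. apply ln_le.
  - assert (Hz := pow2_ge_0 y). lra.
  - rewrite <- (pow2_abs y). apply Rplus_le_compat_l, pow_incr.
    split; [apply Rabs_pos|auto].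
Qed.

Lemma weight_unbounded K : exists Z0, 0 < Z0 /\ forall Z, Z0 <= Z -> K <= weight g N Z.
Proof. clear l Hl.
  exists (exp K). split; [apply exp_pos|]. intros Z HZ. assert (Hp := exp_pos K).
  assert (0 < (N + 6) / g) by (apply Rdiv_lt_0_compat; lra).
  assert (K <= ln (1 + Z ^ 2)).
  { rewrite <- (ln_exp K) at 1. apply ln_le; auto. nra. }
  unfold weight. lra.
Qed.

Definition weight1 (z : R) : R := 2 * z / (1 + z ^ 2).
Definition weight2 (z : R) : R := 2 * (1 - z ^ 2) / (1 + z ^ 2) ^ 2.

Lemma weight_derive z : is_derive (weight g N) z (weight1 z).
Proof.
  assert (H := pow2_ge_0 z). unfold weight. der. lra. unfold weight1. field. lra.
Qed.
Lemma weight1_derive z : is_derive weight1 z (weight2 z).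
Proof.
  assert (H := pow2_ge_0 z). unfold weight1. der. lra. unfold weight2. field. lra.
Qed.

Lemma weight_super eps z m : 0 < eps <= 1 -> Rabs m <= N ->
  0 < g * weight g N z - eps * weight2 z - (l * z - m) * weight1 z.
Proof.
  intros He Hm. assert (H := pow2_ge_0 z).
  assert (H1 : Rabs (weight1 z) <= 1).
  { assert (A1 := pow2_ge_0 (1 + z)). assert (A2 := pow2_ge_0 (1 - z)).
    unfold weight1. apply Rabs_le. split; apply Rmult_le_reg_r with (1 + z ^ 2); try lra;
      unfold Rdiv; rewrite Rmult_assoc, Rinv_l by lra; lra. }
  assert (H2 : weight2 z <= 2).
  { unfold weight2. set (q := z ^ 2) in *.
    assert (Hq : 0 < (1 + q) ^ 2) by (apply pow_lt; lra).
    apply Rmult_le_reg_r with ((1 + q) ^ 2); auto.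
    unfold Rdiv. rewrite Rmult_assoc, Rinv_l by lra. nra. }
  assert (H3 : l * z * weight1 z <= 2).
  { apply Rle_trans with (z * weight1 z).
    - assert (0 <= z * weight1 z).
      { replace (z * weight1 z) with (2 * z ^ 2 / (1 + z ^ 2)) by (unfold weight1; field; lra).
        apply Rmult_le_pos; [lra|left; apply Rinv_0_lt_compat; lra]. }
      rewrite Rmult_assoc. nra.
    - unfold weight1. apply Rmult_le_reg_r with (1 + z ^ 2); [lra|].
      replace (z * (2 * z / (1 + z ^ 2)) * (1 + z ^ 2)) with (2 * z ^ 2) by (field; lra). lra. }
  assert (H4 : - (N * 1) <= m * weight1 z).
  { assert (Hmw : Rabs (m * weight1 z) <= N * 1).
    { rewrite Rabs_mult. apply Rmult_le_compat; try apply Rabs_pos; auto. }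
    apply Rabs_le_between in Hmw. lra. }
  assert (H5 : N + 6 <= g * weight g N z).
  { unfold weight. rewrite Rmult_plus_distr_l.
    replace (g * ((N + 6) / g)) with (N + 6) by (field; lra).
    assert (0 <= ln (1 + z ^ 2)) by (rewrite <- ln_1; apply ln_le; lra).
    assert (0 <= g * ln (1 + z ^ 2)) by (apply Rmult_le_pos; lra). lra. }
  assert (eps * weight2 z <= 2) by nra. lra.
Qed.

(** Maximum principle on a large interval: a bound [M] at its ends is felt only
    through [M weight z / weight Z], which is small when [Z] is large. *)
Lemma growth_max_principle eps Z M S (E E1 E2 m : R -> R) :
  0 < eps <= 1 -> 0 < Z -> 0 <= M -> 0 <= S ->
  (forall z, is_derive E z (E1 z)) -> (forall z, is_derive E1 z (E2 z)) ->
  (forall z, Rabs (m z) <= N) -> E (- Z) <= M -> E Z <= M ->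
  (forall z, Rabs z <= Z -> g * E z <= eps * E2 z + (l * z - m z) * E1 z + S) ->
  forall z, Rabs z <= Z -> E z <= S / g + M * weight g N z / weight g N Z.
Proof.
  intros He HZ HM HS D1 D2 Hm Ha Hb Heq z Hz.
  assert (HwZ := weight_pos Z).
  set (k := M / weight g N Z).
  assert (Hk : 0 <= k).
  { apply Rmult_le_pos; auto. left. apply Rinv_0_lt_compat. lra. }
  assert (HSg : 0 <= S / g) by (apply Rmult_le_pos; [lra|left; apply Rinv_0_lt_compat; lra]).
  assert (EkZ : k * weight g N Z = M) by (unfold k; field; lra).
  replace (M * weight g N z / weight g N Z) with (k * weight g N z) by (unfold k; field; lra).
  cut (E z - (S / g + k * weight g N z) <= 0); [lra|].
  apply (max_principle2 (fun z => E z - (S / g + k * weight g N z))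
    (fun z => E1 z - k * weight1 z) (fun z => E2 z - k * weight2 z) (- Z) Z); try lra.
  - intros t _. assert (D3 := weight_derive t). der. ring.
  - intros t _. assert (D3 := weight1_derive t). der. ring.
  - replace (weight g N (- Z)) with (weight g N Z) by (unfold weight; f_equal; f_equal; ring). lra.
  - intros x Hx Hpos Hcrit.
    specialize (Heq x ltac:(apply Rabs_le; lra)).
    assert (Hw := weight_super eps x (m x) He (Hm x)).
    assert (EE1 : E1 x = k * weight1 x) by lra. rewrite EE1 in Heq.
    assert (0 <= k * (g * weight g N x - eps * weight2 x - (l * x - m x) * weight1 x))
      by (apply Rmult_le_pos; lra).
    assert (0 < g * (E x - (S / g + k * weight g N x))) by (apply Rmult_lt_0_compat; lra).
    replace (g * (E x - (S / g + k * weight g N x))) with (g * E x - S - k * (g * weight g N x)) in *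
      by (field; lra).
    apply Rmult_lt_reg_l with eps; lra.
  - apply Rabs_le_between. exact Hz.
Qed.

Lemma growth_max_principle_abs eps Z M S (E E1 E2 m : R -> R) :
  0 < eps <= 1 -> 0 < Z -> 0 <= M -> 0 <= S ->
  (forall z, is_derive E z (E1 z)) -> (forall z, is_derive E1 z (E2 z)) ->
  (forall z, Rabs (m z) <= N) -> Rabs (E (- Z)) <= M -> Rabs (E Z) <= M ->
  (forall z, Rabs z <= Z -> Rabs (g * E z - (eps * E2 z + (l * z - m z) * E1 z)) <= S) ->
  forall z, Rabs z <= Z -> Rabs (E z) <= S / g + M * weight g N z / weight g N Z.
Proof.
  intros He HZ HM HS D1 D2 Hm Ha Hb Heq z Hz.
  apply Rabs_le_between in Ha, Hb.
  assert (K1 := growth_max_principle eps Z M S E E1 E2 m He HZ HM HS D1 D2 Hm ltac:(lra) ltac:(lra)).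
  assert (K2 := growth_max_principle eps Z M S (fun z => - E z) (fun z => - E1 z)
    (fun z => - E2 z) m He HZ HM HS (fun t => der_opp _ _ _ (D1 t)) (fun t => der_opp _ _ _ (D2 t))
    Hm ltac:(lra) ltac:(lra)).
  apply Rabs_le. split.
  - cut (- E z <= S / g + M * weight g N z / weight g N Z); [lra|]. apply K2; auto.
    intros t Ht. specialize (Heq t Ht). apply Rabs_le_between in Heq. lra.
  - apply K1; auto. intros t Ht. specialize (Heq t Ht). apply Rabs_le_between in Heq. lra.
Qed.

Lemma weight_ratio_small M z e : 0 <= M -> 0 < e ->
  exists Z0, 0 < Z0 /\ forall Z, Z0 <= Z -> M * weight g N z / weight g N Z <= e.
Proof. clear l Hl.
  intros HM He. destruct (weight_unbounded (M * weight g N z / e)) as [Z0 [HZ0 H]].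
  exists Z0. split; auto. intros Z HZ. specialize (H Z HZ). assert (Hw := weight_pos Z).
  apply Rmult_le_reg_r with (weight g N Z); [lra|].
  replace (M * weight g N z / weight g N Z * weight g N Z) with (M * weight g N z / e * e)
    by (field; lra).
  rewrite (Rmult_comm e). apply Rmult_le_compat_r; lra.
Qed.
End Weight.

(** [Q e1 e2] has a limit when the distinct [e1], [e2] tend to [e]; for a slope, this
    is strict differentiability. *)
Definition pair_limit (Q : R -> R -> R) (e L : R) : Prop :=
  forall eta, 0 < eta -> exists rho, 0 < rho /\ forall e1 e2, e1 <> e2 ->
    Rabs (e1 - e) < rho -> Rabs (e2 - e) < rho -> Rabs (Q e1 e2 - L) <= eta.

Lemma pair_limit_of_cauchy (Q : R -> R -> R) (e : R) :
  (forall eta, 0 < eta -> exists rho, 0 < rho /\ forall e1 e2 e3 e4, e1 <> e2 -> e3 <> e4 ->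
    Rabs (e1 - e) < rho -> Rabs (e2 - e) < rho -> Rabs (e3 - e) < rho -> Rabs (e4 - e) < rho ->
    Rabs (Q e1 e2 - Q e3 e4) <= eta) ->
  exists L, pair_limit Q e L.
Proof.
  intros H.
  assert (Hsm : forall rho, 0 < rho -> exists n0, forall n, (n0 <= n)%nat -> / (INR n + 1) < rho).
  { intros rho Hr. destruct (INR_unbounded (/ rho)) as [n0 Hn0]. exists n0. intros n Hn.
    apply le_INR in Hn. rewrite <- (Rinv_inv rho). apply Rinv_lt_contravar.
    - apply Rmult_lt_0_compat; [now apply Rinv_0_lt_compat|]. assert (Hp := pos_INR n). lra.
    - lra. }
  assert (Hpos : forall n, 0 < / (INR n + 1)).
  { intros n. apply Rinv_0_lt_compat. assert (Hp := pos_INR n). lra. }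
  set (u := fun n => Q (e + / (INR n + 1)) e).
  assert (Hin : forall n rho, / (INR n + 1) < rho -> Rabs (e + / (INR n + 1) - e) < rho).
  { intros n rho Hr. specialize (Hpos n). rewrite Rabs_right; lra. }
  destruct (lim_seq_of_cauchy u) as [L HL].
  - intros eta He. destruct (H (eta / 2)) as [rho [Hr Hrho]]; [lra|].
    destruct (Hsm rho Hr) as [n0 Hn0]. exists n0. intros n m Hn Hm.
    apply Rle_lt_trans with (eta / 2); [|lra].
    assert (P1 := Hpos n). assert (P2 := Hpos m).
    apply Hrho; try (rewrite Rminus_diag, Rabs_R0; lra); try lra; apply Hin; auto.
  - exists L. intros eta He. destruct (H (eta / 2)) as [rho [Hr Hrho]]; [lra|].
    exists rho. split; auto. intros e1 e2 Hne H1 H2.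
    destruct (Hsm rho Hr) as [n0 Hn0].
    destruct (proj1 (is_lim_seq_ed u L) HL (eta / 2)) as [n1 Hn1]; [lra|].
    set (n := (n0 + n1)%nat). specialize (Hn0 n ltac:(unfold n; lia)).
    specialize (Hn1 n ltac:(unfold n; lia)). assert (P1 := Hpos n).
    assert (K : Rabs (Q e1 e2 - u n) <= eta / 2).
    { apply Hrho; auto; try lra. rewrite Rminus_diag, Rabs_R0; lra. }
    apply Rabs_le_between in K. apply Rabs_def2 in Hn1. apply Rabs_le. lra.
Qed.

Lemma pair_limit_derive (f : R -> R) e L :
  pair_limit (fun x y => (f x - f y) / (x - y)) e L -> is_derive f e L.
Proof.
  intros H. apply is_derive_ed. intros eta He. destruct (H eta He) as [rho [Hr Hrho]].
  exists rho. split; auto. intros y Hy.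
  destruct (Req_dec y e) as [->|Hne].
  { rewrite !Rminus_diag, Rmult_0_r, Rminus_diag, Rabs_R0. lra. }
  specialize (Hrho y e Hne Hy ltac:(rewrite Rminus_diag, Rabs_R0; lra)).
  replace (f y - f e - L * (y - e)) with (((f y - f e) / (y - e) - L) * (y - e)) by (field; lra).
  rewrite Rabs_mult. apply Rmult_le_compat_r; [apply Rabs_pos|auto].
Qed.

Lemma pair_limit_C1 (f L : R -> R) (e1 : R) :
  (forall e, 0 < e < e1 -> pair_limit (fun x y => (f x - f y) / (x - y)) e (L e)) ->
  C1_on (fun e => 0 < e < e1) f /\ forall e, 0 < e < e1 -> Derive f e = L e.
Proof.
  intros H.
  assert (HD : forall e, 0 < e < e1 -> Derive f e = L e).
  { intros e He. apply is_derive_unique, pair_limit_derive, H, He. }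
  split; auto. intros e He. split.
  - exists (L e). now apply pair_limit_derive, H.
  - apply continuous_ed. intros eta Heta.
    destruct (H e He (eta / 3)) as [rho [Hr Hrho]]; [lra|].
    exists (Rmin (rho / 2) (Rmin e (e1 - e))).
    split; [repeat apply Rmin_glb_lt; lra|]. intros y Hy.
    assert (Hy1 : Rabs (y - e) < rho / 2) by (eapply Rlt_le_trans; [exact Hy|apply Rmin_l]).
    assert (Hy2 : Rabs (y - e) < Rmin e (e1 - e)) by (eapply Rlt_le_trans; [exact Hy|apply Rmin_r]).
    assert (Hy3 : Rabs (y - e) < e) by (eapply Rlt_le_trans; [exact Hy2|apply Rmin_l]).
    assert (Hy4 : Rabs (y - e) < e1 - e) by (eapply Rlt_le_trans; [exact Hy2|apply Rmin_r]).
    apply Rabs_def2 in Hy1, Hy3, Hy4.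
    assert (Hyin : 0 < y < e1) by lra.
    rewrite !HD by auto.
    destruct (H y Hyin (eta / 3)) as [rho' [Hr' Hrho']]; [lra|].
    set (d := Rmin (rho / 2) rho').
    assert (Hd : 0 < d /\ d <= rho / 2 /\ d <= rho').
    { unfold d. split; [apply Rmin_glb_lt; lra|]. split; [apply Rmin_l|apply Rmin_r]. }
    set (x := y + d / 2).
    assert (K1 := Hrho x y ltac:(unfold x; lra) ltac:(apply Rabs_def1; unfold x; lra)
      ltac:(apply Rabs_def1; lra)).
    assert (K2 := Hrho' x y ltac:(unfold x; lra) ltac:(apply Rabs_def1; unfold x; lra)
      ltac:(rewrite Rminus_diag, Rabs_R0; lra)).
    apply Rabs_le_between in K1, K2. apply Rabs_def1; lra.
Qed.

Section Family.
Variables (l c a M0 N e1 : R) (h0 P0 : R -> R) (P h : R -> R -> R) (zc : R -> R).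
Let g := 2 * l - 1.
Hypothesis Hl : / 2 < l < 1.
Hypothesis HM0 : 0 < M0.
Hypothesis HN : 0 < N.
Hypothesis He1 : 0 < e1 <= 1.
Hypothesis HP : forall e, 0 < e < e1 -> viscous_potential g l e (fun _ => True) (P e) (h e).
Hypothesis HPP : forall e, 0 < e < e1 -> forall z, Rabs (P e z - P0 z) <= M0.
Hypothesis HS : forall e, 0 < e < e1 -> solution_facts l c a h0 N e (P e) (h e) (zc e).

Let Hg : 0 < g < 1.
Proof. unfold g. lra. Qed.

Let s e z := slope_of l e z (P e z) (h e z).
Let s1 e z := - ((1 - l) * h e z + (l * z - h e z) * s e z) / e.
Let s2 e z := - (s e z - s e z ^ 2 + (l * z - h e z) * s1 e z) / e.

Lemma P_der e z : 0 < e < e1 -> is_derive (P e) z (h e z).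
Proof. intros He. apply (HP e He z I). Qed.
Lemma h_der e z : 0 < e < e1 -> is_derive (h e) z (s e z).
Proof. intros He. apply (HP e He z I). Qed.
Lemma s_der e z : 0 < e < e1 -> is_derive (s e) z (s1 e z).
Proof.
  intros He. assert (D1 := P_der e z He). assert (D2 := h_der e z He).
  unfold s, slope_of. der. unfold s1, s, slope_of. fold g. unfold g. field. lra.
Qed.
Lemma s1_der e z : 0 < e < e1 -> is_derive (s1 e) z (s2 e z).
Proof.
  intros He. assert (D1 := h_der e z He). assert (D2 := s_der e z He).
  unfold s1. der. unfold s2, s1. field. lra.
Qed.

Lemma h_bound e z : 0 < e < e1 -> Rabs (h e z) <= N.
Proof. intros He. apply (sf_h (HS e He)). Qed.
Lemma s_bound e z : 0 < e < e1 -> Rabs (s e z) <= N / e.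
Proof. intros He. apply (sf_h1 (HS e He)). Qed.
Lemma s_up e z : 0 < e < e1 -> s e z <= N.
Proof. intros He. apply (sf_h1_up (HS e He)). Qed.

(** A difference quotient in the viscosity, at fixed [z]. Those of [P], [P'] and [P'']
    satisfy an exact linear equation, because the nonlinearity is quadratic. *)
Definition quot (u : R -> R -> R) (e e' z : R) : R := (u e z - u e' z) / (e - e').

Lemma quot_der (u du : R -> R -> R) e e' z : e <> e' ->
  is_derive (u e) z (du e z) -> is_derive (u e') z (du e' z) ->
  is_derive (quot u e e') z (quot du e e' z).
Proof. intros Hne D1 D2. unfold quot. der. reflexivity. Qed.

Lemma quot_eq e e' z : 0 < e < e1 -> 0 < e' < e1 -> e <> e' ->
  g * quot P e e' z =
  e * quot s e e' z + (l * z - (h e z + h e' z) / 2) * quot h e e' z + s e' z.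
Proof.
  intros He He' Hne. unfold quot, s, slope_of. fold g. field. repeat split; lra.
Qed.

Lemma quot_bound e e' z : 0 < e < e1 -> 0 < e' < e1 -> e <> e' ->
  Rabs (quot P e e' z) <= N / e' / g.
Proof.
  intros He He' Hne. apply le_epsilon. intros eta Heta.
  set (M := 2 * M0 / Rabs (e - e')).
  assert (Hab : 0 < Rabs (e - e')) by (apply Rabs_pos_lt; lra).
  assert (HM : 0 < M) by (apply Rdiv_lt_0_compat; lra).
  assert (HNe : 0 < N / e') by (apply Rdiv_lt_0_compat; lra).
  assert (Hb : forall y, Rabs (quot P e e' y) <= M).
  { intros y. unfold quot, Rdiv, M. rewrite Rabs_mult, Rabs_inv.
    apply Rmult_le_compat_r; [left; now apply Rinv_0_lt_compat|].
    assert (K1 := HPP e He y). assert (K2 := HPP e' He' y).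
    apply Rabs_le_between in K1, K2. apply Rabs_le. lra. }
  destruct (weight_ratio_small g N Hg HN M z eta) as [Z0 [HZ0 HZ]]; try lra.
  set (Z := Rmax Z0 (Rabs z)).
  assert (HZZ : Z0 <= Z /\ Rabs z <= Z) by (split; [apply Rmax_l|apply Rmax_r]).
  specialize (HZ Z ltac:(lra)).
  assert (K := growth_max_principle_abs g l N Hg ltac:(lra) HN e Z M (N / e')
    (quot P e e') (quot h e e') (quot s e e') (fun z => (h e z + h e' z) / 2)).
  eapply Rle_trans; [apply K; try lra; auto|].
  - intros y. apply quot_der; auto; apply P_der; auto.
  - intros y. apply quot_der; auto; apply h_der; auto.
  - intros y. assert (K1 := h_bound e y He). assert (K2 := h_bound e' y He').
    apply Rabs_le_between in K1, K2. apply Rabs_le. lra.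
  - intros y _. rewrite quot_eq by auto.
    replace (e * quot s e e' y + (l * y - (h e y + h e' y) / 2) * quot h e e' y + s e' y -
      (e * quot s e e' y + (l * y - (h e y + h e' y) / 2) * quot h e e' y)) with (s e' y) by ring.
    now apply s_bound.
  - lra.
Qed.

Definition close (e rho x : R) : Prop := Rabs (x - e) < rho.

(** Near a given viscosity [e], on a bounded set of [z], the quotients are bounded with
    two derivatives, hence they solve the equation linearized at [e] up to an error
    that is proportional to the distance of the viscosities to [e]. *)
Lemma quot_local e Z : 0 < e < e1 -> 0 < Z -> exists C rho0, 0 < C /\ 0 < rho0 /\
  (forall x, close e rho0 x -> 0 < x < e1 /\ e / 2 < x) /\
  (forall x y, x <> y -> close e rho0 x -> close e rho0 y -> forall z, Rabs z <= Z ->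
    Rabs (quot h x y z) <= C /\ Rabs (quot s x y z) <= C) /\
  (forall x y rho, x <> y -> close e rho0 x -> close e rho0 y -> close e rho x -> close e rho y ->
    forall z, Rabs z <= Z ->
    Rabs (g * quot P x y z - e * quot s x y z - (l * z - h e z) * quot h x y z - s e z) <= C * rho).
Proof.
  intros He HZ.
  set (rho0 := Rmin (e / 2) (e1 - e)).
  assert (Hrho : 0 < rho0 /\ rho0 <= e / 2 /\ rho0 <= e1 - e).
  { unfold rho0. split; [apply Rmin_glb_lt; lra|]. split; [apply Rmin_l|apply Rmin_r]. }
  assert (Hin : forall x, close e rho0 x -> 0 < x < e1 /\ e / 2 < x).
  { intros x Hx. apply Rabs_def2 in Hx. lra. }
  set (bb := l * (Z + 1) + N). set (Md := 2 * N / e / g). set (A := 2 * bb / e).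
  set (B := (g * Md + 2 * N / e) * 2 / e).
  assert (HlZ : 0 < l * (Z + 1)) by (apply Rmult_lt_0_compat; lra).
  assert (Hbb : 0 < bb) by (unfold bb; lra).
  assert (H2N : 0 < 2 * N / e) by (apply Rdiv_lt_0_compat; lra).
  assert (HMd : 0 < Md) by (apply Rdiv_lt_0_compat; lra).
  assert (HA : 0 < A) by (apply Rdiv_lt_0_compat; lra).
  assert (HB : 0 < B).
  { apply Rdiv_lt_0_compat; [|lra]. assert (0 < g * Md) by (apply Rmult_lt_0_compat; lra). lra. }
  set (C1 := (2 * Md / 1 + B * 1) * exp (A * 1)). set (C2 := A * C1 + B).
  assert (HC1 : 0 < C1).
  { apply Rmult_lt_0_compat; [lra|apply exp_pos]. }
  assert (HC2 : 0 < C2).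
  { assert (0 < A * C1) by (apply Rmult_lt_0_compat; lra). unfold C2. lra. }
  assert (Hinv : forall x, e / 2 < x -> / x < 2 / e).
  { intros x Hx. replace (2 / e) with (/ (e / 2)) by (field; lra).
    apply Rinv_lt_contravar; auto. apply Rmult_lt_0_compat; lra. }
  assert (HD : forall x y, x <> y -> close e rho0 x -> close e rho0 y -> forall z,
    Rabs (quot P x y z) <= Md).
  { intros x y Hxy Hx Hy z. destruct (Hin x Hx) as [Hx1 Hx2]. destruct (Hin y Hy) as [Hy1 Hy2].
    eapply Rle_trans; [apply quot_bound; auto|].
    unfold Md, Rdiv. apply Rmult_le_compat_r; [left; apply Rinv_0_lt_compat; lra|].
    specialize (Hinv y Hy2). unfold Rdiv in Hinv.
    replace (2 * N * / e) with (N * (2 * / e)) by ring. apply Rmult_le_compat_l; lra. }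
  assert (HD2 : forall x y, x <> y -> close e rho0 x -> close e rho0 y -> forall z, Rabs z <= Z + 1 ->
    Rabs (quot s x y z) <= A * Rabs (quot h x y z) + B).
  { intros x y Hxy Hx Hy z Hz. destruct (Hin x Hx) as [Hx1 Hx2]. destruct (Hin y Hy) as [Hy1 Hy2].
    assert (E := quot_eq x y z Hx1 Hy1 Hxy).
    assert (E2 : quot s x y z = (g * quot P x y z - (l * z - (h x z + h y z) / 2) * quot h x y z - s y z) * / x).
    { rewrite E. field. lra. }
    assert (Hb1 : Rabs (l * z - (h x z + h y z) / 2) <= bb).
    { assert (K1 := h_bound x z Hx1). assert (K2 := h_bound y z Hy1).
      apply Rabs_le_between in K1, K2, Hz.
      assert (l * z <= l * (Z + 1)) by (apply Rmult_le_compat_l; lra).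
      assert (l * - (Z + 1) <= l * z) by (apply Rmult_le_compat_l; lra).
      unfold bb. apply Rabs_le. lra. }
    assert (Hs : Rabs (s y z) <= 2 * N / e).
    { eapply Rle_trans; [now apply s_bound|]. specialize (Hinv y Hy2).
      replace (2 * N / e) with (N * (2 / e)) by (field; lra). unfold Rdiv at 1.
      apply Rmult_le_compat_l; lra. }
    assert (Hp := HD x y Hxy Hx Hy z).
    rewrite E2, Rabs_mult.
    assert (Hix : 0 < / x) by (apply Rinv_0_lt_compat; lra).
    rewrite (Rabs_right (/ x)) by lra.
    specialize (Hinv x Hx2).
    assert (Hnum : Rabs (g * quot P x y z - (l * z - (h x z + h y z) / 2) * quot h x y z - s y z)
       <= g * Md + bb * Rabs (quot h x y z) + 2 * N / e).
    { eapply Rle_trans; [apply Rabs_triang|]. rewrite Rabs_Ropp. apply Rplus_le_compat; auto.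
      eapply Rle_trans; [apply Rabs_triang|]. rewrite Rabs_Ropp, !Rabs_mult, (Rabs_right g) by lra.
      apply Rplus_le_compat. apply Rmult_le_compat_l; lra.
      apply Rmult_le_compat_r; [apply Rabs_pos|auto]. }
    apply Rle_trans with ((g * Md + bb * Rabs (quot h x y z) + 2 * N / e) * (2 / e)).
    - apply Rmult_le_compat; auto; try lra. apply Rabs_pos.
    - right. unfold A, B. field. lra. }
  assert (HD1 : forall x y, x <> y -> close e rho0 x -> close e rho0 y -> forall z, Rabs z <= Z ->
    Rabs (quot h x y z) <= C1).
  { intros x y Hxy Hx Hy z Hz. destruct (Hin x Hx) as [Hx1 Hx2]. destruct (Hin y Hy) as [Hy1 Hy2].
    apply (interior_gradient (quot P x y) (quot h x y) (quot s x y) Md A B z 1); try lra.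
    - intros t _. apply quot_der; auto; apply P_der; auto.
    - intros t _. apply quot_der; auto; apply h_der; auto.
    - intros t _. apply HD; auto.
    - intros t Ht. apply HD2; auto. apply Rabs_le_between in Hz. apply Rabs_le. lra. }
  assert (HD2' : forall x y, x <> y -> close e rho0 x -> close e rho0 y -> forall z, Rabs z <= Z ->
    Rabs (quot s x y z) <= C2).
  { intros x y Hxy Hx Hy z Hz. eapply Rle_trans; [apply HD2; auto; lra|].
    unfold C2. apply Rplus_le_compat_r, Rmult_le_compat_l; [lra|]. apply HD1; auto. }
  assert (Hself : close e rho0 e) by (unfold close; rewrite Rminus_diag, Rabs_R0; lra).
  assert (Hdiff : forall (u : R -> R -> R) C', 0 < C' -> (forall x y, x <> y -> close e rho0 x -> close e rho0 y ->
     forall z, Rabs z <= Z -> Rabs (quot u x y z) <= C') ->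
     forall x rho, close e rho0 x -> close e rho x -> forall z, Rabs z <= Z ->
     Rabs (u x z - u e z) <= C' * rho).
  { intros u C' HC' Hu x rho Hx Hxr z Hz. destruct (Req_dec x e) as [->|Hne].
    - rewrite !Rminus_diag, Rabs_R0. apply Rmult_le_pos; [lra|].
      left. eapply Rle_lt_trans; [apply Rabs_pos|exact Hxr].
    - specialize (Hu x e Hne Hx Hself z Hz). unfold close in Hxr.
      replace (u x z - u e z) with (quot u x e z * (x - e)) by (unfold quot; field; lra).
      rewrite Rabs_mult. apply Rmult_le_compat; try apply Rabs_pos; lra. }
  set (C := C1 + C2 + (C2 + C1 * C1 + C2)).
  assert (HC : 0 < C1 * C1) by (apply Rmult_lt_0_compat; lra).
  exists C, rho0. split; [unfold C; lra|]. split; [lra|]. split; [exact Hin|]. split.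
  - intros x y Hxy Hx Hy z Hz. specialize (HD1 x y Hxy Hx Hy z Hz).
    specialize (HD2' x y Hxy Hx Hy z Hz). unfold C. lra.
  - intros x y rho Hxy Hx Hy Hxr Hyr z Hz.
    destruct (Hin x Hx) as [Hx1 Hx2]. destruct (Hin y Hy) as [Hy1 Hy2].
    assert (Hr : 0 < rho) by (eapply Rle_lt_trans; [apply Rabs_pos|exact Hxr]).
    rewrite quot_eq by auto.
    replace (x * quot s x y z + (l * z - (h x z + h y z) / 2) * quot h x y z + s y z
       - e * quot s x y z - (l * z - h e z) * quot h x y z - s e z)
     with ((x - e) * quot s x y z + (- ((h x z - h e z) + (h y z - h e z)) / 2) * quot h x y z
       + (s y z - s e z)) by field.
    assert (K1 := Hdiff h C1 HC1 HD1 x rho Hx Hxr z Hz).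
    assert (K2 := Hdiff h C1 HC1 HD1 y rho Hy Hyr z Hz).
    assert (K3 := Hdiff s C2 HC2 HD2' y rho Hy Hyr z Hz).
    assert (K4 := HD1 x y Hxy Hx Hy z Hz). assert (K5 := HD2' x y Hxy Hx Hy z Hz).
    eapply Rle_trans; [apply Rabs_triang|].
    apply Rle_trans with ((rho * C2 + (C1 * rho) * C1) + C2 * rho).
    + apply Rplus_le_compat; auto.
      eapply Rle_trans; [apply Rabs_triang|]. rewrite !Rabs_mult.
      unfold close in Hxr.
      apply Rplus_le_compat; apply Rmult_le_compat; try apply Rabs_pos; auto; try lra.
      apply Rabs_le_between in K1, K2. apply Rabs_le. lra.
    + unfold C. nra.
Qed.

(** Two quotients solve the same linearized equation up to small residuals, and they
    are bounded on the line. By the maximum principle on a large interval they differ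
    little, and then so do their derivatives in [z]. *)
Lemma quot_cauchy e z eta : 0 < e < e1 -> 0 < eta -> exists rho, 0 < rho /\
  forall x y x' y', x <> y -> x' <> y' ->
    close e rho x -> close e rho y -> close e rho x' -> close e rho y' ->
    Rabs (quot P x y z - quot P x' y' z) <= eta /\
    Rabs (quot h x y z - quot h x' y' z) <= eta.
Proof.
  intros He Heta.
  set (Z1 := Rabs z + 1).
  assert (HZ1 : 0 < Z1) by (unfold Z1; assert (Hp := Rabs_pos z); lra).
  set (bb := l * Z1 + N). set (A := bb / e).
  assert (Hbb : 0 < bb) by (assert (0 < l * Z1) by (apply Rmult_lt_0_compat; lra); unfold bb; lra).
  assert (HA : 0 < A) by (apply Rdiv_lt_0_compat; lra).
  (* [K] is the constant of the interior gradient bound on [[z, z + 1]] *)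
  set (K := (2 / 1 + (g + 1) / e * 1) * exp (A * 1)).
  assert (HK0 : 0 < (g + 1) / e) by (apply Rdiv_lt_0_compat; lra).
  assert (HK : 0 < K) by (apply Rmult_lt_0_compat; [lra|apply exp_pos]).
  set (eta' := Rmin eta (eta / K)).
  assert (HeK : 0 < eta / K) by (apply Rdiv_lt_0_compat; lra).
  assert (Heta' : 0 < eta' /\ eta' <= eta /\ eta' <= eta / K).
  { unfold eta'. split; [apply Rmin_glb_lt; lra|]. split; [apply Rmin_l|apply Rmin_r]. }
  set (Md := 2 * (2 * N / e / g)).
  assert (HMd : 0 < Md).
  { unfold Md. assert (0 < 2 * N / e / g); [|lra].
    apply Rdiv_lt_0_compat; [|lra]. apply Rdiv_lt_0_compat; lra. }
  destruct (weight_ratio_small g N Hg HN Md Z1 (eta' / 2)) as [Z0 [HZ0 HZ]]; try lra.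
  set (Z := Rmax Z0 Z1).
  assert (HZZ : Z0 <= Z /\ Z1 <= Z) by (split; [apply Rmax_l|apply Rmax_r]).
  specialize (HZ Z ltac:(lra)).
  destruct (quot_local e Z He ltac:(lra)) as [C [rho0 [HC [Hrho0 [Hin [_ Hres]]]]]].
  set (rho := Rmin rho0 (g * eta' / (4 * C))).
  assert (Hge : 0 < g * eta') by (apply Rmult_lt_0_compat; lra).
  assert (Hgc : 0 < g * eta' / (4 * C)) by (apply Rdiv_lt_0_compat; lra).
  assert (Hrho : 0 < rho /\ rho <= rho0 /\ rho <= g * eta' / (4 * C)).
  { unfold rho. split; [apply Rmin_glb_lt; lra|]. split; [apply Rmin_l|apply Rmin_r]. }
  assert (HCr : 2 * (C * rho) <= g * (eta' / 2)).
  { assert (C * rho <= C * (g * eta' / (4 * C))) by (apply Rmult_le_compat_l; lra).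
    replace (C * (g * eta' / (4 * C))) with (g * eta' / 4) in H by (field; lra). lra. }
  exists rho. split; [lra|]. intros x y x' y' Hxy Hxy' Hx Hy Hx' Hy'.
  assert (W : forall t, close e rho t -> close e rho0 t) by (unfold close; intros; lra).
  set (E := fun t => quot P x y t - quot P x' y' t).
  set (E1 := fun t => quot h x y t - quot h x' y' t).
  set (E2 := fun t => quot s x y t - quot s x' y' t).
  assert (D1 : forall t, is_derive E t (E1 t)).
  { intros t. apply der_minus; apply quot_der; auto; apply P_der; apply Hin; auto. }
  assert (D2 : forall t, is_derive E1 t (E2 t)).
  { intros t. apply der_minus; apply quot_der; auto; apply h_der; apply Hin; auto. }
  assert (Hr : forall t, Rabs t <= Z -> Rabs (g * E t - (e * E2 t + (l * t - h e t) * E1 t)) <= 2 * (C * rho)).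
  { intros t Ht.
    assert (R1 := Hres x y rho Hxy (W _ Hx) (W _ Hy) Hx Hy t Ht).
    assert (R2 := Hres x' y' rho Hxy' (W _ Hx') (W _ Hy') Hx' Hy' t Ht).
    apply Rabs_le_between in R1, R2. unfold E, E1, E2. apply Rabs_le. lra. }
  assert (Hb : forall t, Rabs (E t) <= Md).
  { intros t.
    assert (Hq : forall u v, u <> v -> close e rho u -> close e rho v -> Rabs (quot P u v t) <= 2 * N / e / g).
    { intros u v Huv Hu Hv. destruct (Hin u (W _ Hu)) as [Hu1 Hu2]. destruct (Hin v (W _ Hv)) as [Hv1 Hv2].
      eapply Rle_trans; [apply quot_bound; auto|]. unfold Rdiv.
      apply Rmult_le_compat_r; [left; apply Rinv_0_lt_compat; lra|].
      replace (2 * N * / e) with (N * / (e / 2)) by (field; lra).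
      apply Rmult_le_compat_l; [lra|]. apply Rinv_le_contravar; lra. }
    assert (Q1 := Hq x y Hxy Hx Hy). assert (Q2 := Hq x' y' Hxy' Hx' Hy').
    apply Rabs_le_between in Q1, Q2. unfold E, Md. apply Rabs_le. lra. }
  assert (HE : forall t, Rabs t <= Z1 -> Rabs (E t) <= eta').
  { intros t Ht.
    assert (G := growth_max_principle_abs g l N Hg ltac:(lra) HN e Z Md (2 * (C * rho)) E E1 E2 (h e)
      ltac:(lra) ltac:(lra) ltac:(lra)).
    assert (HCr0 : 0 < C * rho) by (apply Rmult_lt_0_compat; lra).
    eapply Rle_trans; [apply G; auto; try lra|].
    - intros u; now apply h_bound.
    - assert (Hw := weight_mono g N t Z1 Ht).
      assert (HwZ := weight_pos g N Hg HN Z).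
      assert (Md * weight g N t / weight g N Z <= Md * weight g N Z1 / weight g N Z).
      { unfold Rdiv. apply Rmult_le_compat_r; [left; apply Rinv_0_lt_compat; lra|].
        apply Rmult_le_compat_l; lra. }
      assert (2 * (C * rho) / g <= eta' / 2).
      { apply Rmult_le_reg_r with g; [lra|]. unfold Rdiv. rewrite (Rmult_assoc _ (/ g)), Rinv_l by lra. lra. }
      lra. }
  split.
  - apply Rle_trans with eta'; [|lra]. apply HE. unfold Z1. lra.
  - apply Rle_trans with (K * eta').
    + replace (K * eta') with ((2 * eta' / 1 + ((g + 1) / e * eta') * 1) * exp (A * 1)) by (unfold K; field; lra).
      apply (interior_gradient E E1 E2 eta' A ((g + 1) / e * eta') z 1); try lra; auto.
      * apply Rmult_le_pos; lra.
      * intros t Ht. apply HE. unfold Z1. assert (Hz := Rle_abs z). assert (Hz' := Rle_abs (- z)).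
        rewrite Rabs_Ropp in Hz'. apply Rabs_le. lra.
      * intros t Ht.
        assert (HtZ : Rabs t <= Z1).
        { unfold Z1. assert (Hz := Rle_abs z). assert (Hz' := Rle_abs (- z)).
          rewrite Rabs_Ropp in Hz'. apply Rabs_le. lra. }
        assert (R1 := Hr t ltac:(lra)). assert (R2 := HE t HtZ).
        assert (Hb1 : Rabs (l * t - h e t) <= bb).
        { eapply Rle_trans; [apply Rabs_triang|]. rewrite Rabs_Ropp, Rabs_mult, (Rabs_right l) by lra.
          unfold bb. apply Rplus_le_compat; [apply Rmult_le_compat_l; lra|now apply h_bound]. }
        set (r := g * E t - (e * E2 t + (l * t - h e t) * E1 t)) in *.
        replace (E2 t) with ((g * E t + - ((l * t - h e t) * E1 t) + - r) * / e) by (unfold r; field; lra).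
        assert (Hie : 0 < / e) by (apply Rinv_0_lt_compat; lra).
        rewrite Rabs_mult, (Rabs_right (/ e)) by lra.
        replace (A * Rabs (E1 t) + (g + 1) / e * eta') with ((g * eta' + bb * Rabs (E1 t) + eta') * / e)
          by (unfold A; field; lra).
        apply Rmult_le_compat_r; [lra|].
        eapply Rle_trans; [apply Rabs_triang|]. rewrite Rabs_Ropp. apply Rplus_le_compat.
        -- eapply Rle_trans; [apply Rabs_triang|]. rewrite Rabs_Ropp, !Rabs_mult, (Rabs_right g) by lra.
           apply Rplus_le_compat. apply Rmult_le_compat_l; lra.
           apply Rmult_le_compat_r; [apply Rabs_pos|auto].
        -- assert (g * (eta' / 2) <= 1 * (eta' / 2)) by (apply Rmult_le_compat_r; lra). lra.
    + apply Rle_trans with (K * (eta / K)). apply Rmult_le_compat_l; lra.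
      right. field. lra.
Qed.

Lemma quot_limits e z : 0 < e < e1 -> exists X Y,
  pair_limit (fun x y => quot P x y z) e X /\ pair_limit (fun x y => quot h x y z) e Y.
Proof.
  intros He.
  destruct (pair_limit_of_cauchy (fun x y => quot P x y z) e) as [X HX].
  { intros eta Heta. destruct (quot_cauchy e z eta He Heta) as [rho [Hr H]].
    exists rho. split; auto. intros. now apply H. }
  destruct (pair_limit_of_cauchy (fun x y => quot h x y z) e) as [Y HY].
  { intros eta Heta. destruct (quot_cauchy e z eta He Heta) as [rho [Hr H]].
    exists rho. split; auto. intros. now apply H. }
  now exists X, Y.
Qed.

(** The logarithm of [K2 - P''], where [K2] exceeds an upper bound of [P''], is a
    supersolution of the linearized equation with source [|P''|]: squaring [P'']
    in the equation of [P''] beats the division by [K2 - P'']. This is why the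
    derivatives in [eps], whose source [P''] is of size [1/eps] in the layer, are
    only logarithmically large. *)
Lemma log_super K2 v m : 1 <= K2 -> m = K2 - v -> 1 <= m -> Rabs v <= K2 * ((v ^ 2 - v) / m) + 2 * K2.
Proof.
  intros HK Em Hm. apply Rmult_le_reg_r with m; [lra|].
  replace ((K2 * ((v ^ 2 - v) / m) + 2 * K2) * m) with (K2 * (v ^ 2 - v) + 2 * K2 * m) by (field; lra).
  subst m. destruct (Rle_lt_dec 0 v) as [H|H].
  - rewrite Rabs_right by lra.
    assert (0 <= (v - K2) ^ 2) by apply pow2_ge_0. assert (0 <= v ^ 2) by apply pow2_ge_0.
    assert (0 <= (K2 - 1) * v ^ 2) by (apply Rmult_le_pos; lra). nra.
  - rewrite Rabs_left by lra. assert (0 <= v ^ 2) by apply pow2_ge_0.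
    assert (0 <= (K2 - 1) * v ^ 2) by (apply Rmult_le_pos; lra). nra.
Qed.

Lemma ln_inv_nonneg e : 0 < e < e1 -> 0 <= ln (1 / e).
Proof.
  intros He. rewrite <- ln_1. apply ln_le; [lra|].
  apply Rmult_le_reg_r with e; [lra|]. unfold Rdiv. rewrite Rmult_assoc, Rinv_l; lra.
Qed.

(** For [|z - zc| <= eps] the gradient bound is taken on the scale [eps] of the layer,
    which costs the factor [1 / eps] in the second estimate. *)
Lemma quot_log_bound : exists C, 0 < C /\ forall e, 0 < e < e1 -> exists rho, 0 < rho /\
  forall x y, x <> y -> close e rho x -> close e rho y ->
    Rabs (quot P x y (zc e)) <= C * (1 + ln (1 / e)) /\
    Rabs (quot h x y (zc e)) <= C * (1 + ln (1 / e)) / e.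
Proof.
  set (K2 := N + 1).
  set (Ca := K2 * (1 + ln (2 * N + 1)) + 2 * K2 / g + 1).
  set (nb := l * (Rabs c + N + 1) + N).
  set (C := (3 * Ca + N + 1) * exp nb).
  assert (HK2 : 1 < K2) by (unfold K2; lra).
  assert (Hln : 0 < ln (2 * N + 1)) by (rewrite <- ln_1; apply ln_increasing; lra).
  assert (HKg : 0 < 2 * K2 / g) by (apply Rdiv_lt_0_compat; lra).
  assert (HCa : 1 < Ca).
  { assert (0 < K2 * (1 + ln (2 * N + 1))) by (apply Rmult_lt_0_compat; lra). unfold Ca. lra. }
  assert (Hnb : 0 < nb).
  { assert (Hp := Rabs_pos c). assert (0 < l * (Rabs c + N + 1)) by (apply Rmult_lt_0_compat; lra).
    unfold nb. lra. }
  assert (Hexp : 1 <= exp nb) by (apply exp_ge_1; lra).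
  assert (HC : 3 * Ca + N + 1 <= C).
  { unfold C. rewrite <- (Rmult_1_r (3 * Ca + N + 1)) at 1. apply Rmult_le_compat_l; lra. }
  exists C. split; [lra|]. intros e He.
  assert (HL := ln_inv_nonneg e He). set (L := ln (1 / e)) in *.
  assert (Hzc : Rabs (zc e) <= Rabs c + N).
  { assert (K := sf_loc (HS e He)).
    assert (T := Rabs_triang (zc e - c) c). replace (zc e - c + c) with (zc e) in T by ring.
    assert (N * e <= N * 1) by (apply Rmult_le_compat_l; lra). lra. }
  set (Z1 := Rabs (zc e) + 1).
  assert (HZ1 : 0 < Z1) by (unfold Z1; assert (Hp := Rabs_pos (zc e)); lra).
  set (Md := 2 * N / e / g).
  assert (HMd : 0 < Md) by (apply Rdiv_lt_0_compat; [apply Rdiv_lt_0_compat; lra|lra]).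
  destruct (weight_ratio_small g N Hg HN Md Z1 (1 / 2)) as [Z0 [HZ0 HZ]]; try lra.
  set (Z := Rmax Z0 Z1).
  assert (HZZ : Z0 <= Z /\ Z1 <= Z) by (split; [apply Rmax_l|apply Rmax_r]).
  specialize (HZ Z ltac:(lra)).
  destruct (quot_local e Z He ltac:(lra)) as [C' [rho0 [HC' [Hrho0 [Hin [_ Hres]]]]]].
  set (rho := Rmin rho0 (g / (2 * C'))).
  assert (Hgc : 0 < g / (2 * C')) by (apply Rdiv_lt_0_compat; lra).
  assert (Hrho : 0 < rho /\ rho <= rho0 /\ rho <= g / (2 * C')).
  { unfold rho. split; [apply Rmin_glb_lt; lra|]. split; [apply Rmin_l|apply Rmin_r]. }
  assert (HCr : C' * rho <= g / 2).
  { apply Rle_trans with (C' * (g / (2 * C'))). apply Rmult_le_compat_l; lra. right; field; lra. }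
  assert (HCr0 : 0 < C' * rho) by (apply Rmult_lt_0_compat; lra).
  exists rho. split; [lra|]. intros x y Hxy Hx Hy.
  assert (W : forall t, close e rho t -> close e rho0 t) by (unfold close; intros; lra).
  destruct (Hin x (W _ Hx)) as [Hx1 Hx2]. destruct (Hin y (W _ Hy)) as [Hy1 Hy2].
  set (m := fun t => K2 - s e t).
  assert (Hm : forall t, 1 <= m t).
  { intros t. assert (K := s_up e t He). unfold m, K2. lra. }
  set (Psi := fun t => K2 * ln (m t) + 2 * K2 / g).
  set (Psi1 := fun t => K2 * (- s1 e t / m t)).
  set (Psi2 := fun t => K2 * ((- s2 e t * m t - s1 e t ^ 2) / m t ^ 2)).
  assert (DP1 : forall t, is_derive Psi t (Psi1 t)).
  { intros t. assert (D := s_der e t He). assert (Hmt := Hm t). unfold Psi, m. der.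
    unfold m in Hmt. lra. unfold Psi1, m. field. unfold m in Hmt. lra. }
  assert (DP2 : forall t, is_derive Psi1 t (Psi2 t)).
  { intros t. assert (D := s_der e t He). assert (D' := s1_der e t He). assert (Hmt := Hm t).
    unfold Psi1, m. der. unfold m in Hmt; lra. unfold Psi2, m. field. unfold m in Hmt. lra. }
  assert (HPsi0 : forall t, 0 <= Psi t).
  { intros t. assert (0 <= ln (m t)) by (rewrite <- ln_1; apply ln_le; [lra|apply Hm]).
    assert (0 <= K2 * ln (m t)) by (apply Rmult_le_pos; lra). unfold Psi. lra. }
  assert (Hsuper : forall t, Rabs (s e t) <= g * Psi t - e * Psi2 t - (l * t - h e t) * Psi1 t).
  { intros t. specialize (Hm t).
    assert (Hlog := log_super K2 (s e t) (m t) ltac:(lra) eq_refl Hm).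
    assert (E : e * s2 e t + (l * t - h e t) * s1 e t = s e t ^ 2 - s e t).
    { unfold s2. field. lra. }
    assert (E2 : g * Psi t - e * Psi2 t - (l * t - h e t) * Psi1 t =
      g * (K2 * ln (m t)) + 2 * K2 + K2 * ((e * s2 e t + (l * t - h e t) * s1 e t) / m t)
       + K2 * (e * (s1 e t / m t) ^ 2)).
    { unfold Psi, Psi1, Psi2. field. lra. }
    rewrite E2, E.
    assert (0 <= ln (m t)) by (rewrite <- ln_1; apply ln_le; lra).
    assert (0 <= g * (K2 * ln (m t))) by (repeat apply Rmult_le_pos; lra).
    assert (0 <= K2 * (e * (s1 e t / m t) ^ 2)).
    { apply Rmult_le_pos; [lra|]. apply Rmult_le_pos; [lra|apply pow2_ge_0]. }
    lra. }
  set (Bd := K2 * (ln (2 * N + 1) + L) + 2 * K2 / g + 1).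
  assert (HPsiB : forall t, Psi t + 1 <= Bd).
  { intros t. unfold Psi, Bd.
    assert (ln (m t) <= ln (2 * N + 1) + L).
    { unfold L. rewrite <- ln_mult; [|lra|apply Rdiv_lt_0_compat; lra].
      apply ln_le; [specialize (Hm t); lra|].
      assert (K := s_bound e t He). apply Rabs_le_between in K. unfold m, K2.
      replace ((2 * N + 1) * (1 / e)) with (N / e + (N + 1) * / e) by (field; lra).
      assert (1 <= / e) by (rewrite <- Rinv_1; apply Rinv_le_contravar; lra).
      assert ((N + 1) * 1 <= (N + 1) * / e) by (apply Rmult_le_compat_l; lra). lra. }
    assert (K2 * ln (m t) <= K2 * (ln (2 * N + 1) + L)) by (apply Rmult_le_compat_l; lra). lra. }
  assert (HBd : 1 < Bd <= Ca * (1 + L)).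
  { unfold Bd, Ca. assert (0 < K2 * (ln (2 * N + 1) + L)) by (apply Rmult_lt_0_compat; lra).
    split; [lra|].
    assert (0 <= K2 * ln (2 * N + 1) * L) by (repeat apply Rmult_le_pos; lra).
    assert (0 <= (2 * K2 / g + 1) * L) by (apply Rmult_le_pos; lra). lra. }
  assert (HDb : forall t, Rabs (quot P x y t) <= Md).
  { intros t. eapply Rle_trans; [apply quot_bound; auto|]. unfold Md, Rdiv.
    apply Rmult_le_compat_r; [left; apply Rinv_0_lt_compat; lra|].
    replace (2 * N * / e) with (N * / (e / 2)) by (field; lra).
    apply Rmult_le_compat_l; [lra|]. apply Rinv_le_contravar; lra. }
  assert (HD : forall t, Rabs t <= Z1 -> Rabs (quot P x y t) <= Bd).
  { intros t Ht.
    assert (key : forall sg, Rabs sg = 1 -> sg * quot P x y t - Psi t <= 1).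
    { intros sg Hsg.
      assert (G := growth_max_principle g l N Hg ltac:(lra) HN e Z Md (C' * rho)
        (fun t => sg * quot P x y t - Psi t) (fun t => sg * quot h x y t - Psi1 t)
        (fun t => sg * quot s x y t - Psi2 t) (h e) ltac:(lra) ltac:(lra) ltac:(lra)).
      assert (Hab : forall u, sg * quot P x y u - Psi u <= Md).
      { intros u. specialize (HPsi0 u). specialize (HDb u).
        assert (K := Rle_abs (sg * quot P x y u)). rewrite Rabs_mult, Hsg in K. lra. }
      eapply Rle_trans; [apply G; auto; try lra|].
      - intros u. apply der_minus; [|apply DP1]. apply (der_scal (quot P x y)).
        apply quot_der; auto; apply P_der; auto.
      - intros u. apply der_minus; [|apply DP2]. apply (der_scal (quot h x y)).
        apply quot_der; auto; apply h_der; auto.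
      - intros u; now apply h_bound.
      - intros u Hu. assert (R := Hres x y rho Hxy (W _ Hx) (W _ Hy) Hx Hy u Hu).
        set (r := g * quot P x y u - e * quot s x y u - (l * u - h e u) * quot h x y u - s e u) in *.
        assert (Hsr : sg * (r + s e u) <= C' * rho + Rabs (s e u)).
        { eapply Rle_trans; [apply Rle_abs|]. rewrite Rabs_mult, Hsg, Rmult_1_l.
          eapply Rle_trans; [apply Rabs_triang|]. lra. }
        specialize (Hsuper u). unfold r in Hsr. lra.
      - assert (Hw := weight_mono g N t Z1 Ht).
        assert (HwZ := weight_pos g N Hg HN Z).
        assert (Md * weight g N t / weight g N Z <= Md * weight g N Z1 / weight g N Z).
        { unfold Rdiv. apply Rmult_le_compat_r; [left; apply Rinv_0_lt_compat; lra|].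
          apply Rmult_le_compat_l; lra. }
        assert (C' * rho / g <= 1 / 2).
        { apply Rmult_le_reg_r with g; [lra|]. unfold Rdiv. rewrite (Rmult_assoc _ (/ g)), Rinv_l by lra. lra. }
        lra. }
    assert (K1 := key 1 Rabs_R1). assert (K3 := key (-1) ltac:(rewrite Rabs_left; lra)).
    specialize (HPsiB t). apply Rabs_le. lra. }
  assert (HCL : (3 * Ca + N + 1) * exp nb * (1 + L) = C * (1 + L)) by reflexivity.
  split.
  - eapply Rle_trans; [apply HD; unfold Z1; lra|].
    apply Rle_trans with (Ca * (1 + L)); [lra|]. apply Rmult_le_compat_r; lra.
  - set (B := (g * Bd + N / e + 1) / e).
    assert (HNe : 0 < N / e) by (apply Rdiv_lt_0_compat; lra).
    assert (HgB : 0 < g * Bd < Bd) by (split; nra).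
    assert (HB : 0 < B) by (apply Rdiv_lt_0_compat; lra).
    assert (HA : 0 < nb / e) by (apply Rdiv_lt_0_compat; lra).
    assert (Hie : 1 <= / e) by (rewrite <- Rinv_1; apply Rinv_le_contravar; lra).
    assert (Hzb := Rle_abs (zc e)). assert (Hzb' := Rle_abs (- zc e)). rewrite Rabs_Ropp in Hzb'.
    apply Rle_trans with ((2 * Bd / e + B * e) * exp (nb / e * e)).
    + apply (interior_gradient (quot P x y) (quot h x y) (quot s x y) Bd (nb / e) B (zc e) e); try lra.
      * intros t _. apply quot_der; auto; apply P_der; auto.
      * intros t _. apply quot_der; auto; apply h_der; auto.
      * intros t Ht. apply HD. unfold Z1. apply Rabs_le. lra.
      * intros t Ht.
        assert (HtZ : Rabs t <= Z1) by (unfold Z1; apply Rabs_le; lra).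
        assert (R := Hres x y rho Hxy (W _ Hx) (W _ Hy) Hx Hy t ltac:(lra)).
        set (r := g * quot P x y t - e * quot s x y t - (l * t - h e t) * quot h x y t - s e t) in *.
        assert (Hb1 : Rabs (l * t - h e t) <= nb).
        { eapply Rle_trans; [apply Rabs_triang|]. rewrite Rabs_Ropp, Rabs_mult, (Rabs_right l) by lra.
          unfold nb. apply Rplus_le_compat; [apply Rmult_le_compat_l; unfold Z1 in HtZ; lra|now apply h_bound]. }
        replace (quot s x y t) with
          ((g * quot P x y t + - ((l * t - h e t) * quot h x y t) + - (s e t + r)) * / e)
          by (unfold r; field; lra).
        assert (Hsb := s_bound e t He).
        rewrite Rabs_mult, (Rabs_right (/ e)) by lra.
        replace (nb / e * Rabs (quot h x y t) + B) with
          ((g * Bd + nb * Rabs (quot h x y t) + (N / e + 1)) * / e) by (unfold B; field; lra).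
        apply Rmult_le_compat_r; [lra|].
        eapply Rle_trans; [apply Rabs_triang|]. rewrite Rabs_Ropp. apply Rplus_le_compat.
        -- eapply Rle_trans; [apply Rabs_triang|]. rewrite Rabs_Ropp, !Rabs_mult, (Rabs_right g) by lra.
           apply Rplus_le_compat. apply Rmult_le_compat_l; [lra|apply HD; auto].
           apply Rmult_le_compat_r; [apply Rabs_pos|auto].
        -- eapply Rle_trans; [apply Rabs_triang|]. lra.
    + replace (nb / e * e) with nb by (field; lra).
      replace (2 * Bd / e + B * e) with ((2 * Bd + N) * / e + (g * Bd + 1)) by (unfold B; field; lra).
      replace (C * (1 + L) / e) with ((3 * Ca + N + 1) * (1 + L) * / e * exp nb)
        by (unfold C; field; lra).
      apply Rmult_le_compat_r; [lra|].
      apply Rle_trans with ((3 * Bd + N + 1) * / e).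
      * assert ((g * Bd + 1) * 1 <= (Bd + 1) * / e) by (apply Rmult_le_compat; lra). lra.
      * apply Rmult_le_compat_r; [lra|].
        assert (0 <= (N + 1) * L) by (apply Rmult_le_pos; lra). lra.
Qed.

Lemma crossing_slope_pos e : 0 < e < e1 -> / (2 * N * e) <= l - s e (zc e).
Proof.
  intros He. assert (K := sf_amp_low (HS e He)).
  assert (Z := sf_zero (HS e He)).
  unfold s, slope_of. rewrite Z. fold g.
  replace ((g * P e (zc e) - l * zc e * (l * zc e) + (l * zc e) ^ 2 / 2) / e)
    with (- (amplitude2 l (zc e) (P e (zc e)) * / (2 * e)))
    by (unfold amplitude2, g; field; lra).
  assert (Hi : 0 < / (2 * e)) by (apply Rinv_0_lt_compat; lra).
  assert (/ N * / (2 * e) <= amplitude2 l (zc e) (P e (zc e)) * / (2 * e))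
    by (apply Rmult_le_compat_r; lra).
  replace (/ (2 * N * e)) with (/ N * / (2 * e)) by (field; lra). lra.
Qed.

Lemma crossing_continuous e eta : 0 < e < e1 -> 0 < eta -> exists rho, 0 < rho /\
  forall x, close e rho x -> 0 < x < e1 /\ Rabs (zc x - zc e) <= eta.
Proof.
  intros He Heta.
  assert (Hp := Rabs_pos (zc e)).
  assert (Hzb := Rle_abs (zc e)). assert (Hzb' := Rle_abs (- zc e)). rewrite Rabs_Ropp in Hzb'.
  destruct (quot_local e (Rabs (zc e) + eta) He ltac:(lra)) as [C [rho0 [HC [Hrho0 [Hin [Hq _]]]]]].
  assert (Hr := sf_right (HS e He) (zc e + eta) ltac:(lra)).
  assert (Hlf := sf_left (HS e He) (zc e - eta) ltac:(lra)).
  set (d := Rmin (l * (zc e + eta) - h e (zc e + eta)) (h e (zc e - eta) - l * (zc e - eta))).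
  assert (Hd : 0 < d /\ d <= l * (zc e + eta) - h e (zc e + eta) /\ d <= h e (zc e - eta) - l * (zc e - eta)).
  { unfold d. split; [apply Rmin_glb_lt; lra|]. split; [apply Rmin_l|apply Rmin_r]. }
  set (rho := Rmin rho0 (d / C)).
  assert (HdC : 0 < d / C) by (apply Rdiv_lt_0_compat; lra).
  assert (Hrho : 0 < rho /\ rho <= rho0 /\ rho <= d / C).
  { unfold rho. split; [apply Rmin_glb_lt; lra|]. split; [apply Rmin_l|apply Rmin_r]. }
  exists rho. split; [lra|]. intros x Hx.
  assert (Hx0 : close e rho0 x) by (unfold close in *; lra).
  destruct (Hin x Hx0) as [Hx1 _]. split; auto.
  assert (Hdiff : forall z, Rabs z <= Rabs (zc e) + eta -> Rabs (h x z - h e z) < d).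
  { intros z Hz. destruct (Req_dec x e) as [->|Hne].
    - rewrite Rminus_diag, Rabs_R0. lra.
    - destruct (Hq x e Hne Hx0 ltac:(unfold close; rewrite Rminus_diag, Rabs_R0; lra) z Hz) as [K _].
      replace (h x z - h e z) with (quot h x e z * (x - e)) by (unfold quot; field; lra).
      rewrite Rabs_mult. unfold close in Hx.
      apply Rle_lt_trans with (C * Rabs (x - e)).
      apply Rmult_le_compat_r; [apply Rabs_pos|auto].
      apply Rlt_le_trans with (C * (d / C)). apply Rmult_lt_compat_l; lra. right; field; lra. }
  assert (K1 := Hdiff (zc e + eta) ltac:(apply Rabs_le; lra)).
  assert (K2 := Hdiff (zc e - eta) ltac:(apply Rabs_le; lra)).
  apply Rabs_def2 in K1, K2.
  assert (Z := sf_zero (HS x Hx1)).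
  apply Rabs_le. split.
  - destruct (Rle_lt_dec (zc e - eta) (zc x)) as [|H]; [lra|].
    assert (K3 := sf_right (HS x Hx1) (zc e - eta) H). lra.
  - destruct (Rle_lt_dec (zc x) (zc e + eta)) as [|H]; [lra|].
    assert (K3 := sf_left (HS x Hx1) (zc e + eta) H). lra.
Qed.

(** Joint continuity at [(e, zc e)], from continuity in [z] at the viscosity [e] and a
    Lipschitz bound in the viscosity. *)
Lemma near_crossing (u du : R -> R -> R) e eta : 0 < e < e1 -> 0 < eta ->
  (forall x z, 0 < x < e1 -> is_derive (u x) z (du x z)) ->
  (forall Z, 0 < Z -> exists C rho0, 0 < C /\ 0 < rho0 /\
     forall x y, x <> y -> close e rho0 x -> close e rho0 y -> forall z, Rabs z <= Z ->
       Rabs (quot u x y z) <= C) ->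
  exists rho, 0 < rho /\ forall x z, close e rho x -> Rabs (z - zc e) <= rho ->
    Rabs (u x z - u e (zc e)) <= eta.
Proof.
  intros He Heta Hd Hq. assert (Hp := Rabs_pos (zc e)).
  destruct (Hq (Rabs (zc e) + 1) ltac:(lra)) as [C [rho0 [HC [Hrho0 HqC]]]].
  destruct (proj1 (continuous_ed (u e) (zc e)) (continuous_of_derive _ _ _ (Hd e (zc e) He)) (eta / 2))
    as [r [Hr Hcont]]; [lra|].
  set (rho := Rmin (Rmin rho0 (eta / (2 * C))) (Rmin (r / 2) 1)).
  assert (HeC : 0 < eta / (2 * C)) by (apply Rdiv_lt_0_compat; lra).
  assert (Hrho : 0 < rho /\ rho <= rho0 /\ rho <= eta / (2 * C) /\ rho <= r / 2 /\ rho <= 1).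
  { unfold rho. split; [repeat apply Rmin_glb_lt; lra|].
    assert (A1 := Rmin_l (Rmin rho0 (eta / (2 * C))) (Rmin (r / 2) 1)).
    assert (A2 := Rmin_r (Rmin rho0 (eta / (2 * C))) (Rmin (r / 2) 1)).
    assert (A3 := Rmin_l rho0 (eta / (2 * C))). assert (A4 := Rmin_r rho0 (eta / (2 * C))).
    assert (A5 := Rmin_l (r / 2) 1). assert (A6 := Rmin_r (r / 2) 1). lra. }
  exists rho. split; [lra|]. intros x z Hx Hz.
  assert (B1 : Rabs (u e z - u e (zc e)) < eta / 2) by (apply Hcont; lra).
  assert (B2 : Rabs (u x z - u e z) <= eta / 2).
  { destruct (Req_dec x e) as [->|Hne].
    - rewrite Rminus_diag, Rabs_R0. lra.
    - replace (u x z - u e z) with (quot u x e z * (x - e)) by (unfold quot; field; lra).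
      rewrite Rabs_mult. unfold close in Hx.
      apply Rle_trans with (C * (eta / (2 * C))); [|right; field; lra].
      apply Rmult_le_compat; try apply Rabs_pos; [|lra].
      apply HqC; auto; try (unfold close; lra).
      + unfold close. rewrite Rminus_diag, Rabs_R0. lra.
      + assert (T := Rabs_triang (z - zc e) (zc e)). replace (z - zc e + zc e) with z in T by ring. lra. }
  apply Rabs_def2 in B1. apply Rabs_le_between in B2. apply Rabs_le. lra.
Qed.

Lemma increment_between (u du : R -> R) y z :
  (forall t, is_derive u t (du t)) ->
  exists x, Rmin y z <= x <= Rmax y z /\ u z - u y = du x * (z - y).
Proof.
  intros Hd. destruct (MVT_gen u y z du) as [x [Hx E]]; auto.
  - intros x _. eapply continuity_pt_of_continuous, continuous_of_derive, Hd.
  - now exists x.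
Qed.

Lemma between_near p y z rho x : Rabs (y - p) <= rho -> Rabs (z - p) <= rho ->
  Rmin y z <= x <= Rmax y z -> Rabs (x - p) <= rho.
Proof.
  intros Hy Hz. apply Rabs_le_between in Hy, Hz. unfold Rmin, Rmax.
  destruct (Rle_dec y z); intros; apply Rabs_le; lra.
Qed.

(** As the quotients have bounded derivatives in [z], their limit is the same along
    the moving point [zc y]. *)
Lemma quot_limit_moving (u du : R -> R -> R) e X : 0 < e < e1 ->
  (forall x z, 0 < x < e1 -> is_derive (u x) z (du x z)) ->
  (forall Z, 0 < Z -> exists C rho0, 0 < C /\ 0 < rho0 /\
     forall x y, x <> y -> close e rho0 x -> close e rho0 y -> forall z, Rabs z <= Z ->
       Rabs (quot du x y z) <= C) ->
  pair_limit (fun x y => quot u x y (zc e)) e X ->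
  pair_limit (fun x y => quot u x y (zc y)) e X.
Proof.
  intros He Hd Hq HX eta Heta. assert (Hp := Rabs_pos (zc e)).
  destruct (Hq (Rabs (zc e) + 1) ltac:(lra)) as [C [rho0 [HC [Hrho0 HqC]]]].
  destruct (HX (eta / 2)) as [rho1 [Hrho1 H1]]; [lra|].
  assert (HeC : 0 < eta / (2 * C)) by (apply Rdiv_lt_0_compat; lra).
  destruct (crossing_continuous e (Rmin 1 (eta / (2 * C))) He) as [rho2 [Hrho2 H2]].
  { apply Rmin_glb_lt; lra. }
  exists (Rmin rho0 (Rmin rho1 rho2)). split; [repeat apply Rmin_glb_lt; lra|].
  intros x y Hxy Hx Hy.
  assert (M1 := Rmin_l rho0 (Rmin rho1 rho2)). assert (M2 := Rmin_r rho0 (Rmin rho1 rho2)).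
  assert (M3 := Rmin_l rho1 rho2). assert (M4 := Rmin_r rho1 rho2).
  specialize (H1 x y Hxy ltac:(lra) ltac:(lra)).
  destruct (H2 x ltac:(unfold close; lra)) as [Hx1 _].
  destruct (H2 y ltac:(unfold close; lra)) as [Hy1 Hzy].
  assert (M5 := Rmin_l 1 (eta / (2 * C))). assert (M6 := Rmin_r 1 (eta / (2 * C))).
  destruct (increment_between (quot u x y) (quot du x y) (zc e) (zc y)) as [xi [Hxi E]].
  { intros t. apply quot_der; auto. }
  assert (Hxi' : Rabs (xi - zc e) <= 1).
  { apply (between_near (zc e) (zc e) (zc y) 1 xi); auto.
    rewrite Rminus_diag, Rabs_R0; lra. lra. }
  assert (B : Rabs (quot u x y (zc y) - quot u x y (zc e)) <= eta / 2).
  { rewrite E, Rabs_mult.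
    apply Rle_trans with (C * (eta / (2 * C))); [|right; field; lra].
    apply Rmult_le_compat; try apply Rabs_pos; [|lra].
    apply HqC; auto; try (unfold close; lra).
    assert (T := Rabs_triang (xi - zc e) (zc e)). replace (xi - zc e + zc e) with xi in T by ring. lra. }
  apply Rabs_le_between in H1, B. apply Rabs_le. lra.
Qed.

Lemma quot_h_bounded e Z : 0 < e < e1 -> 0 < Z -> exists C rho0, 0 < C /\ 0 < rho0 /\
  forall x y, x <> y -> close e rho0 x -> close e rho0 y -> forall z, Rabs z <= Z ->
    Rabs (quot h x y z) <= C.
Proof.
  intros He HZ. destruct (quot_local e Z He HZ) as [C [rho0 [HC [Hr [_ [Hq _]]]]]].
  exists C, rho0. split; auto. split; auto. intros x y Hxy Hx Hy z Hz.
  apply (Hq x y Hxy Hx Hy z Hz).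
Qed.

Lemma quot_s_bounded e Z : 0 < e < e1 -> 0 < Z -> exists C rho0, 0 < C /\ 0 < rho0 /\
  forall x y, x <> y -> close e rho0 x -> close e rho0 y -> forall z, Rabs z <= Z ->
    Rabs (quot s x y z) <= C.
Proof.
  intros He HZ. destruct (quot_local e Z He HZ) as [C [rho0 [HC [Hr [_ [Hq _]]]]]].
  exists C, rho0. split; auto. split; auto. intros x y Hxy Hx Hy z Hz.
  apply (Hq x y Hxy Hx Hy z Hz).
Qed.

Lemma quotient_near p q d Y sigma eta : 0 < d -> 0 < eta -> q * sigma = p ->
  Rabs (p - Y) <= Rmin (d / 2) (eta * d / (2 * (1 + Rabs Y / d))) ->
  Rabs (q - d) <= Rmin (d / 2) (eta * d / (2 * (1 + Rabs Y / d))) ->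
  Rabs (sigma - Y / d) <= eta.
Proof.
  intros Hd Heta E Hp Hq.
  assert (HY := Rabs_pos Y).
  assert (HYd : 0 <= Rabs Y / d) by (apply Rmult_le_pos; [auto|left; now apply Rinv_0_lt_compat]).
  set (k := 1 + Rabs Y / d) in *. assert (Hk : 1 <= k) by (unfold k; lra).
  set (t := Rmin (d / 2) (eta * d / (2 * k))) in *.
  assert (T1 : t <= d / 2) by apply Rmin_l. assert (T2 : t <= eta * d / (2 * k)) by apply Rmin_r.
  assert (Hq2 : d / 2 <= q) by (apply Rabs_le_between in Hq; lra).
  replace (sigma - Y / d) with (((p - Y) + - (Y / d * (q - d))) / q).
  2: { rewrite <- E. field. split; lra. }
  unfold Rdiv at 1. rewrite Rabs_mult, (Rabs_right (/ q)).
  2: { apply Rle_ge. left. apply Rinv_0_lt_compat. lra. }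
  apply Rmult_le_reg_r with q; [lra|]. rewrite Rmult_assoc, Rinv_l, Rmult_1_r by lra.
  eapply Rle_trans; [apply Rabs_triang|]. rewrite Rabs_Ropp, Rabs_mult.
  assert (EYd : Rabs (Y / d) = Rabs Y / d).
  { unfold Rdiv. rewrite Rabs_mult, (Rabs_right (/ d)); auto.
    apply Rle_ge. left. now apply Rinv_0_lt_compat. }
  rewrite EYd.
  apply Rle_trans with (k * t).
  - unfold k. assert (Rabs Y / d * Rabs (q - d) <= Rabs Y / d * t) by (apply Rmult_le_compat_l; lra). lra.
  - apply Rle_trans with (k * (eta * d / (2 * k))).
    + apply Rmult_le_compat_l; lra.
    + replace (k * (eta * d / (2 * k))) with (eta * (d / 2)) by (field; lra).
      apply Rmult_le_compat_l; lra.
Qed.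

(** Differentiating [h eps (zc eps) = l zc eps]. *)
Lemma crossing_slope e Y : 0 < e < e1 ->
  pair_limit (fun x y => quot h x y (zc e)) e Y ->
  pair_limit (fun x y => (zc x - zc y) / (x - y)) e (Y / (l - s e (zc e))).
Proof.
  intros He HY eta Heta.
  assert (Hd0 := crossing_slope_pos e He).
  assert (Hi : 0 < / (2 * N * e)).
  { apply Rinv_0_lt_compat. repeat apply Rmult_lt_0_compat; lra. }
  set (d := l - s e (zc e)) in *. assert (Hd : 0 < d) by lra.
  set (t := Rmin (d / 2) (eta * d / (2 * (1 + Rabs Y / d)))).
  assert (Ht : 0 < t).
  { apply Rmin_glb_lt; [lra|]. apply Rdiv_lt_0_compat; [apply Rmult_lt_0_compat; lra|].
    assert (0 <= Rabs Y / d) by (apply Rmult_le_pos; [apply Rabs_pos|left; now apply Rinv_0_lt_compat]). lra. }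
  assert (HYm := quot_limit_moving h s e Y He (fun x z Hx => h_der x z Hx)
    (fun Z HZ => quot_s_bounded e Z He HZ) HY).
  destruct (HYm t Ht) as [rho1 [Hr1 H1]].
  destruct (near_crossing s s1 e t He Ht (fun x z Hx => s_der x z Hx)
    (fun Z HZ => quot_s_bounded e Z He HZ)) as [rho2 [Hr2 H2]].
  destruct (crossing_continuous e rho2 He Hr2) as [rho3 [Hr3 H3]].
  exists (Rmin rho1 (Rmin rho2 rho3)). split; [repeat apply Rmin_glb_lt; lra|].
  intros x y Hxy Hx Hy.
  assert (M1 := Rmin_l rho1 (Rmin rho2 rho3)). assert (M2 := Rmin_r rho1 (Rmin rho2 rho3)).
  assert (M3 := Rmin_l rho2 rho3). assert (M4 := Rmin_r rho2 rho3).
  destruct (H3 x ltac:(unfold close; lra)) as [Hx1 Hzx].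
  destruct (H3 y ltac:(unfold close; lra)) as [Hy1 Hzy].
  destruct (increment_between (h x) (s x) (zc y) (zc x)) as [xi [Hxi E]].
  { intros z. now apply h_der. }
  assert (Hxi' := between_near (zc e) _ _ rho2 xi Hzy Hzx Hxi).
  apply (quotient_near (quot h x y (zc y)) (l - s x xi) d Y); auto.
  - assert (Zx := sf_zero (HS x Hx1)).
    assert (Zy := sf_zero (HS y Hy1)).
    unfold quot. replace (h y (zc y)) with (l * zc y) by auto.
    replace (h x (zc y)) with (l * zc x - s x xi * (zc x - zc y)) by (rewrite <- E, Zx; ring).
    field. lra.
  - fold t. apply H1; auto; lra.
  - fold t. replace (l - s x xi - d) with (- (s x xi - s e (zc e))) by (unfold d; ring).
    rewrite Rabs_Ropp. apply H2; auto. unfold close; lra.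
Qed.

Lemma crossing_value_slope e X sigma : 0 < e < e1 ->
  pair_limit (fun x y => quot P x y (zc e)) e X ->
  pair_limit (fun x y => (zc x - zc y) / (x - y)) e sigma ->
  pair_limit (fun x y => (P x (zc x) - P y (zc y)) / (x - y)) e (h e (zc e) * sigma + X).
Proof.
  intros He HX Hsig eta Heta.
  assert (HXm := quot_limit_moving P h e X He (fun x z Hx => P_der x z Hx)
    (fun Z HZ => quot_h_bounded e Z He HZ) HX).
  destruct (HXm (eta / 3)) as [rho1 [Hr1 H1]]; [lra|].
  set (k := Rabs sigma + 1). assert (Hk : 1 <= k) by (assert (Hp := Rabs_pos sigma); unfold k; lra).
  destruct (Hsig (Rmin 1 (eta / (3 * N)))) as [rho2 [Hr2 H2]].
  { apply Rmin_glb_lt; [lra|]. apply Rdiv_lt_0_compat; lra. }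
  destruct (near_crossing h s e (eta / (3 * k)) He) as [rho3 [Hr3 H3]].
  { apply Rdiv_lt_0_compat; lra. }
  { intros x z Hx. now apply h_der. }
  { intros Z HZ. now apply quot_h_bounded. }
  destruct (crossing_continuous e rho3 He Hr3) as [rho4 [Hr4 H4]].
  exists (Rmin (Rmin rho1 rho2) (Rmin rho3 rho4)). split; [repeat apply Rmin_glb_lt; lra|].
  intros x y Hxy Hx Hy.
  assert (M1 := Rmin_l (Rmin rho1 rho2) (Rmin rho3 rho4)).
  assert (M2 := Rmin_r (Rmin rho1 rho2) (Rmin rho3 rho4)).
  assert (M3 := Rmin_l rho1 rho2). assert (M4 := Rmin_r rho1 rho2).
  assert (M5 := Rmin_l rho3 rho4). assert (M6 := Rmin_r rho3 rho4).
  destruct (H4 x ltac:(unfold close; lra)) as [Hx1 Hzx].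
  destruct (H4 y ltac:(unfold close; lra)) as [Hy1 Hzy].
  destruct (increment_between (P x) (h x) (zc y) (zc x)) as [xi [Hxi E]].
  { intros z. now apply P_der. }
  assert (Hxi' := between_near (zc e) _ _ rho3 xi Hzy Hzx Hxi).
  specialize (H1 x y Hxy ltac:(lra) ltac:(lra)). specialize (H2 x y Hxy ltac:(lra) ltac:(lra)).
  specialize (H3 x xi ltac:(unfold close; lra) Hxi').
  set (sl := (zc x - zc y) / (x - y)) in *.
  assert (N1 := Rmin_l 1 (eta / (3 * N))). assert (N2 := Rmin_r 1 (eta / (3 * N))).
  replace ((P x (zc x) - P y (zc y)) / (x - y) - (h e (zc e) * sigma + X))
    with ((h x xi - h e (zc e)) * sl + h e (zc e) * (sl - sigma) + (quot P x y (zc y) - X)).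
  2: { replace (P x (zc x)) with (P x (zc y) + h x xi * (zc x - zc y)) by (rewrite <- E; ring).
       unfold quot, sl. field. lra. }
  eapply Rle_trans; [apply Rabs_triang|].
  assert (A1 : Rabs ((h x xi - h e (zc e)) * sl + h e (zc e) * (sl - sigma)) <= eta / 3 + eta / 3).
  { eapply Rle_trans; [apply Rabs_triang|]. rewrite !Rabs_mult. apply Rplus_le_compat.
    - apply Rle_trans with (eta / (3 * k) * k); [|right; field; lra].
      apply Rmult_le_compat; try apply Rabs_pos; auto.
      unfold k. assert (T := Rabs_triang (sl - sigma) sigma). replace (sl - sigma + sigma) with sl in T by ring. lra.
    - apply Rle_trans with (N * (eta / (3 * N))); [|right; field; lra].
      apply Rmult_le_compat; try apply Rabs_pos; [now apply h_bound|lra]. }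
  lra.
Qed.

Lemma pair_limit_bound (Q : R -> R -> R) e L B rho : 0 < rho ->
  (forall x y, x <> y -> close e rho x -> close e rho y -> Rabs (Q x y) <= B) ->
  pair_limit Q e L -> Rabs L <= B.
Proof.
  intros Hr HB HL. apply le_epsilon. intros eta Heta.
  destruct (HL eta Heta) as [r [Hr0 H]].
  set (d := Rmin rho r / 2).
  assert (Hm : 0 < Rmin rho r) by (apply Rmin_glb_lt; lra).
  assert (M1 := Rmin_l rho r). assert (M2 := Rmin_r rho r).
  assert (Ha : Rabs (e + d - e) = d) by (replace (e + d - e) with d by ring; apply Rabs_right; unfold d; lra).
  specialize (H (e + d) e ltac:(unfold d; lra) ltac:(rewrite Ha; unfold d; lra)
    ltac:(rewrite Rminus_diag, Rabs_R0; lra)).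
  specialize (HB (e + d) e ltac:(unfold d; lra) ltac:(unfold close; rewrite Ha; unfold d; lra)
    ltac:(unfold close; rewrite Rminus_diag, Rabs_R0; lra)).
  apply Rabs_le_between in H, HB. apply Rabs_le. lra.
Qed.

(** In [zc' = (dh/deps) / (l - h')] the numerator is of order [ln (1/eps) / eps] and
    the denominator is at least of order [1/eps]. *)
Lemma crossing_C1 : exists K, 0 < K /\ forall e, 0 < e < e1 -> exists dz dp,
  pair_limit (fun x y => (zc x - zc y) / (x - y)) e dz /\
  pair_limit (fun x y => (P x (zc x) - P y (zc y)) / (x - y)) e dp /\
  Rabs dz <= K * (1 + ln (1 / e)) /\ Rabs dp <= K * (1 + ln (1 / e)).
Proof.
  destruct quot_log_bound as [C [HC Hlog]].
  assert (HNC : 0 < 2 * N * C) by (repeat apply Rmult_lt_0_compat; lra).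
  assert (HNNC : 0 < N * (2 * N * C)) by (apply Rmult_lt_0_compat; lra).
  exists (2 * N * C + N * (2 * N * C) + C). split; [lra|].
  intros e He. destruct (quot_limits e (zc e) He) as [X [Y [HX HY]]].
  destruct (Hlog e He) as [rho [Hr Hb]].
  assert (BX := pair_limit_bound _ e X _ rho Hr (fun x y A B D => proj1 (Hb x y A B D)) HX).
  assert (BY := pair_limit_bound _ e Y _ rho Hr (fun x y A B D => proj2 (Hb x y A B D)) HY).
  assert (HL := ln_inv_nonneg e He). set (L := ln (1 / e)) in *.
  assert (Hd := crossing_slope_pos e He). set (d := l - s e (zc e)) in *.
  assert (Hi : 0 < / (2 * N * e)).
  { apply Rinv_0_lt_compat. repeat apply Rmult_lt_0_compat; lra. }
  assert (Hz := crossing_slope e Y He HY). fold d in Hz.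
  assert (Hp := crossing_value_slope e X (Y / d) He HX Hz).
  assert (Bz : Rabs (Y / d) <= 2 * N * C * (1 + L)).
  { unfold Rdiv. rewrite Rabs_mult, (Rabs_right (/ d)).
    2: { apply Rle_ge. left. apply Rinv_0_lt_compat. lra. }
    assert (Hid : / d <= 2 * N * e).
    { rewrite <- (Rinv_inv (2 * N * e)). apply Rinv_le_contravar; lra. }
    apply Rle_trans with (C * (1 + L) / e * (2 * N * e)); [|right; field; lra].
    apply Rmult_le_compat; auto; [apply Rabs_pos|]. left. apply Rinv_0_lt_compat. lra. }
  exists (Y / d), (h e (zc e) * (Y / d) + X).
  split; auto. split; auto. split.
  - assert (0 <= (N * (2 * N * C) + C) * (1 + L)) by (apply Rmult_le_pos; lra). lra.
  - eapply Rle_trans; [apply Rabs_triang|]. rewrite Rabs_mult.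
    assert (Rabs (h e (zc e)) * Rabs (Y / d) <= N * (2 * N * C * (1 + L))).
    { apply Rmult_le_compat; try apply Rabs_pos; auto. now apply h_bound. }
    assert (0 <= (2 * N * C) * (1 + L)) by (apply Rmult_le_pos; lra). lra.
Qed.
End Family.

(** * Uniqueness, tails and norms *)

Lemma viscous_solution_derivatives alpha eps zc a u : viscous_solution alpha eps zc a u ->
  (forall z, is_derive u z (Derive u z)) /\
  (forall z, is_derive (Derive u) z (Derive_n u 2 z)).
Proof.
  intros [H _]. split; intros z; destruct (H z) as [H1 H2].
  - now apply Derive_correct.
  - apply Derive_correct. exact H2.
Qed.

(** The difference [E] of two solutions satisfies a linear equation, so [E^2 + E'^2]
    grows at most exponentially away from [zc], where it vanishes. *)
Lemma viscous_solution_unique alpha eps zc a u v : 0 < alpha -> 0 < eps ->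
  viscous_solution alpha eps zc a u -> viscous_solution alpha eps zc a v ->
  forall z, u z = v z.
Proof.
  intros Hal He Hu Hv z.
  destruct (viscous_solution_derivatives _ _ _ _ _ Hu) as [U1 U2].
  destruct (viscous_solution_derivatives _ _ _ _ _ Hv) as [V1 V2].
  destruct Hu as [_ [Ue [Uz Ud]]]. destruct Hv as [_ [Ve [Vz Vd]]].
  set (l := / (1 + alpha)).
  assert (Hl : 0 < l < 1).
  { unfold l. split; [apply Rinv_0_lt_compat; lra|]. rewrite <- Rinv_1. apply Rinv_lt_contravar; lra. }
  set (Z := Rmax (Rabs z) (Rabs zc) + 1).
  assert (HZ : Rabs z <= Z /\ Rabs zc <= Z).
  { assert (K1 := Rmax_l (Rabs z) (Rabs zc)). assert (K2 := Rmax_r (Rabs z) (Rabs zc)). unfold Z; lra. }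
  destruct (bounded_on_segment (Derive u) (- Z) Z) as [G [HG HGb]].
  { intros x _. eapply continuous_of_derive, U2. }
  destruct (bounded_on_segment v (- Z) Z) as [B [HB HBb]].
  { intros x _. eapply continuous_of_derive, V1. }
  set (E := fun t => u t - v t). set (E1 := fun t => Derive u t - Derive v t).
  set (E2 := fun t => Derive_n u 2 t - Derive_n v 2 t).
  set (A0 := (1 + l * Z + G + B) / eps).
  assert (HZ0 : 0 <= Z) by (assert (Hp := Rabs_pos z); lra).
  assert (HlZ : 0 <= l * Z) by (apply Rmult_le_pos; lra).
  assert (HA0 : 0 < A0) by (apply Rdiv_lt_0_compat; lra).
  assert (HE2 : forall t, Rabs t <= Z -> Rabs (E2 t) <= A0 * (Rabs (E t) + Rabs (E1 t))).
  { intros t Ht. specialize (Ue t). specialize (Ve t).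
    assert (Ht' := proj1 (Rabs_le_between _ _) Ht).
    specialize (HGb t ltac:(lra)). specialize (HBb t ltac:(lra)).
    assert (Eq : E2 t = - (((1 - l) - Derive u t) * E t + (l * t - v t) * E1 t) / eps).
    { apply Rmult_eq_reg_l with eps; [|lra]. unfold E2, E, E1.
      replace (alpha / (1 + alpha)) with (1 - l) in Ue, Ve by (unfold l; field; lra).
      replace (t / (1 + alpha)) with (l * t) in Ue, Ve by (unfold l; field; lra).
      replace (eps * (- ((1 - l - Derive u t) * (u t - v t) + (l * t - v t) * (Derive u t - Derive v t)) / eps))
        with (- ((1 - l - Derive u t) * (u t - v t) + (l * t - v t) * (Derive u t - Derive v t)))
        by (field; lra).
      lra. }
    assert (Hie : 0 < / eps) by now apply Rinv_0_lt_compat.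
    rewrite Eq. unfold Rdiv at 1. rewrite Rabs_mult, Rabs_Ropp, (Rabs_right (/ eps)) by lra.
    replace (A0 * (Rabs (E t) + Rabs (E1 t))) with
      ((1 + l * Z + G + B) * (Rabs (E t) + Rabs (E1 t)) * / eps) by (unfold A0; field; lra).
    apply Rmult_le_compat_r; [lra|].
    eapply Rle_trans; [apply Rabs_triang|]. rewrite !Rabs_mult.
    assert (B1 : Rabs (1 - l - Derive u t) <= 1 + G).
    { apply Rabs_le_between in HGb. apply Rabs_le. lra. }
    assert (B2 : Rabs (l * t - v t) <= l * Z + B).
    { eapply Rle_trans; [apply Rabs_triang|]. rewrite Rabs_Ropp, Rabs_mult, (Rabs_right l) by lra.
      assert (l * Rabs t <= l * Z) by (apply Rmult_le_compat_l; lra). lra. }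
    assert (P1 := Rabs_pos (E t)). assert (P2 := Rabs_pos (E1 t)).
    assert (Rabs (1 - l - Derive u t) * Rabs (E t) <= (1 + G) * Rabs (E t)) by (apply Rmult_le_compat_r; lra).
    assert (Rabs (l * t - v t) * Rabs (E1 t) <= (l * Z + B) * Rabs (E1 t)) by (apply Rmult_le_compat_r; lra).
    assert (0 <= (l * Z + B) * Rabs (E t)) by (apply Rmult_le_pos; lra).
    assert (0 <= (1 + G) * Rabs (E1 t)) by (apply Rmult_le_pos; lra). lra. }
  set (y := fun t => E t ^ 2 + E1 t ^ 2).
  set (dy := fun t => 2 * E t * E1 t + 2 * E1 t * E2 t).
  assert (Hdy : forall t, is_derive y t (dy t)).
  { intros t. assert (D1 := U1 t). assert (D2 := V1 t). assert (D3 := U2 t). assert (D4 := V2 t).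
    assert (D5 : is_derive E t (E1 t)) by (apply der_minus; auto).
    assert (D6 : is_derive E1 t (E2 t)) by (apply (der_minus (Derive u) (Derive v)); auto).
    unfold y. der. unfold dy. ring. }
  set (A := 1 + 3 * A0).
  assert (Hyb : forall t, Rabs t <= Z -> Rabs (dy t) <= A * y t).
  { intros t Ht. specialize (HE2 t Ht). unfold dy, y.
    assert (P1 := Rabs_pos (E t)). assert (P2 := Rabs_pos (E1 t)).
    rewrite <- (pow2_abs (E t)), <- (pow2_abs (E1 t)).
    eapply Rle_trans; [apply Rabs_triang|]. rewrite !Rabs_mult, (Rabs_right 2) by lra.
    set (p := Rabs (E t)) in *. set (q := Rabs (E1 t)) in *.
    assert (S1 : 0 <= (p - q) ^ 2) by apply pow2_ge_0.
    assert (S2 : q * Rabs (E2 t) <= q * (A0 * (p + q))) by (apply Rmult_le_compat_l; lra).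
    assert (S3 : 2 * (q * (p + q)) <= 3 * (p ^ 2 + q ^ 2)) by (assert (0 <= p ^ 2) by apply pow2_ge_0; lra).
    assert (S4 : A0 * (2 * (q * (p + q))) <= A0 * (3 * (p ^ 2 + q ^ 2))) by (apply Rmult_le_compat_l; lra).
    unfold A. lra. }
  assert (Hy0 : y zc = 0).
  { unfold y, E, E1. rewrite Uz, Vz, Ud, Vd. ring. }
  assert (Hyz : y z <= 0).
  { destruct HZ as [HZ1 HZ2].
    apply Rabs_le_between in HZ1, HZ2.
    destruct (Rle_lt_dec zc z) as [H|H].
    - assert (K : y z <= y zc * exp (A * (z - zc))).
      { apply (gronwall_pos A y dy zc z); try lra; auto.
        intros t Ht. eapply Rle_trans; [apply Rle_abs|apply Hyb]. apply Rabs_le; lra. }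
      rewrite Hy0, Rmult_0_l in K. exact K.
    - assert (K := gronwall_pos A (fun t => y (- t)) (fun t => - dy (- t)) (- zc) (- z)).
      assert (K' : (fun t => y (- t)) (- z) <= y (- - zc) * exp (A * (- z - - zc))).
      { apply K; try lra.
        - intros t Ht. apply is_derive_reflect, Hdy.
        - intros t Ht. eapply Rle_trans; [apply Rle_abs|]. rewrite Rabs_Ropp. apply Hyb. apply Rabs_le; lra. }
      simpl in K'. rewrite !Ropp_involutive, Hy0, Rmult_0_l in K'. exact K'. }
  unfold y in Hyz. assert (S1 := pow2_ge_0 (E z)). assert (S2 := pow2_ge_0 (E1 z)).
  assert (S3 : E z ^ 2 = 0) by lra.
  assert (S4 : E z = 0).
  { destruct (Req_dec (E z) 0) as [|Hn]; auto. exfalso. apply (pow_nonzero (E z) 2 Hn S3). }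
  unfold E in S4. lra.
Qed.

Lemma viscous_solution_of_potential alpha eps P h zc a : 0 < alpha -> 0 < eps ->
  let l := / (1 + alpha) in
  viscous_potential (2 * l - 1) l eps (fun _ => True) P h ->
  h zc = l * zc -> a ^ 2 = amplitude2 l zc (P zc) ->
  viscous_solution alpha eps zc a h.
Proof.
  intros Hal He l HP Hz Ha.
  set (s := fun z => slope_of l eps z (P z) (h z)).
  set (s1 := fun z => - ((1 - l) * h z + (l * z - h z) * s z) / eps).
  assert (D1 : forall z, is_derive h z (s z)) by (intros z; apply (HP z I)).
  assert (D2 : forall z, is_derive s z (s1 z)).
  { intros z. destruct (HP z I) as [D0 _]. assert (D := D1 z). unfold s, slope_of. der.
    unfold s1, s, slope_of. field. lra. }
  assert (E1 : forall z, Derive h z = s z) by (intros z; apply is_derive_unique, D1).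
  assert (D3 : forall z, is_derive (Derive_n h 1) z (s1 z)).
  { intros z. apply (is_derive_ext s); auto. intros t. symmetry. apply E1. }
  assert (E2 : forall z, Derive_n h 2 z = s1 z) by (intros z; apply is_derive_unique, D3).
  split; [|split; [|split]].
  - intros z. split; [exists (s z); apply D1|exists (s1 z); apply D3].
  - intros z. rewrite E1, E2. unfold s1.
    replace (alpha / (1 + alpha)) with (1 - l) by (unfold l; field; lra).
    replace (z / (1 + alpha)) with (l * z) by (unfold l; field; lra). field. lra.
  - rewrite Hz. unfold l. field. lra.
  - rewrite E1. unfold s, slope_of. rewrite Hz, Ha. unfold amplitude2. field. lra.
Qed.

Lemma Rpower_small alpha e : 0 < alpha < 1 -> 0 < e ->
  exists R0, 1 < R0 /\ forall r, R0 < r -> Rpower r alpha / r < e.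
Proof.
  intros Hal He. set (K := Rmax 1 (- ln e / (1 - alpha) + 1)).
  assert (HK : 1 <= K /\ - ln e / (1 - alpha) + 1 <= K) by (split; [apply Rmax_l|apply Rmax_r]).
  exists (exp K). assert (H1 := exp_ge_linear K). split; [lra|]. intros r Hr.
  assert (Hr0 : 0 < r) by lra.
  replace (Rpower r alpha / r) with (exp ((alpha - 1) * ln r)).
  2: { unfold Rpower, Rdiv. rewrite <- (exp_ln r Hr0) at 3. rewrite <- exp_Ropp, <- exp_plus. f_equal. ring. }
  rewrite <- (exp_ln e He). apply exp_increasing.
  assert (Hln : K < ln r) by (rewrite <- (ln_exp K); apply ln_increasing; [apply exp_pos|auto]).
  assert ((1 - alpha) * (- ln e / (1 - alpha)) < (1 - alpha) * ln r) by (apply Rmult_lt_compat_l; lra).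
  replace ((1 - alpha) * (- ln e / (1 - alpha))) with (- ln e) in H by (field; lra). lra.
Qed.

(** [alpha < 1], so a difference of order [1/|z|] is negligible against
    [|z|^(-alpha)]. *)
Lemma power_tail_transfer alpha kappa L h0 h c N :
  0 < alpha < 1 -> 0 < kappa -> 0 < N -> (L = p_infty \/ L = m_infty) ->
  (forall z, 1 <= Rabs (z - c) -> Rabs (h z - h0 z) * (1 + Rabs (z - c)) <= N) ->
  power_tail alpha kappa L h0 -> power_tail alpha kappa L h.
Proof.
  intros Hal Hka HN HL Hd [o0 [Ho0 Hh0]].
  exists (fun z => h z / (kappa * Rpower (Rabs z) (- alpha)) - 1).
  assert (Hrp : forall z, 0 < Rpower (Rabs z) (- alpha)) by (intros; apply exp_pos).
  assert (Hfar : forall R0, Rbar_locally L (fun z => R0 < Rabs z)).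
  { intros R0. destruct HL as [-> | ->].
    - exists (Rmax R0 0). intros x Hx. assert (K1 := Rmax_l R0 0). assert (K2 := Rmax_r R0 0).
      rewrite Rabs_right; lra.
    - exists (- Rmax R0 0). intros x Hx. assert (K1 := Rmax_l R0 0). assert (K2 := Rmax_r R0 0).
      rewrite Rabs_left; lra. }
  split.
  - apply is_lim_spec. intros e.
    apply is_lim_spec in Ho0. specialize (Ho0 (pos_div_2 e)).
    destruct (Rpower_small alpha (kappa * (e / 2) / (N * (1 + Rabs c))) Hal) as [R0 [HR0 HR]].
    { assert (He := cond_pos e). assert (Hp := Rabs_pos c).
      apply Rdiv_lt_0_compat; apply Rmult_lt_0_compat; lra. }
    assert (Hf := Hfar (Rmax R0 (1 + Rabs c))).
    assert (Hgoal : Rbar_locally L (fun z =>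
      Rabs (h z / (kappa * Rpower (Rabs z) (- alpha)) - 1 - 0) < e)).
    { assert (Ho0' : Rbar_locally L (fun z => Rabs (o0 z - 0) < pos_div_2 e)).
      { destruct HL as [-> | ->]; exact Ho0. }
      generalize (filter_and _ _ Ho0' (filter_and _ _ Hh0 Hf)).
      apply filter_imp. intros z [A1 [A2 A3]]. simpl in A1.
      assert (M1 := Rmax_l R0 (1 + Rabs c)). assert (M2 := Rmax_r R0 (1 + Rabs c)).
      assert (Hzc : 1 <= Rabs (z - c)).
      { assert (T := Rabs_triang (z - c) c). replace (z - c + c) with z in T by ring. lra. }
      specialize (Hd z Hzc). specialize (HR (Rabs z) ltac:(lra)).
      specialize (Hrp z). set (w := Rpower (Rabs z) (- alpha)) in *.
      assert (Hz0 : 0 < Rabs z) by (assert (Hp := Rabs_pos c); lra).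
      assert (Ew : Rpower (Rabs z) alpha = / w) by (unfold w; rewrite Rpower_Ropp, Rinv_inv; auto).
      rewrite Ew in HR.
      replace (h z / (kappa * w) - 1 - 0) with ((o0 z - 0) + (h z - h0 z) / (kappa * w)).
      2: { rewrite A2. field. lra. }
      eapply Rle_lt_trans; [apply Rabs_triang|].
      assert (Hpc := Rabs_pos c). assert (Hpz := Rabs_pos (z - c)).
      assert (B : Rabs ((h z - h0 z) / (kappa * w)) < e / 2); [|lra].
      assert (Hkw : 0 < kappa * w) by (apply Rmult_lt_0_compat; lra).
      unfold Rdiv at 1. rewrite Rabs_mult, (Rabs_right (/ (kappa * w))).
      2: { apply Rle_ge. left. now apply Rinv_0_lt_compat. }
      apply Rmult_lt_reg_r with (kappa * w); auto. rewrite Rmult_assoc, Rinv_l, Rmult_1_r by lra.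
      assert (Hzw : Rabs z <= (1 + Rabs (z - c)) * (1 + Rabs c)).
      { assert (T := Rabs_triang (z - c) c). replace (z - c + c) with z in T by ring. nra. }
      assert (B1 : Rabs (h z - h0 z) * Rabs z <= N * (1 + Rabs c)).
      { apply Rle_trans with (Rabs (h z - h0 z) * ((1 + Rabs (z - c)) * (1 + Rabs c))).
        apply Rmult_le_compat_l; [apply Rabs_pos|auto].
        rewrite <- Rmult_assoc. apply Rmult_le_compat_r; lra. }
      assert (B2 : N * (1 + Rabs c) < kappa * (e / 2) * w * Rabs z).
      { assert (HNc : 0 < N * (1 + Rabs c)) by (apply Rmult_lt_0_compat; lra).
        assert (Hwz : 0 < w * Rabs z) by (apply Rmult_lt_0_compat; lra).
        apply (Rmult_lt_compat_r (N * (1 + Rabs c) * (w * Rabs z))) in HR.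
        2: { now apply Rmult_lt_0_compat. }
        replace (/ w / Rabs z * (N * (1 + Rabs c) * (w * Rabs z))) with (N * (1 + Rabs c)) in HR
          by (field; lra).
        replace (kappa * (e / 2) / (N * (1 + Rabs c)) * (N * (1 + Rabs c) * (w * Rabs z)))
          with (kappa * (e / 2) * w * Rabs z) in HR by (field; lra). exact HR. }
      apply Rmult_lt_reg_r with (Rabs z); auto. lra. }
    destruct HL as [-> | ->]; exact Hgoal.
  - assert (Hall : forall z, h z = kappa * Rpower (Rabs z) (- alpha) *
      (1 + (h z / (kappa * Rpower (Rabs z) (- alpha)) - 1))).
    { intros z. specialize (Hrp z). field. lra. }
    apply filter_forall. exact Hall.
Qed.

Lemma null_set_empty : null_set (fun _ => False).
Proof.
  intros d. exists (fun _ => 0), (fun _ => 0). split; [intros; lra|]. split; [tauto|].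
  intros m. rewrite (sum_n_ext _ (fun _ => 0)) by (intros; apply Rminus_diag).
  rewrite sum_n_const, Rmult_0_r. left. apply cond_pos.
Qed.

Lemma Linf_norm_le A f M : 0 <= M -> (forall x, A x -> Rabs (f x) <= M) ->
  Rbar_le (Linf_norm A f) M.
Proof.
  intros HM H. unfold Linf_norm.
  match goal with |- Rbar_le (Glb_Rbar ?E) _ => destruct (Glb_Rbar_correct E) as [Hlb _] end.
  apply Hlb. split; auto. exists (fun _ => False). split; [apply null_set_empty|auto].
Qed.

Lemma at_right_0 (Q : R -> Prop) d : 0 < d -> (forall e, 0 < e < d -> Q e) -> at_right 0 Q.
Proof.
  intros Hd H. exists (mkposreal d Hd). intros e He Hpos. apply H.
  change (Rabs (e - 0) < d) in He. rewrite Rminus_0_r, Rabs_right in He; lra.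
Qed.

Lemma vanishes_of_bound (F : R -> R -> Prop) (u : R -> R -> R) (B : R) e0 :
  0 < e0 -> 0 <= B ->
  (forall e, 0 < e < e0 -> 1 <= ln (1 / e) /\ forall z, F e z -> Rabs (u e z) <= B / ln (1 / e)) ->
  vanishes_at_0 (fun e => Linf_norm (F e) (u e)).
Proof.
  intros He0 HB H eta. assert (Heta := cond_pos eta).
  set (K := 2 * B / eta + 1).
  assert (HBe : 0 <= 2 * B / eta).
  { apply Rmult_le_pos; [lra|]. left. now apply Rinv_0_lt_compat. }
  apply at_right_0 with (Rmin e0 (exp (- K))).
  { apply Rmin_glb_lt; [lra|apply exp_pos]. }
  intros e He. assert (M1 := Rmin_l e0 (exp (- K))). assert (M2 := Rmin_r e0 (exp (- K))).
  destruct (H e ltac:(lra)) as [HL Hb].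
  assert (HK : K < ln (1 / e)).
  { rewrite <- (ln_exp K). apply ln_increasing; [apply exp_pos|].
    unfold Rdiv. rewrite Rmult_1_l, <- (Rinv_inv (exp K)), <- exp_Ropp.
    apply Rinv_lt_contravar; [|lra]. apply Rmult_lt_0_compat; [lra|apply exp_pos]. }
  apply Rbar_le_lt_trans with (Finite (eta / 2)); [|simpl; lra].
  apply Linf_norm_le; [lra|]. intros z Hz. eapply Rle_trans; [now apply Hb|].
  apply Rmult_le_reg_r with (ln (1 / e)); [lra|].
  unfold Rdiv at 1. rewrite Rmult_assoc, Rinv_l, Rmult_1_r by lra.
  apply Rle_trans with (eta / 2 * K); [|apply Rmult_le_compat_l; lra].
  unfold K. replace (eta / 2 * (2 * B / eta + 1)) with (B + eta / 2) by (field; lra). lra.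
Qed.

Lemma eps_log_bounds e : 0 < e -> 1 <= ln (1 / e) ->
  let L := ln (1 / e) in e * L <= 1 /\ e <= 27 / L /\ e * L <= 27 / L /\ e * L ^ 2 <= 27 / L.
Proof.
  intros He HL L. fold L in HL.
  assert (Ee : exp L = / e).
  { unfold L. rewrite exp_ln; [field; lra|]. apply Rdiv_lt_0_compat; lra. }
  assert (H1 := exp_ge_linear L).
  assert (HeL : e * exp L = 1) by (rewrite Ee; field; lra).
  assert (H3 : L ^ 3 / 27 <= exp L).
  { replace L with (L / 3 + L / 3 + L / 3) at 2 by field. rewrite !exp_plus.
    assert (K := exp_ge_linear (L / 3)). set (x := exp (L / 3)) in *.
    replace (L ^ 3 / 27) with ((L / 3) ^ 3) by field.
    replace (x * x * x) with (x ^ 3) by ring. apply pow_incr. lra. }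
  assert (A : e * L ^ 2 <= 27 / L).
  { apply Rmult_le_reg_r with L; [lra|]. unfold Rdiv. rewrite (Rmult_assoc 27), Rinv_l, Rmult_1_r by lra.
    assert (e * (L ^ 3 / 27) <= e * exp L) by (apply Rmult_le_compat_l; lra). lra. }
  assert (B : e * L <= e * L ^ 2) by (apply Rmult_le_compat_l; nra).
  assert (C : e <= e * L) by nra.
  split; [nra|]. lra.
Qed.

Lemma layer_form A y eps : 0 < eps ->
  2 * A * exp (- A * (y / eps)) / (1 + exp (- A * (y / eps))) = A - A * tanh (A * y / (2 * eps)).
Proof.
  intros He. set (x := A * y / (2 * eps)).
  replace (- A * (y / eps)) with (- x + - x) by (unfold x; field; lra).
  assert (E : exp (- x) = / exp x) by apply exp_Ropp.
  rewrite exp_plus. rewrite tanh_exp, E. assert (Hp := exp_pos x).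
  field. assert (0 < exp x * exp x) by (apply Rmult_lt_0_compat; lra). split; nra.
Qed.

Lemma Rpower_le_base r alpha : 1 <= r -> 0 < alpha < 1 -> Rpower r alpha <= r.
Proof.
  intros Hr Hal. unfold Rpower. rewrite <- (exp_ln r) at 2 by lra. apply exp_le_compat.
  assert (0 <= ln r) by (rewrite <- ln_1; apply ln_le; lra). nra.
Qed.

(** * Convergence inside and outside the layer *)

Section Asymptotics.
Variables (l c a k0 Hm H1 N e : R) (h0 h1 P h : R -> R) (zc : R).
Hypothesis Hl : / 2 < l < 1.
Hypothesis IP : inviscid_profile l c a k0 Hm H1 h0 h1.
Hypothesis HN : 0 < N.
Hypothesis He : 0 < e <= 1.
Hypothesis HS : solution_facts l c a h0 N e P h zc.
Let A := sqrt (amplitude2 l zc (P zc)).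
Let L := ln (1 / e).
Hypothesis HL : 1 <= L.
Hypothesis HLN : N < L.

Let Ha : 0 < a.
Proof. apply (ip_a IP). Qed.
Let HH1 : 0 < H1.
Proof. apply (ip_H1 IP). Qed.

Lemma amplitude_pos : 0 < A /\ A ^ 2 = amplitude2 l zc (P zc).
Proof.
  assert (K := sf_amp_low HS). assert (0 < / N) by now apply Rinv_0_lt_compat.
  split; [apply sqrt_lt_R0; lra|]. unfold A. apply pow2_sqrt. lra.
Qed.

Lemma amplitude_near : Rabs (A - a) <= N / a * e.
Proof.
  destruct amplitude_pos as [HA EA]. assert (K := sf_amp HS). rewrite <- EA in K.
  replace (A ^ 2 - a ^ 2) with ((A - a) * (A + a)) in K by ring.
  rewrite Rabs_mult, (Rabs_right (A + a)) in K by lra.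
  assert (Hp := Rabs_pos (A - a)).
  apply Rmult_le_reg_r with a; auto. replace (N / a * e * a) with (N * e) by (field; lra).
  assert (Rabs (A - a) * a <= Rabs (A - a) * (A + a)) by (apply Rmult_le_compat_l; lra). lra.
Qed.

Let C1 := 27 * (2 * N + 1 + N + N / a).

Lemma layer_estimate z : layer 1 e zc z ->
  Rabs (h z - (l * c - a) - 2 * A * exp (- A * ((z - zc) / e)) / (1 + exp (- A * ((z - zc) / e))))
    <= C1 / L.
Proof.
  unfold layer. fold L. intros Hz.
  destruct (eps_log_bounds e ltac:(lra) HL) as [B1 [B2 [B3 B4]]]. fold L in B1, B2, B3, B4.
  assert (Hy : Rabs (z - zc) <= e * L) by (apply Rabs_le; lra).
  assert (K := sf_layer HS z ltac:(lra)). fold A in K.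
  rewrite layer_form by lra.
  assert (Kz := sf_loc HS). assert (Ka := amplitude_near).
  replace (h z - (l * c - a) - (A - A * tanh (A * (z - zc) / (2 * e)))) with
    (- (l * z - h z - A * tanh (A * (z - zc) / (2 * e))) + (l * (z - zc) + l * (zc - c)) + - (A - a)) by ring.
  assert (HNa : 0 < N / a) by (apply Rdiv_lt_0_compat; lra).
  assert (Hy2 : (z - zc) ^ 2 / e <= e * L ^ 2).
  { rewrite <- pow2_abs. apply Rmult_le_reg_r with e; [lra|].
    unfold Rdiv. rewrite Rmult_assoc, Rinv_l, Rmult_1_r by lra.
    replace (e * L ^ 2 * e) with ((e * L) ^ 2) by ring. apply pow_incr.
    split; [apply Rabs_pos|auto]. }
  assert (T1 : N * ((z - zc) ^ 2 / e + Rabs (z - zc)) <= N * (2 * (27 / L))).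
  { apply Rmult_le_compat_l; lra. }
  assert (T2 : Rabs (l * (z - zc) + l * (zc - c)) <= 27 / L + N * (27 / L)).
  { eapply Rle_trans; [apply Rabs_triang|]. rewrite !Rabs_mult, (Rabs_right l) by lra.
    assert (P1 := Rabs_pos (z - zc)). assert (P2 := Rabs_pos (zc - c)).
    assert (N * e <= N * (27 / L)) by (apply Rmult_le_compat_l; lra). nra. }
  assert (T3 : N / a * e <= N / a * (27 / L)) by (apply Rmult_le_compat_l; lra).
  replace (C1 / L) with (N * (2 * (27 / L)) + (27 / L + N * (27 / L)) + N / a * (27 / L))
    by (unfold C1; field; lra).
  eapply Rle_trans; [apply Rabs_triang|]. rewrite Rabs_Ropp.
  apply Rplus_le_compat; [|lra].
  eapply Rle_trans; [apply Rabs_triang|]. rewrite Rabs_Ropp. lra.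
Qed.

Let C2 := (27 * (2 * N + (1 + H1) * (1 + N) + N / a) + 2 + 27 * N) * (2 + N).

(** At the edge of the layer the solution has already reached the outer profile, and
    the outer estimates propagate this. *)
Lemma edge_estimate (sg z : R) : Rabs sg = 1 -> z = zc + sg * (e * L) ->
  0 < sg * (z - c) /\ N * e <= C2 / L /\ Rabs (h z - h0 z) * (1 + sg * (z - c)) <= C2 / L.
Proof.
  intros Hsg Ez.
  assert (Hsg2 := abs_one_sqr sg Hsg).
  destruct (eps_log_bounds e ltac:(lra) HL) as [B1 [B2 [B3 B4]]]. fold L in B1, B2, B3, B4.
  assert (Kz := sf_loc HS). assert (Ka := amplitude_near).
  destruct amplitude_pos as [HA _].
  assert (HeL : 0 < e * L) by (apply Rmult_lt_0_compat; lra).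
  assert (HNe : N * e < e * L) by nra.
  assert (Hsz : sg * (z - c) = e * L + sg * (zc - c)).
  { rewrite Ez. replace (sg * (zc + sg * (e * L) - c)) with (sg * sg * (e * L) + sg * (zc - c)) by ring.
    rewrite Hsg2. ring. }
  assert (Hsc : Rabs (sg * (zc - c)) <= N * e) by (rewrite Rabs_mult, Hsg; lra).
  apply Rabs_le_between in Hsc.
  assert (Hpos : 0 < sg * (z - c)) by lra.
  assert (Hyz : Rabs (z - zc) = e * L).
  { rewrite Ez. replace (zc + sg * (e * L) - zc) with (sg * (e * L)) by ring.
    rewrite Rabs_mult, Hsg, Rabs_right; lra. }
  assert (K := sf_layer HS z ltac:(lra)). fold A in K.
  assert (HNa : 0 < N / a) by (apply Rdiv_lt_0_compat; lra).
  assert (F0 : Rabs (sg * (l * z - h0 z) - a) <= (l + H1) * (sg * (z - c))).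
  { assert (Hcase : sg = 1 \/ sg = -1).
    { unfold Rabs in Hsg. destruct (Rcase_abs sg); [right|left]; lra. }
    destruct Hcase as [-> | ->].
    - replace (1 * (l * z - h0 z) - a) with (l * z - h0 z - a) by ring.
      rewrite Rmult_1_l. apply (ip_right_c IP). lra.
    - replace (-1 * (l * z - h0 z) - a) with (h0 z - l * z - a) by ring.
      replace (-1 * (z - c)) with (c - z) by ring. apply (ip_left_c IP). lra. }
  set (x := A * (e * L) / (2 * e)).
  assert (Ex : x = A * L / 2) by (unfold x; field; lra).
  assert (Hx : 0 <= x) by (rewrite Ex; assert (0 < A * L) by (apply Rmult_lt_0_compat; lra); lra).
  assert (Eth : tanh (A * (z - zc) / (2 * e)) = sg * tanh x).
  { assert (Hcase : sg = 1 \/ sg = -1).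
    { unfold Rabs in Hsg. destruct (Rcase_abs sg); [right|left]; lra. }
    destruct Hcase as [-> | ->].
    - rewrite Rmult_1_l. f_equal. rewrite Ez. unfold x. field. lra.
    - replace (-1 * tanh x) with (- tanh x) by ring. rewrite <- tanh_odd. f_equal.
      rewrite Ez. unfold x. field. lra. }
  rewrite Eth in K.
  destruct (tanh_gap x Hx) as [G1 G2].
  assert (G3 : 0 <= A - A * tanh x <= 2 / L).
  { split; [nra|]. apply Rmult_le_reg_r with L; [lra|].
    unfold Rdiv. rewrite (Rmult_assoc 2), Rinv_l, Rmult_1_r by lra. rewrite Ex in G2 at 1. lra. }
  assert (Hy2 : (z - zc) ^ 2 / e = e * L ^ 2).
  { rewrite <- pow2_abs, Hyz. field. lra. }
  rewrite Hy2, Hyz in K.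
  assert (T1 : N * (e * L ^ 2 + e * L) <= N * (2 * (27 / L))) by (apply Rmult_le_compat_l; lra).
  assert (HsL : sg * (z - c) <= 27 / L + N * (27 / L)).
  { assert (N * e <= N * (27 / L)) by (apply Rmult_le_compat_l; lra). lra. }
  assert (T2 : (l + H1) * (sg * (z - c)) <= (1 + H1) * (27 / L + N * (27 / L))).
  { apply Rmult_le_compat; lra. }
  assert (T3 : N / a * e <= N / a * (27 / L)) by (apply Rmult_le_compat_l; lra).
  assert (T4 : N * e <= N * (27 / L)) by (apply Rmult_le_compat_l; lra).
  set (D := 27 * (2 * N + (1 + H1) * (1 + N) + N / a) + 2).
  assert (HD : 0 < D).
  { assert (0 < (1 + H1) * (1 + N)) by (apply Rmult_lt_0_compat; lra). unfold D. lra. }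
  assert (Hd : Rabs (h z - h0 z) <= D / L).
  { replace (D / L) with (N * (2 * (27 / L)) + (1 + H1) * (27 / L + N * (27 / L)) + N / a * (27 / L) + 2 / L)
      by (unfold D; field; lra).
    replace (h z - h0 z) with (- (l * z - h z - A * (sg * tanh x)) + sg * ((sg * (l * z - h0 z) - a) + - (A - a) + (A - A * tanh x))).
    2: { replace (sg * ((sg * (l * z - h0 z) - a) + - (A - a) + (A - A * tanh x))) with
         (sg * sg * (l * z - h0 z) - A * (sg * tanh x)) by ring. rewrite Hsg2. ring. }
    eapply Rle_trans; [apply Rabs_triang|]. rewrite Rabs_Ropp, (Rabs_mult sg), Hsg, Rmult_1_l.
    assert (Rabs (sg * (l * z - h0 z) - a + - (A - a) + (A - A * tanh x)) <=
      (1 + H1) * (27 / L + N * (27 / L)) + N / a * (27 / L) + 2 / L); [|lra].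
    eapply Rle_trans; [apply Rabs_triang|]. rewrite (Rabs_right (A - A * tanh x)) by lra.
    apply Rplus_le_compat; [|lra].
    eapply Rle_trans; [apply Rabs_triang|]. rewrite Rabs_Ropp. lra. }
  assert (HiL : 0 < / L) by (apply Rinv_0_lt_compat; lra).
  assert (HNL : 0 < 27 * N * / L) by (apply Rmult_lt_0_compat; lra).
  assert (EC2 : C2 / L = (D / L + 27 * N * / L) * (2 + N)) by (unfold C2, D; field; lra).
  assert (HDL : 0 < D / L) by (apply Rdiv_lt_0_compat; lra).
  split; [auto|]. split.
  - rewrite EC2. apply Rle_trans with (27 * N * / L).
    + replace (27 * N * / L) with (N * (27 / L)) by (field; lra). lra.
    + nra.
  - assert (N * e <= N * 1) by (apply Rmult_le_compat_l; lra).
    rewrite EC2. apply Rmult_le_compat; try apply Rabs_pos; lra.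
Qed.

Lemma outer_estimate alpha z : 0 < alpha < 1 -> ~ layer 1 e zc z ->
  Rabs (Rpower (1 + Rabs z) alpha * (h z - h0 z)) <= (1 + Rabs c) * C2 / L.
Proof.
  intros Hal Hz. unfold layer in Hz. fold L in Hz. rewrite Rmult_1_l in Hz.
  assert (HeL : 0 < e * L) by (apply Rmult_lt_0_compat; lra).
  assert (Hd : Rabs (h z - h0 z) * (1 + Rabs (z - c)) <= C2 / L).
  { destruct (Rle_lt_dec (zc - e * L) z) as [H|H].
    - assert (Hzr : zc + e * L < z) by (destruct (Rle_lt_dec z (zc + e * L)); [tauto|auto]).
      destruct (edge_estimate 1 (zc + e * L) Rabs_R1 ltac:(ring)) as [E1 [E2 E3]].
      rewrite Rmult_1_l in E1, E3.
      rewrite (Rabs_right (z - c)) by lra.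
      apply (sf_outer_right HS (zc + e * L)); auto; lra.
    - destruct (edge_estimate (-1) (zc - e * L) ltac:(rewrite Rabs_left; lra) ltac:(ring)) as [E1 [E2 E3]].
      replace (-1 * (zc - e * L - c)) with (c - (zc - e * L)) in E1, E3 by ring.
      rewrite (Rabs_left (z - c)) by lra. replace (- (z - c)) with (c - z) by ring.
      apply (sf_outer_left HS (zc - e * L)); auto; lra. }
  assert (Hp := Rabs_pos z). assert (Hpc := Rabs_pos c). assert (Hpd := Rabs_pos (z - c)).
  assert (Hw : Rpower (1 + Rabs z) alpha <= (1 + Rabs c) * (1 + Rabs (z - c))).
  { eapply Rle_trans; [apply Rpower_le_base; lra|].
    assert (T := Rabs_triang (z - c) c). replace (z - c + c) with z in T by ring. nra. }
  rewrite Rabs_mult, (Rabs_right (Rpower _ _)) by (apply Rle_ge; left; apply exp_pos).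
  apply Rle_trans with ((1 + Rabs c) * (1 + Rabs (z - c)) * Rabs (h z - h0 z)).
  - apply Rmult_le_compat_r; [apply Rabs_pos|auto].
  - replace ((1 + Rabs c) * C2 / L) with ((1 + Rabs c) * (C2 / L)) by (field; lra).
    rewrite Rmult_assoc, (Rmult_comm (1 + Rabs (z - c))). apply Rmult_le_compat_l; lra.
Qed.
End Asymptotics.

(** * The theorem *)

Lemma filterlim_at_right_0 (u : R -> R) (x B d : R) : 0 < d -> 0 < B ->
  (forall e, 0 < e < d -> Rabs (u e - x) <= B * e) -> filterlim u (at_right 0) (locally x).
Proof.
  intros Hd HB H. apply filterlim_locally. intros eta. assert (Heta := cond_pos eta).
  assert (HeB : 0 < eta / B) by now apply Rdiv_lt_0_compat.
  apply at_right_0 with (Rmin d (eta / B)); [now apply Rmin_glb_lt|].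
  intros e He. assert (M1 := Rmin_l d (eta / B)). assert (M2 := Rmin_r d (eta / B)).
  change (Rabs (u e - x) < eta). eapply Rle_lt_trans; [apply H; lra|].
  apply Rlt_le_trans with (B * (eta / B)). apply Rmult_lt_compat_l; lra. right; field; lra.
Qed.

(** [a = sqrt (l^2 zc^2 - 2 g p)] inherits the regularity of [zc] and [p]. *)
Lemma amplitude_C1 l e1 m (zc p : R -> R) : 0 < m ->
  C1_on (fun e => 0 < e < e1) zc -> C1_on (fun e => 0 < e < e1) p ->
  (forall e, 0 < e < e1 -> m <= amplitude2 l (zc e) (p e)) ->
  C1_on (fun e => 0 < e < e1) (fun e => sqrt (amplitude2 l (zc e) (p e))) /\
  forall e, 0 < e < e1 -> Derive (fun e => sqrt (amplitude2 l (zc e) (p e))) e =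
    (l ^ 2 * zc e * Derive zc e - (2 * l - 1) * Derive p e) * / sqrt (amplitude2 l (zc e) (p e)).
Proof.
  intros Hm0 Hz Hp Hm.
  set (a := fun e => sqrt (amplitude2 l (zc e) (p e))).
  set (G := fun e => (l ^ 2 * zc e * Derive zc e - (2 * l - 1) * Derive p e) * / a e).
  assert (Ha : forall e, 0 < e < e1 -> 0 < a e).
  { intros e He. apply sqrt_lt_R0. specialize (Hm e He). lra. }
  assert (HD : forall e, 0 < e < e1 -> is_derive a e (G e)).
  { intros e He. specialize (Hm e He). assert (Hae := Ha e He).
    destruct (Hz e He) as [Z1 _]. destruct (Hp e He) as [Q1 _].
    assert (D1 := Derive_correct _ _ Z1). assert (D2 := Derive_correct _ _ Q1).
    assert (D3 : is_derive (fun e => amplitude2 l (zc e) (p e)) e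
      (2 * (l ^ 2 * zc e * Derive zc e - (2 * l - 1) * Derive p e))).
    { unfold amplitude2. der. ring. }
    evar_last.
    - apply (der_comp sqrt (fun e => amplitude2 l (zc e) (p e))); [exact D3|].
      apply is_derive_Reals. apply derivable_pt_lim_sqrt. lra.
    - unfold G. fold (a e). field. lra. }
  split.
  - intros e He. split; [exists (G e); auto|].
    apply continuous_ext_loc with G.
    + set (r := Rmin e (e1 - e)). assert (Hr : 0 < r) by (apply Rmin_glb_lt; lra).
      exists (mkposreal r Hr). intros y Hy. change (Rabs (y - e) < r) in Hy.
      assert (M1 := Rmin_l e (e1 - e)). assert (M2 := Rmin_r e (e1 - e)). fold r in M1, M2.
      apply Rabs_def2 in Hy. symmetry. apply is_derive_unique, HD. lra.
    + destruct (Hz e He) as [[z1 Z1] Z2]. destruct (Hp e He) as [[q1 Q1] Q2].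
      unfold G. apply continuous_R_mult.
      * apply continuous_R_minus; apply continuous_R_mult; auto; [|apply continuous_const].
        apply continuous_R_mult; [apply continuous_const|]. eapply continuous_of_derive, Z1.
      * apply continuous_Rinv_comp; [eapply continuous_of_derive, HD, He|].
        specialize (Ha e He). lra.
  - intros e He. apply is_derive_unique, HD, He.
Qed.

Theorem proposition1p3 (alpha kp km : R)
    (Halpha : 0 < alpha < 1) (Hkp : 0 < kp) (Hkm : 0 < km) :
  exists w0 : R, 0 < w0 /\
  forall (zc0 a0 : R) (h0 : R -> R) (h0r h0l : R),
    limit_profile alpha kp km zc0 a0 h0 ->
    filterlim h0 (at_right zc0) (locally h0r) ->
    filterlim h0 (at_left zc0) (locally h0l) ->
  exists (eps0 : R) (zc a : R -> R) (h : R -> R -> R),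
    0 < eps0 /\
    C1_on (fun eps => 0 < eps < eps0) zc /\
    C1_on (fun eps => 0 < eps < eps0) a /\
    filterlim zc (at_right 0) (locally zc0) /\
    filterlim a (at_right 0) (locally ((h0l - h0r) / 2)) /\
    (forall eps, 0 < eps < eps0 ->
       viscous_solution alpha eps (zc eps) (a eps) (h eps) /\
       (forall g, viscous_solution alpha eps (zc eps) (a eps) g ->
          forall z, g z = h eps z) /\
       power_tail alpha kp p_infty (h eps) /\
       power_tail alpha km m_infty (h eps)) /\
    vanishes_at_0 (fun eps =>
      Linf_norm (layer w0 eps (zc eps))
        (fun z => h eps z - h0r
           - 2 * a eps * exp (- a eps * ((z - zc eps) / eps))
             / (1 + exp (- a eps * ((z - zc eps) / eps))))) /\
    vanishes_at_0 (fun eps =>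
      Linf_norm (fun z => ~ layer w0 eps (zc eps) z)
        (fun z => Rpower (1 + Rabs z) alpha * (h eps z - h0 z))) /\
    exists K : R, 0 < K /\
      forall eps, 0 < eps < eps0 ->
        Rabs (Derive zc eps) + Rabs (Derive a eps) <= K * (ln (1 / eps)) ^ 2.
Proof.
  (* any width would do: both [|zc eps - zc0|] and the thickness of the layer are
     negligible against [eps ln (1/eps)] *)
  exists 1. split; [lra|].
  intros c a0 h0 h0r h0l [Hc [Hac [Hpos [Hreg [Hode [Hr [Hlf [Htp Htm]]]]]]]] Hr' Hl'.
  set (l := / (1 + alpha)).
  assert (Hl : / 2 < l < 1).
  { unfold l. split; [apply Rinv_lt_contravar; lra|].
    rewrite <- Rinv_1. apply Rinv_lt_contravar; lra. }
  assert (El1 : alpha / (1 + alpha) = 1 - l) by (unfold l; field; lra).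
  assert (El : forall z, z / (1 + alpha) = l * z) by (intros; unfold l; field; lra).
  rewrite El in Hr, Hlf. rewrite El1, El in Hac.
  assert (E0r : h0r = l * c - a0) by exact (filterlim_locally_unique h0 _ _ Hr' Hr).
  assert (E0l : h0l = l * c + a0) by exact (filterlim_locally_unique h0 _ _ Hl' Hlf).
  destruct (profile_facts l c a0 h0 (Derive h0) Hl Hc Hac Hpos) as [k0 [Hm [H1 IP]]].
  { intros z Hz. apply Derive_correct. exact (Hreg 1%nat z Hz). }
  { intros z Hz. specialize (Hode z Hz). rewrite El1, El in Hode. exact Hode. }
  { apply at_right_ed, Hr. }
  { apply at_left_ed, Hlf. }
  assert (Ha0 := ip_a IP). assert (HH1 := ip_H1 IP).
  set (g := 2 * l - 1). assert (Hg : 0 < g < 1) by (unfold g; lra).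
  set (C0 := 2 * (H1 + 2 * (l + H1) + 2 * g) / g + 2).
  assert (HC0 : 0 < C0).
  { assert (0 < 2 * (H1 + 2 * (l + H1) + 2 * g) / g) by (apply Rdiv_lt_0_compat; lra). unfold C0. lra. }
  destruct (solution_facts_uniform l c a0 k0 Hm H1 C0 h0 (Derive h0) Hl IP HC0) as [N [e1 [HN [He1 Hfacts]]]].
  (* below [eps0], [ln (1/eps)] exceeds 1 and [N] *)
  set (eps0 := Rmin (Rmin e1 1) (exp (- (N + 1)))).
  assert (He0 : 0 < eps0 /\ eps0 <= e1 /\ eps0 <= 1 /\ eps0 <= exp (- (N + 1))).
  { unfold eps0. assert (M1 := Rmin_l (Rmin e1 1) (exp (- (N + 1)))).
    assert (M2 := Rmin_r (Rmin e1 1) (exp (- (N + 1)))).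
    assert (M3 := Rmin_l e1 1). assert (M4 := Rmin_r e1 1).
    split; [repeat apply Rmin_glb_lt; try lra; apply exp_pos|lra]. }
  assert (HL : forall e, 0 < e < eps0 -> N + 1 < ln (1 / e)).
  { intros e He. rewrite <- (ln_exp (N + 1)). apply ln_increasing; [apply exp_pos|].
    unfold Rdiv. rewrite Rmult_1_l, <- (Rinv_inv (exp (N + 1))), <- exp_Ropp.
    apply Rinv_lt_contravar; [|lra]. apply Rmult_lt_0_compat; [lra|apply exp_pos]. }
  assert (Hex : forall e, exists T : (R -> R) * (R -> R) * R, 0 < e < eps0 ->
    viscous_potential g l e (fun _ => True) (fst (fst T)) (snd (fst T)) /\
    (forall z, Rabs (fst (fst T) z - potential0 l c a0 h0 z) <= C0 * e) /\
    solution_facts l c a0 h0 N e (fst (fst T)) (snd (fst T)) (snd T)).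
  { intros e. destruct (Rlt_dec 0 e) as [Hp|Hp].
    2: { exists (fun _ => 0, fun _ => 0, 0). intros; lra. }
    destruct (viscous_potential_near l c a0 k0 Hm H1 h0 (Derive h0) Hl IP e Hp) as [P [h [HP HPP]]].
    destruct (Rlt_dec e e1) as [Hlt|Hge].
    - destruct (Hfacts e P h (conj Hp Hlt) HP HPP) as [z Hz].
      exists (P, h, z). intros _. simpl. auto.
    - exists (fun _ => 0, fun _ => 0, 0). intros; lra. }
  destruct (functional_choice _ Hex) as [T HT]. clear Hex.
  set (P := fun e => fst (fst (T e))). set (h := fun e => snd (fst (T e))). set (zc := fun e => snd (T e)).
  assert (HP : forall e, 0 < e < eps0 -> viscous_potential g l e (fun _ => True) (P e) (h e))
    by (intros e He; apply (HT e He)).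
  assert (HPP : forall e, 0 < e < eps0 -> forall z, Rabs (P e z - potential0 l c a0 h0 z) <= C0).
  { intros e He z. destruct (HT e He) as [_ [K _]]. eapply Rle_trans; [apply K|].
    rewrite <- (Rmult_1_r C0) at 2. apply Rmult_le_compat_l; lra. }
  assert (HS : forall e, 0 < e < eps0 -> solution_facts l c a0 h0 N e (P e) (h e) (zc e))
    by (intros e He; apply (HT e He)).
  clear HT Hfacts.
  destruct (crossing_C1 l c a0 C0 N eps0 h0 (potential0 l c a0 h0) P h zc Hl HC0 HN
    ltac:(lra) HP HPP HS) as [K [HK Hslopes]].
  assert (Hch : forall e, exists D : R * R, 0 < e < eps0 ->
    pair_limit (fun x y => (zc x - zc y) / (x - y)) e (fst D) /\
    pair_limit (fun x y => (P x (zc x) - P y (zc y)) / (x - y)) e (snd D) /\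
    Rabs (fst D) <= K * (1 + ln (1 / e)) /\ Rabs (snd D) <= K * (1 + ln (1 / e))).
  { intros e. destruct (Rlt_dec 0 e) as [Hp|Hp]; [|exists (0, 0); intros; lra].
    destruct (Rlt_dec e eps0) as [Hlt|Hge]; [|exists (0, 0); intros; lra].
    destruct (Hslopes e (conj Hp Hlt)) as [dz [dp H]]. exists (dz, dp). auto. }
  destruct (functional_choice _ Hch) as [D HD]. clear Hch Hslopes.
  destruct (pair_limit_C1 zc (fun e => fst (D e)) eps0) as [Cz Dz].
  { intros e He. apply (HD e He). }
  destruct (pair_limit_C1 (fun e => P e (zc e)) (fun e => snd (D e)) eps0) as [Cp Dp].
  { intros e He. apply (HD e He). }
  set (a := fun e => sqrt (amplitude2 l (zc e) (P e (zc e)))).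
  assert (HiN : 0 < / N) by now apply Rinv_0_lt_compat.
  assert (Hamp : forall e, 0 < e < eps0 -> / N <= amplitude2 l (zc e) (P e (zc e)))
    by (intros e He; apply (sf_amp_low (HS e He))).
  destruct (amplitude_C1 l eps0 (/ N) zc (fun e => P e (zc e)) HiN Cz Cp Hamp) as [Ca Da].
  exists eps0, zc, a, h.
  split; [lra|]. split; [exact Cz|]. split; [exact Ca|]. split; [|split; [|split; [|split; [|split]]]].
  - apply (filterlim_at_right_0 zc c N eps0); try lra.
    intros e He. apply (sf_loc (HS e He)).
  - replace ((h0l - h0r) / 2) with a0 by (rewrite E0l, E0r; field).
    apply (filterlim_at_right_0 a a0 (N / a0) eps0); try lra.
    + apply Rdiv_lt_0_compat; lra.
    + intros e He. apply (amplitude_near l c a0 k0 Hm H1 N e h0 (Derive h0) (P e) (h e) (zc e)); auto; lra.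
  - intros e He.
    assert (Hvs : viscous_solution alpha e (zc e) (a e) (h e)).
    { apply (viscous_solution_of_potential alpha e (P e)); try lra.
      - apply (HP e He).
      - apply (sf_zero (HS e He)).
      - unfold a. fold l. apply pow2_sqrt. specialize (Hamp e He). lra. }
    split; [exact Hvs|]. split; [|split].
    + intros u Hu. apply (viscous_solution_unique alpha e (zc e) (a e)); auto; lra.
    + apply (power_tail_transfer alpha kp p_infty h0 (h e) c N); auto.
      apply (sf_tail (HS e He)).
    + apply (power_tail_transfer alpha km m_infty h0 (h e) c N); auto.
      apply (sf_tail (HS e He)).
  - assert (HNa : 0 < N / a0) by (apply Rdiv_lt_0_compat; lra).
    apply vanishes_of_bound with (27 * (2 * N + 1 + N + N / a0)) eps0; try lra.
    intros e He. assert (HLe := HL e He). split; [lra|]. intros z Hz. rewrite E0r.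
    apply (layer_estimate l c a0 k0 Hm H1 N e h0 (Derive h0) (P e) (h e) (zc e)); auto; lra.
  - assert (HNa : 0 < N / a0) by (apply Rdiv_lt_0_compat; lra).
    set (C2 := (27 * (2 * N + (1 + H1) * (1 + N) + N / a0) + 2 + 27 * N) * (2 + N)).
    assert (HC2 : 0 < C2).
    { assert (0 < (1 + H1) * (1 + N)) by (apply Rmult_lt_0_compat; lra).
      apply Rmult_lt_0_compat; lra. }
    assert (Hpc := Rabs_pos c).
    apply vanishes_of_bound with ((1 + Rabs c) * C2) eps0; try lra.
    { apply Rmult_le_pos; lra. }
    intros e He. assert (HLe := HL e He). split; [lra|]. intros z Hz.
    apply (outer_estimate l c a0 k0 Hm H1 N e h0 (Derive h0) (P e) (h e) (zc e)); auto; lra.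
  - set (b := sqrt (/ N)). assert (Hb : 0 < b) by now apply sqrt_lt_R0.
    assert (Hpc := Rabs_pos c).
    set (K1 := (Rabs c + N + 1) * K / b).
    assert (HK1 : 0 < K1) by (apply Rdiv_lt_0_compat; auto; apply Rmult_lt_0_compat; lra).
    exists (2 * (K + K1)). split; [lra|]. intros e He.
    destruct (HD e He) as [_ [_ [B1 B2]]]. assert (HLe := HL e He).
    set (L := ln (1 / e)) in *.
    fold a in Da. rewrite (Da e He). cbv beta. rewrite (Dp e He), (Dz e He). fold (a e).
    assert (Hab : b <= a e) by (apply sqrt_le_1_alt, Hamp, He).
    assert (Hzc : Rabs (zc e) <= Rabs c + N).
    { assert (Kz := sf_loc (HS e He)).
      assert (T1 := Rabs_triang (zc e - c) c). replace (zc e - c + c) with (zc e) in T1 by ring.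
      assert (N * e <= N * 1) by (apply Rmult_le_compat_l; lra). lra. }
    assert (HKL : 0 < K * (1 + L)) by (apply Rmult_lt_0_compat; lra).
    assert (B3 : Rabs ((l ^ 2 * zc e * fst (D e) - (2 * l - 1) * snd (D e)) * / a e) <= K1 * (1 + L)).
    { rewrite Rabs_mult, (Rabs_right (/ a e)).
      2: { apply Rle_ge. left. apply Rinv_0_lt_compat. lra. }
      replace (K1 * (1 + L)) with ((Rabs c + N + 1) * (K * (1 + L)) * / b) by (unfold K1; field; lra).
      apply Rmult_le_compat; [apply Rabs_pos|left; apply Rinv_0_lt_compat; lra| |apply Rinv_le_contravar; lra].
      eapply Rle_trans; [apply Rabs_triang|]. rewrite Rabs_Ropp, !Rabs_mult.
      rewrite (Rabs_right (l ^ 2)), (Rabs_right (2 * l - 1)) by nra.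
      assert (P1 := Rabs_pos (zc e)). assert (P2 := Rabs_pos (fst (D e))). assert (P3 := Rabs_pos (snd (D e))).
      assert (Q1 : Rabs (zc e) * Rabs (fst (D e)) <= (Rabs c + N) * (K * (1 + L)))
        by (apply Rmult_le_compat; lra).
      assert (Q2 : l ^ 2 * Rabs (zc e) * Rabs (fst (D e)) <= 1 * (Rabs (zc e) * Rabs (fst (D e)))).
      { rewrite Rmult_assoc. apply Rmult_le_compat_r; [apply Rmult_le_pos; lra|nra]. }
      assert (Q3 : (2 * l - 1) * Rabs (snd (D e)) <= 1 * Rabs (snd (D e))) by (apply Rmult_le_compat_r; lra).
      lra. }
    assert (HL2 : 1 + L <= 2 * L ^ 2) by nra.
    apply Rle_trans with ((K + K1) * (1 + L)); [lra|].
    replace (2 * (K + K1) * L ^ 2) with ((K + K1) * (2 * L ^ 2)) by ring.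
    apply Rmult_le_compat_l; lra.
Qed.
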